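(* Let $\Gamma$ be a simple connected cubic vertex-transitive graph of girth $7$. Then it is one of the following: 1. $\Gamma$ has signature $(0,1,1)$ and is isomorphic to the truncation of a $7$-regular graph $\Lambda$ (possibly with parallel edges) with respect to an arc-transitive dihedral scheme $\leftrightarrow$ on $\Lambda$. 2. $\Gamma$ has signature $(2,2,2)$ and is the skeleton of a rotary map of type $\{7,3\}$ embedded on a surface with Euler characteristic $\chi = n\left(\frac{3}{7}-\frac{1}{2}\right)$, where $n=|V(\Gamma)|$. 3. $\Gamma$ has signature $(4,4,4)$ and is (isomorphic to) the Coxeter graph. 4. $\Gamma$ has signature $(4,4,6)$ and is isomorphic to the Cayley graph $\mathbf{A}(3n)$ for some integer $n\geq 3$. 5. $\Gamma$ has signature $(4,5,5)$ and is (isomorphic to) one of the generalised Petersen graphs $\mathrm{Pet}(13,5)$, $\mathrm{Pet}(15,4)$ and $\mathrm{Pet}(17,4)$.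
   Context: All graphs are finite, and simple unless stated otherwise. A graph is vertex-transitive if its automorphism group acts transitively on its vertices. Signature. Let $\Gamma$ be a simple cubic graph of girth $g$. A girth cycle is a cycle of length $g$; cycles are counted as subgraphs. For an edge $e$, $\epsilon(e)$ is the number of girth cycles containing $e$. The signature of a vertex $v$ is the triple $(\epsilon(e_1),\epsilon(e_2),\epsilon(e_3))$, where $e_1,e_2,e_3$ are the edges incident to $v$ ordered so that $\epsilon(e_1)\le\epsilon(e_2)\le\epsilon(e_3)$. If all vertices have the same signature $(a,b,c)$, then $\Gamma$ is girth-regular with signature $(a,b,c)$; vertex-transitive graphs are always girth-regular. Dihedral schemes and truncations. Let $\Lambda$ be a graph (possibly with parallel edges) and let $A(\Lambda)$ be its set of arcs (each edge underlies two arcs, one for each orientation). A dihedral scheme on $\Lambda$ is an irreflexive symmetric relation $\leftrightarrow$ on $A(\Lambda)$ such that the connected components of the simple graph with vertex set $A(\Lambda)$ and edge set $\{uv \mid u\leftrightarrow v\}$ are cycles, each cycle containing precisely all the arcs with the same beginning (initial vertex). The truncation of $\Lambda$ with respect to $\leftrightarrow$ is the simple graph with vertex set $A(\Lambda)$ in which two arcs $u,v$ are adjacent when $u\leftrightarrow v$ or when $u$ and $v$ have the same underlying edge. $\mathrm{Aut}(\Lambda,\leftrightarrow)$ is the group of all automorphisms of $\Lambda$ that preserve $\leftrightarrow$; the scheme is arc-transitive if $\mathrm{Aut}(\Lambda,\leftrightarrow)$ acts transitively on $A(\Lambda)$. Maps. A (trivalent) map is a pair $M=(\Gamma,\mathcal{C})$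 where $\Gamma$ is a simple cubic graph and $\mathcal{C}$ is a set of cycles of $\Gamma$ such that every edge of $\Gamma$ is contained in precisely two cycles of $\mathcal{C}$. The elements of $\mathcal{C}$ are the faces, and $\Gamma$ is the skeleton of $M$. The surface of the map is obtained by gluing a disc along each face, so its Euler characteristic is $\chi=|V(\Gamma)|-|E(\Gamma)|+|\mathcal{C}|$. The map is of type $\{k,3\}$ if every cycle in $\mathcal{C}$ has length $k$. $\mathrm{Aut}(M)$ consists of all automorphisms of $\Gamma$ that preserve $\mathcal{C}$. The map is rotary if, in $\mathrm{Aut}(M)$, the stabiliser of each vertex contains a cyclic group acting transitively on the edges incident to that vertex, and the stabiliser of each face contains a cyclic group acting transitively on the vertices of the face. The graphs $\mathbf{A}(m)$. For an integer $m\ge 8$, $\mathbf{A}(m)$ is the graph with vertex set $\{x_i,y_i,a_i,b_i \mid i\in\mathbb{Z}_m\}$ ($4m$ distinct vertices) and edge set $\{x_ix_{i+1},\ x_iy_i,\ y_ia_i,\ a_ib_i,\ b_iy_{i+2},\ a_ib_{i+1} \mid i\in\mathbb{Z}_m\}$. Generalised Petersen graphs. $\mathrm{Pet}(n,k)$ is the graph with $2n$ vertices $u_i,v_i$ ($i\in\mathbb{Z}_n$) and edges $u_iu_{i+1}$, $u_iv_i$, $v_iv_{i+k}$ for $i\in\mathbb{Z}_n$. The Coxeter graph is the graph on $28$ vertices whose vertices are the $3$-subsets of the point set of the Fano plane that are not lines, two being adjacent when they are disjoint. *)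

(* Defs.v *)
From HB Require Import structures.
From mathcomp Require Import all_boot all_order all_algebra all_fingroup all_solvable.

Set Implicit Arguments.
Unset Strict Implicit.
Unset Printing Implicit Defensive.

Import GRing.Theory.

(* A finite simple graph is a symmetric irreflexive relation on a finType. *)

Definition graph_iso (T U : Type) (e : rel T) (e' : rel U) : Prop :=
  exists2 f : T -> U, bijective f & forall x y, e' (f x) (f y) = e x y.

Definition graph_connected (T : finType) (e : rel T) : Prop :=
  forall x y, connect e x y.

Definition cubic (T : finType) (e : rel T) : Prop :=
  forall x, #|[set y | e x y]| = 3.

Definition edges (T : finType) (e : rel T) : {set {set T}} :=
  [set [set p.1; p.2] | p : T * T & e p.1 p.2].

Definition edges_at (T : finType) (e : rel T) (v : T) : {set {set T}} :=
  [set E in edges e | v \in E].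

Definition graph_aut (T : finType) (e : rel T) : {set {perm T}} :=
  [set s : {perm T} | [forall x, forall y, e (s x) (s y) == e x y]].

Fact graph_aut_group_set (T : finType) (e : rel T) : group_set (graph_aut e).
Proof.
apply/group_setP; split=> [|s t].
  by rewrite inE; apply/'forall_forallP=> x y; rewrite !perm1.
rewrite !inE => /'forall_forallP es /'forall_forallP et.
apply/'forall_forallP=> x y.
by rewrite !permM (eqP (et _ _)) (eqP (es _ _)).
Qed.

Canonical graph_aut_group (T : finType) (e : rel T) :=
  Group (graph_aut_group_set e).

Definition vertex_transitive (T : finType) (e : rel T) : Prop :=
  [transitive graph_aut e, on [set: T] | 'P].

(* A cycle is a subgraph without isolated vertices, so it is identified with
   its edge set: it does not depend on a starting point or an orientation. *)
Definition cycle_edges (T : finType) (c : seq T) : {set {set T}} :=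
  [set [set x; next c x] | x in c].

Definition kcycle (T : finType) (e : rel T) (k : nat) (F : {set {set T}}) : bool :=
  (2 < k) && [exists c : k.-tuple T, ucycleb e c && (F == cycle_edges c)].

(* The value is #|T|.+1 when the graph has no cycle. *)
Definition girth (T : finType) (e : rel T) : nat :=
  find (fun k => [exists F, kcycle e k F]) (iota 0 #|T|.+1).

Definition girth_cycles_through (T : finType) (e : rel T) (E : {set T}) : nat :=
  #|[set F | kcycle e (girth e) F & E \in F]|.

Definition vertex_signature (T : finType) (e : rel T) (v : T) : seq nat :=
  sort leq [seq girth_cycles_through e E | E <- enum (edges_at e v)].

Definition has_signature (T : finType) (e : rel T) (a b c : nat) : Prop :=
  forall v, vertex_signature e v = [:: a; b; c].

(* Loopless multigraphs: parallel edges are distinct elements of [mgE] with the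
   same pair of ends. *)
Record multigraph := Multigraph {
  mgV : finType;
  mgE : finType;
  mg_ends : mgE -> {set mgV};
  mg_endsP : forall d, #|mg_ends d| = 2
}.

Definition mg_regular (L : multigraph) (k : nat) : Prop :=
  forall v : mgV L, #|[set d | v \in mg_ends d]| = k.

(* The arc (d, v) is the edge d oriented so that it begins at its end v. *)
Definition mg_arc (L : multigraph) : finType :=
  {a : mgE L * mgV L | a.2 \in mg_ends a.1}.

Definition arc_edge (L : multigraph) (a : mg_arc L) : mgE L := (val a).1.
Definition arc_begin (L : multigraph) (a : mg_arc L) : mgV L := (val a).2.

Record mg_aut (L : multigraph) := MgAut {
  mg_autV : {perm mgV L};
  mg_autE : {perm mgE L};
  mg_autP : forall d, mg_ends (mg_autE d) = mg_autV @: mg_ends d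
}.

Fact mg_aut_arc_subproof (L : multigraph) (g : mg_aut L) (a : mg_arc L) :
  mg_autV g (arc_begin a) \in mg_ends (mg_autE g (arc_edge a)).
Proof. by rewrite mg_autP imset_f //; exact: (valP a). Qed.

Definition mg_aut_arc (L : multigraph) (g : mg_aut L) (a : mg_arc L) : mg_arc L :=
  exist _ (mg_autE g (arc_edge a), mg_autV g (arc_begin a))
    (mg_aut_arc_subproof g a).

Definition component_is_cycle (T : finType) (r : rel T) (x : T) : Prop :=
  exists c : seq T,
    [/\ 2 < size c, uniq c, c =i connect r x
      & {in c &, forall y z, r y z = (z == next c y) || (y == next c z)}].

Definition dihedral_scheme (L : multigraph) (r : rel (mg_arc L)) : Prop :=
  [/\ irreflexive r, symmetric r, forall a, component_is_cycle r a
    & forall a b, connect r a b = (arc_begin a == arc_begin b)].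

Definition scheme_arc_transitive (L : multigraph) (r : rel (mg_arc L)) : Prop :=
  forall a b, exists2 g : mg_aut L,
    forall u v, r (mg_aut_arc g u) (mg_aut_arc g v) = r u v & mg_aut_arc g a = b.

Definition truncation (L : multigraph) (r : rel (mg_arc L)) : rel (mg_arc L) :=
  fun a b => r a b || ((a != b) && (arc_edge a == arc_edge b)).

(* A trivalent map is given by its skeleton e and its set C of faces. *)
Definition cubic_map (T : finType) (e : rel T) (C : {set {set {set T}}}) : Prop :=
  [/\ cubic e, forall F, F \in C -> exists k, kcycle e k F
    & forall E, E \in edges e -> #|[set F in C | E \in F]| = 2].

Definition map_type (T : finType) (e : rel T) (C : {set {set {set T}}})
    (k : nat) : Prop :=
  forall F, F \in C -> kcycle e k F.

Definition euler_char (T : finType) (e : rel T) (C : {set {set {set T}}}) : int :=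
  (#|T|%:Z - #|edges e|%:Z + #|C|%:Z)%R.

(* 'P^* acts on sets of vertices (edges) and 'P^*^* on sets of edges (cycles). *)
Definition map_aut (T : finType) (e : rel T) (C : {set {set {set T}}}) :
    {set {perm T}} :=
  'N_(graph_aut e)(C | 'P^*^*)%g.

(* The vertex set of a face F is cover F, the union of its edges. *)
Definition rotary (T : finType) (e : rel T) (C : {set {set {set T}}}) : Prop :=
  (forall v : T, exists H : {group {perm T}},
     [/\ cyclic H, H \subset 'C_(map_aut e C)[v | 'P]%g
       & [transitive H, on edges_at e v | 'P^*]]) /\
  (forall F, F \in C -> exists H : {group {perm T}},
     [/\ cyclic H, H \subset 'C_(map_aut e C)[F | 'P^*^*]%g
       & [transitive H, on cover F | 'P]]).

Inductive Avertex (m : nat) : Type :=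
  | Ax of 'Z_m | Ay of 'Z_m | Aa of 'Z_m | Ab of 'Z_m.

Definition Aarc (m : nat) (u v : Avertex m) : bool :=
  match u, v with
  | Ax i, Ax j => j == (i + 1)%R
  | Ax i, Ay j => j == i
  | Ay i, Aa j => j == i
  | Aa i, Ab j => (j == i) || (j == (i + 1)%R)
  | Ab i, Ay j => j == (i + 2)%R
  | _, _ => false
  end.

(* Meant for m >= 8. *)
Definition Agraph (m : nat) : rel (Avertex m) :=
  fun u v => Aarc u v || Aarc v u.
Arguments Agraph : clear implicits.

Definition is_cayley_graph (T : Type) (e : rel T) : Prop :=
  exists (gT : finGroupType) (S : {set gT}),
    [/\ 1%g \notin S, forall s, s \in S -> s^-1%g \in S
      & graph_iso e (fun g h : gT => (g^-1 * h)%g \in S)].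

Inductive PetVertex (n : nat) : Type := Pu of 'Z_n | Pv of 'Z_n.

Definition PetArc (n k : nat) (x y : PetVertex n) : bool :=
  match x, y with
  | Pu i, Pu j => j == (i + 1)%R
  | Pu i, Pv j => j == i
  | Pv i, Pv j => j == (i + k%:R)%R
  | _, _ => false
  end.

(* Meant for n > 1, since 'Z_0 and 'Z_1 have two elements. *)
Definition Pet (n k : nat) : rel (PetVertex n) :=
  fun x y => PetArc k x y || PetArc k y x.
Arguments Pet : clear implicits.

(* The Fano plane as the translates of the difference set {0, 1, 3}. *)
Definition fano_lines : {set {set 'Z_7}} :=
  [set [set i; i + 1; i + 3]%R | i : 'Z_7].

Definition CoxeterVertex : Type :=
  {t : {set 'Z_7} | (#|t| == 3) && (t \notin fano_lines)}.

Definition Coxeter_graph : rel CoxeterVertex :=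
  fun s t => [disjoint val s & val t].

(* Main.v *)
Require Import Defs.
From HB Require Import structures.
From mathcomp Require Import all_boot all_order all_algebra all_fingroup all_solvable.
From mathcomp Require Import zify lra.

(** The proof counts heptagons, that is, 7-cycles read from a vertex in a
    direction. Girth 7 makes every non-backtracking closed walk of length at
    most six impossible, and a heptagon is determined by four consecutive edges;
    so at most 24 of them start at a vertex. An invariant property of the edges
    or turns of a heptagon makes it a word of seven letters, and by
    vertex-transitivity all rotations of a word are read equally often at each
    vertex (count_rot): one heptagon whose seven rotations have distinct words is
    seven heptagons at each vertex.

    Let M be a perfect matching preserved by all automorphisms. The edges of a
    heptagon in M form one of five palindromic patterns: none, one edge, two
    edges with two or one others between them, or three edges. A pattern with
    edges in M accounts for 14 heptagons per vertex, so at most one occurs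
    (pattern_counts), and a heptagon without edges in M is a component of the
    2-factor off M, so it accounts for 2 at most. These numbers imply that
    either M can be chosen such that the two other edges at a vertex are in
    equally many heptagons, or the group is arc-transitive
    (matching_or_arc_transitive).

    In the first case the components of the 2-factor off M, unrolled to lines
    indexed by the integers, are followed from heptagon to heptagon. If no
    heptagon meets M, the components are disjoint heptagons, and contracting
    them exhibits the graph as a truncation (truncation_of_quotient). One edge in
    M closes a 4-cycle (no_pat1). For two edges, the mates of the vertices of a
    line x, taken with step 2 or 4, form stretches of length 3 or 1 of another
    line; doing this twice returns to x and bounds its period, which must be 13,
    or 15 or 17: these are the generalised Petersen graphs (pet13, pet15_17).
    For three edges, consecutive heptagons along a line build the remaining
    vertices of A(m) (ladder_step), and comparison of the lines of the ladder
    shows that 3 divides m (Agraph_iso). A(3n) is a Cayley graph of a semidirect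
    product of a four-group by a cyclic group (Agraph_cayley).

    In the arc-transitive case, letters for the two ways to turn after an arc, or
    after a 2-arc, show that each 2-arc or each 3-arc is in exactly one heptagon
    (arc_transitive_counts); the obstacle is a graph where each 4-arc is in a
    heptagon, and such a Moore graph does not exist (no_moore). With one heptagon
    per 2-arc, the heptagons are the faces of a map, and an automorphism rotates
    each face because its seven 2-arcs are in at most two orbits
    (face_rotation). With one heptagon per 3-arc, the surroundings of a heptagon
    are determined by whether the vertices are flat, a kind of holonomy around a
    vertex: if they are not, some vertex has four neighbours (nonflat_absurd), and
    if they are, the neighbourhood closes up to the Coxeter graph, described as
    three heptagons with steps 1, 2 and 3 joined by seven vertices
    (flat_Coxeter). *)

Set Implicit Arguments.
Unset Strict Implicit.
Unset Printing Implicit Defensive.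

Import GRing.Theory.

(** * Cubic graphs of girth seven *)

Record vtGraph7 := VtGraph7 {
  vert :> finType;
  adj : rel vert;
  adj_sym : symmetric adj;
  adj_irr : irreflexive adj;
  adj_conn : graph_connected adj;
  adj_cubic : cubic adj;
  adj_vt : vertex_transitive adj;
  adj_girth : girth adj = 7
}.

Section Basics.
Variable G : vtGraph7.
Local Notation e := (@adj G).
Implicit Types (a b c d x y z u v w : G) (s : {perm G}).

Lemma adj_neq a b : e a b -> a != b.
Proof. by apply: contraTneq => ->; rewrite adj_irr. Qed.

Lemma nbr_enum a :
  exists b c d, [/\ b != c, b != d, c != d & forall y, e a y = [|| y == b, y == c | y == d]].
Proof.
have := adj_cubic a; rewrite cardE => cE.
have := enum_uniq [set y | e a y]; have := mem_enum [set y | e a y].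
case: (enum _) cE => [|b [|c [|d []]]] //= _ mE.
rewrite !inE negb_or => /and3P[/andP[bc bd] cd _].
by exists b, c, d; split=> // y; have := mE y; rewrite !inE.
Qed.

Lemma nbr_split a b : e a b ->
  exists c d, [/\ b != c, b != d, c != d & forall y, e a y = [|| y == b, y == c | y == d]].
Proof.
have [p [q [r [pq pr qr N]]]] := nbr_enum a; rewrite N.
case/or3P=> /eqP ->.
- by exists q, r.
- by exists p, r; split=> //; rewrite 1?eq_sym // => y; rewrite N orbCA.
- exists p, q; split=> //; rewrite 1?eq_sym // => y.
  by rewrite N orbA orbC.
Qed.

Definition third a b c : G := odflt a [pick y | [&& e a y, y != b & y != c]].

Lemma thirdP a b c : e a b -> e a c -> b != c ->
  [/\ e a (third a b c), third a b c != b, third a b c != c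
    & forall y, e a y -> [\/ y = b, y = c | y = third a b c]].
Proof.
move=> ab ac nbc; have [p [q [bp bq pq N]]] := nbr_split ab.
rewrite /third; case: pickP => [y|no] /=.
  case/and3P=> ay yb yc; split=> // z az.
  move: ac ay az nbc yb yc; rewrite !N.
  by case/or3P=> /eqP -> /or3P[]/eqP -> /or3P[]/eqP ->; rewrite ?eqxx //;
    do ?[by constructor 1 | by constructor 2 | by constructor 3].
exfalso; move: ac nbc; rewrite N => /or3P[]/eqP cE; first by rewrite cE eqxx.
  by have := no q; rewrite N eqxx !orbT cE [q == b]eq_sym bq [q == p]eq_sym pq.
by have := no p; rewrite N eqxx !orbT cE [p == b]eq_sym bp pq.
Qed.

Lemma third_eq a b c d : e a b -> e a c -> e a d -> b != c -> b != d -> c != d ->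
  third a b c = d.
Proof.
move=> ab ac ad bc bd cd; have [_ _ _ /(_ _ ad)] := thirdP ab ac bc.
by case=> // dE; rewrite dE ?eqxx in bd cd.
Qed.

Lemma third_uniq a b c x y : e a b -> e a c -> b != c -> e a x -> e a y ->
  x != b -> x != c -> y != b -> y != c -> x = y.
Proof.
move=> ab ac bc ax ay xb xc yb yc; transitivity (third a b c); [apply: esym|];
  by apply: third_eq; rewrite // eq_sym.
Qed.

Lemma four_nbrs a b c d f : e a b -> e a c -> e a d -> e a f ->
  uniq [:: b; c; d; f] -> False.
Proof.
move=> ab ac ad af /= /and4P[]; rewrite !inE !negb_or.
move=> /and3P[bc bd bf] /andP[cd cf] df _.
by move: df; rewrite (third_uniq ab ac bc ad af) ?eqxx // eq_sym.
Qed.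

Lemma no_short_ucycle (s : seq G) : 2 < size s < 7 -> ~~ ucycleb e s.
Proof.
case/andP=> s3 s7; apply/negP=> us.
have fl : find (fun k => [exists F, kcycle e k F]) (iota 0 #|G|.+1) = 7 by exact: (adj_girth G).
have := @before_find _ 0 (fun k => [exists F, kcycle e k F]) (iota 0 #|G|.+1) (size s).
rewrite fl => /(_ s7); rewrite nth_iota; last first.
  have := find_size (fun k => [exists F, kcycle e k F]) (iota 0 #|G|.+1).
  by rewrite fl size_iota; lia.
rewrite add0n => /existsP[]; exists (cycle_edges s).
by rewrite /kcycle s3 /=; apply/existsP; exists (in_tuple s); rewrite us eqxx.
Qed.

(** By induction on the length, proper stretches of the walk have distinct
    ends; a closed walk would then be a cycle of length at most six. *)
Lemma nbw_fun (p : nat -> G) k : 0 < k <= 6 ->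
  (forall i, i < k -> e (p i) (p i.+1)) ->
  (forall i, i.+1 < k -> p i != p i.+2) -> p 0 != p k.
Proof.
elim/ltn_ind: k p => k IH p /andP[k0 k6] pe pn; apply/eqP=> p0k.
have uq : uniq [seq p i | i <- iota 0 k].
  have D i j : i < j < k -> p i != p j.
    case/andP=> ij jk; have := IH (j - i) _ (fun n => p (i + n)).
    rewrite addn0 (subnKC (ltnW ij)); apply; first by lia.
    - by lia.
    - by move=> n nj; rewrite addnS; apply: pe; lia.
    - by move=> n nj; rewrite !addnS; apply: pn; lia.
  rewrite map_inj_in_uniq ?iota_uniq // => i j; rewrite !mem_iota !add0n /= => ik jk.
  case: (ltngtP i j) => // ij pij.
    by have := D i j; rewrite pij eqxx ij jk => /(_ isT).
  by have := D j i; rewrite pij eqxx ij ik => /(_ isT).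
have k3 : 2 < k.
  case: k k0 {k6 IH uq} pe pn p0k => [|[|[|k]]] // _ pe pn p0k.
    by have := pe 0 isT; rewrite -p0k adj_irr.
  by have := pn 0 isT; rewrite -p0k eqxx.
have := @no_short_ucycle [seq p i | i <- iota 0 k].
rewrite size_map size_iota k3 (_ : k < 7) // => /(_ isT) /negP; apply.
rewrite /ucycleb uq andbT.
case: k k0 {k3 k6 IH uq pn} pe p0k => // k _ pe p0k.
rewrite /= rcons_path; apply/andP; split.
  apply/(pathP (p 0)) => i; rewrite size_map size_iota => ik.
  rewrite -[p 0 :: _]/([seq p i | i <- iota 0 k.+1]) !(nth_map 0) ?size_iota //; last by lia.
  by rewrite !nth_iota //; try lia; apply: pe; lia.
have -> : last (p 0) [seq p i | i <- iota 1 k] = p k.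
  by rewrite last_map (last_nth 0) size_iota -[0 :: _]/(iota 0 k.+1) nth_iota.
by rewrite p0k; apply: pe.
Qed.

Fixpoint nbw (s : seq G) : bool :=
  if s is a :: t then
    if t is b :: t' then
      [&& e a b, (if t' is c :: _ then a != c else true) & nbw t]
    else true
  else true.

Lemma nbw_nth (s : seq G) : nbw s -> forall z i, i.+1 < size s -> e (nth z s i) (nth z s i.+1) /\
  (i.+2 < size s -> nth z s i != nth z s i.+2).
Proof.
elim: s => // a [|b t] IH //= /and3P[ab nac nb] z [|i] Hi.
  by split=> //= ; case: t nac {IH nb Hi}.
by have [] := IH nb z i Hi.
Qed.

Lemma nbw_neq (a : G) (s : seq G) : nbw (a :: s) -> 0 < size s <= 6 -> a != last a s.
Proof.
move=> nb ss; have nn := nbw_nth nb a.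
have := @nbw_fun (nth a (a :: s)) (size s) ss.
rewrite [nth _ _ (size s)]/= (_ : nth a (a :: s) (size s) = last a s); last first.
  by rewrite -(nth_last a) /=; case: s {nb nn ss}.
by apply=> i Hi; have [] := nn i; rewrite /= ?ltnS //; lia.
Qed.
End Basics.

Ltac graph_side := first [ done | by rewrite eq_sym | by rewrite adj_sym ].

(** short a s proves a contradiction from the closed non-backtracking walk
    a :: s. *)
Ltac short a s :=
  exfalso; suff: nbw (a :: s) by [move/nbw_neq => /(_ isT); rewrite /= eqxx];
  rewrite /= ?andbT; repeat (apply/andP; split); try graph_side.

(** * Rooted heptagons and their words *)

Section Heptagons.
Variable G : vtGraph7.
Local Notation e := (@adj G).
Implicit Types (a b c d x y z u v w : G) (s : {perm G}).

(** Two 3-paths with the same ends would close up to a walk of length at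
    most six. *)
Lemma path3_uniq a b c d b' c' : e a b -> e b c -> e c d -> a != c -> b != d ->
  e a b' -> e b' c' -> e c' d -> a != c' -> b' != d -> b = b' /\ c = c'.
Proof.
move=> ab bc cd ac bd ab' bc' cd' ac' bd'.
have [bb'|bb'] := eqVneq b b'.
  rewrite -{}bb' in bc' bd' ab' *; split=> //; apply/eqP/negPn/negP => cc'.
  by short b [:: c; d; c'; b].
have [cc'|cc'] := eqVneq c c'.
  by rewrite -cc' in bc' cd'; short a [:: b; c; b'; a].
by short b' [:: a; b; c; d; c'; b'].
Qed.

Definition hept a b c d x y z := ucycleb e [:: a; b; c; d; x; y; z].

(** In girth 7 a non-backtracking closed walk of length 7 repeats no
    vertex. *)
Lemma heptE a b c d x y z : hept a b c d x y z =
  [&& e a b, e b c, e c d, e d x, e x y, e y z, e z a,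
      a != c, b != d, c != x, d != y, x != z, y != a & z != b].
Proof.
apply/idP/idP.
  rewrite /hept /ucycleb /= !inE !negb_or.
  case/andP=> /and5P[-> -> -> -> /and3P[-> -> /andP[-> _]]].
  case/and5P=> /and5P[_ -> _ _ /andP[ya _]] /and5P[_ -> _ _ zb] /and4P[_ -> _ _]
    /and3P[_ -> _] /andP[/andP[_ ->] _].
  by rewrite ![_ == a]eq_sym ya [_ == b]eq_sym zb.
case/and5P=> ab bc cd dx /and5P[xy yz za ac /and5P[bd cx dy xz /andP[ya zb]]].
rewrite /hept /ucycleb /= ab bc cd dx xy yz za /= !inE !negb_or.
have nq p q r t : e p q -> e q r -> e r t -> p != r -> q != t -> p != t.
  by move=> pq qr rt pr qt; apply/eqP=> pt; rewrite -pt in rt qt; short p [:: q; r; p].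
rewrite !(adj_neq ab, adj_neq bc, adj_neq cd, adj_neq dx, adj_neq xy, adj_neq yz, ac, bd, cx, dy, xz) /=.
rewrite (nq a b c d) ?(nq b c d x) ?(nq c d x y) ?(nq d x y z) //=.
rewrite ![a == _]eq_sym ![b == _]eq_sym ![c == _]eq_sym.
by rewrite (nq x y z a) ?(nq y z a b) ?(nq z a b c) ?ya ?zb ?(adj_neq za).
Qed.

Lemma hept_rot a b c d x y z : hept a b c d x y z -> hept b c d x y z a.
Proof. by rewrite !heptE => /and5P[-> -> -> -> /and5P[-> -> -> -> /and5P[-> -> -> -> /andP[-> ->]]]]. Qed.

Lemma hept_rev a b c d x y z : hept a b c d x y z -> hept a z y x d c b.
Proof.
rewrite !heptE => /and5P[? ? ? ? /and5P[? ? ? ? /and5P[? ? ? ? /andP[? ?]]]].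
by repeat (apply/andP; split); graph_side.
Qed.

(** The other three edges of the heptagon form a 3-path with given ends. *)
Lemma hept_arc4 a b c d x y z y' z' : hept a b c d x y z -> hept a b c d x y' z' ->
  y = y' /\ z = z'.
Proof.
rewrite !heptE => /and5P[ab bc cd dx /and5P[xy yz za ac /and5P[bd cx dy xz /andP[ya zb]]]].
case/and5P=> _ _ _ _ /and5P[xy' yz' za' _ /and5P[_ _ dy' xz' /andP[ya' zb']]].
exact: path3_uniq xy yz za xz ya xy' yz' za' xz' ya'.
Qed.

Lemma autE s a b : s \in graph_aut e -> e (s a) (s b) = e a b.
Proof. by rewrite inE => /'forall_forallP/(_ a b)/eqP. Qed.

Lemma hept_aut s a b c d x y z : s \in graph_aut e ->
  hept (s a) (s b) (s c) (s d) (s x) (s y) (s z) = hept a b c d x y z.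
Proof. by move=> sA; rewrite !heptE !(autE _ _ sA) !(inj_eq perm_inj). Qed.

Lemma aut_to v w : exists2 s, s \in graph_aut e & s v = w.
Proof.
have [s sA] := atransP2 (adj_vt G) (in_setT v) (in_setT w); exists s => //.
Qed.

Lemma third_aut s a b c : s \in graph_aut e -> e a b -> e a c -> b != c ->
  third (s a) (s b) (s c) = s (third a b c).
Proof.
move=> sA ab ac bc; have [H1 H2 H3 _] := thirdP ab ac bc.
by apply: third_eq; rewrite ?(autE _ _ sA) ?(inj_eq perm_inj) // eq_sym.
Qed.

Definition heps : {set 7.-tuple G} := [set c : 7.-tuple G | ucycleb e c].

Lemma tuple7P (T : Type) (c : 7.-tuple T) :
  exists a b c1 d x y z : T, c = [tuple a; b; c1; d; x; y; z].
Proof.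
case: c => -[|a [|b [|c [|d [|x [|y [|z []]]]]]]] // i.
by exists a, b, c, d, x, y, z; apply: val_inj.
Qed.

Lemma in_heps a b c d x y z : ([tuple a; b; c; d; x; y; z] \in heps) = hept a b c d x y z.
Proof. by rewrite inE. Qed.

Definition rotH (c : 7.-tuple G) : 7.-tuple G := [tuple of seq.rot 1 c].

Lemma rotH_inj : injective rotH.
Proof. by move=> c d /(congr1 val) /rot_inj /val_inj. Qed.

Lemma rotH_heps (c : 7.-tuple G) : (rotH c \in heps) = (c \in heps).
Proof. by rewrite !inE /ucycleb rot_cycle rot_uniq. Qed.

Definition mapH s (c : 7.-tuple G) : 7.-tuple G := [tuple of map s c].

Lemma mapH_inj s : injective (mapH s).
Proof. by move=> c d /(congr1 val) /(inj_map perm_inj) /val_inj. Qed.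

Lemma mapH_heps s (c : 7.-tuple G) : s \in graph_aut e -> c \in heps -> mapH s c \in heps.
Proof.
move=> sA; have [a [b [c1 [d [x [y [z ->]]]]]]] := tuple7P c.
by rewrite in_heps -(hept_aut _ _ _ _ _ _ _ sA) inE.
Qed.

(** The i-th letter is a property of the four consecutive vertices that
    begin at the i-th vertex; a property of fewer vertices ignores the last
    ones. *)
Definition word (L : G -> G -> G -> G -> bool) (c : seq G) : seq bool :=
  if c is [:: a; b; c; d; x; y; z] then
    [:: L a b c d; L b c d x; L c d x y; L d x y z; L x y z a; L y z a b; L z a b c]
  else [::].

Lemma word_rot L (c : 7.-tuple G) : word L (rotH c) = seq.rot 1 (word L c).
Proof. by have [a [b [c1 [d [x [y [z ->]]]]]]] := tuple7P c. Qed.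

Definition invariant_letter (L : G -> G -> G -> G -> bool) :=
  forall s a b c d, s \in graph_aut e -> L (s a) (s b) (s c) (s d) = L a b c d.

Section Words.
Variables (X : finType) (root : 7.-tuple G -> X) (D : {set X}).
Variable L : G -> G -> G -> G -> bool.
Hypothesis Linv : invariant_letter L.
Hypothesis rootD : forall c : 7.-tuple G, c \in heps -> root c \in D.
Hypothesis root_trans : forall p q, p \in D -> q \in D ->
  exists2 s, s \in graph_aut e & forall c : 7.-tuple G, root c = p -> root (mapH s c) = q.

Definition rooted p (om : seq bool) := [set c : 7.-tuple G in heps | (word L c == om) && (root c == p)].
Definition rooted_count p om := #|rooted p om|.

Lemma word_aut s (c : 7.-tuple G) : s \in graph_aut e -> word L (mapH s c) = word L c.
Proof.
by move=> sA; have [a [b [c1 [d [x [y [z ->]]]]]]] := tuple7P c; rewrite /= !Linv.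
Qed.

(** An automorphism that moves one root to the other maps one set of
    heptagons into the other. *)
Lemma count_const p q om : p \in D -> q \in D -> rooted_count p om = rooted_count q om.
Proof.
suff le (u v : X) : u \in D -> v \in D -> rooted_count u om <= rooted_count v om.
  by move=> pD qD; apply/eqP; rewrite eqn_leq !le.
move=> uD vD; have [s sA sr] := root_trans uD vD.
rewrite /rooted_count -(card_imset _ (@mapH_inj s)); apply/subset_leq_card/subsetP => c.
case/imsetP=> c' /[!inE] /and3P[cH /eqP wc /eqP rc] ->.
have := mapH_heps sA (c := c'); rewrite !inE => -> //.
by rewrite word_aut // wc eqxx (sr _ rc) eqxx.
Qed.

(** Used with constant summands, this counts heptagons of a given word by
    their roots. *)
Lemma sum_count om : \sum_(p in D) rooted_count p om = #|[set c : 7.-tuple G in heps | word L c == om]|.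
Proof.
rewrite -sum1_card (partition_big root (mem D)) /=; last first.
  by move=> c; rewrite inE => /andP[/rootD].
apply: eq_bigr => p pD; rewrite /rooted_count -sum1_card; apply: eq_bigl => c /=.
by rewrite !inE andbA.
Qed.

(** Rotating heptagons is a bijection between those of word om and those of
    word rot 1 om; as each count does not depend on the root, the two
    counts agree at every root. This turns one heptagon into seven
    constraints. *)
Lemma count_rot p q om : p \in D -> q \in D -> rooted_count p om = rooted_count q (seq.rot 1 om).
Proof.
move=> pD qD; have E (om' : seq bool) : #|[set c : 7.-tuple G in heps | word L c == om']| = #|D| * rooted_count q om'.
  by rewrite -sum_count (eq_bigr (fun=> rooted_count q om')) ?sum_nat_const // => u uD; apply: count_const.
rewrite (count_const om pD qD).
have D0 : 0 < #|D| by apply/card_gt0P; exists p.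
apply/eqP; rewrite -(eqn_pmul2l D0) -!E; apply/eqP.
rewrite -(card_imset _ rotH_inj); apply: eq_card => c; apply/imsetP/idP => [[c' H ->]|].
  by move: H; rewrite inE => /andP[cH /eqP wc]; rewrite inE rotH_heps cH word_rot wc eqxx.
rewrite inE => /andP[cH /eqP wc]; exists [tuple of rotr 1 c].
  rewrite inE -rotH_heps.
  have cE : rotH [tuple of rotr 1 c] = c by apply: val_inj; rewrite /= rotrK.
  by rewrite cE cH -(inj_eq (@rot_inj 1 _)) -word_rot cE wc eqxx.
by apply: val_inj; rewrite /= rotrK.
Qed.
End Words.
End Heptagons.

(** * Heptagons through a given walk *)

Lemma card_by_label (T : finType) (W : eqType) (f : T -> W) (A : {set T}) (Om : seq W) :
  uniq Om -> (forall t, t \in A -> f t \in Om) ->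
  #|A| = \sum_(w <- Om) #|[set t in A | f t == w]|.
Proof.
move=> uO fO; under eq_bigr => w _.
  rewrite -sum1_card (eq_bigl (fun t => (t \in A) && (f t == w))); last by move=> t; rewrite inE.
  rewrite big_mkcondr /=; over.
rewrite exchange_big /= -sum1_card; apply: eq_bigr => t tA.
by rewrite -big_mkcond sum1_count (eq_count (a2 := pred1 (f t))) ?count_uniq_mem ?fO // => w; rewrite /= eq_sym.
Qed.

Section Counting.
Variable G : vtGraph7.
Local Notation e := (@adj G).
Implicit Types (a b c d x y z u v w : G) (s : {perm G}).

(** For the two ends of an edge, this is the number of 7-cycles that
    contain the edge. *)
Definition thru (p : seq G) := #|[set h : 7.-tuple G in heps G | prefix p h]|.

Lemma sum_nbrs (f : G -> nat) b c d : b != c -> b != d -> c != d ->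
  (forall y, f y != 0 -> [|| y == b, y == c | y == d]) -> \sum_y f y = f b + f c + f d.
Proof.
move=> bc bd cd Hf; rewrite (bigD1 b) //= (bigD1 c) /= 1?eq_sym // (bigD1 d) /=; last first.
  by rewrite ![d == _]eq_sym bd cd.
rewrite big1 ?addn0 ?addnA // => y /andP[/andP[yb yc] yd].
by apply/eqP/negPn/negP => /Hf; rewrite (negPf yb) (negPf yc) (negPf yd).
Qed.

Lemma thru1 a b c d : b != c -> b != d -> c != d ->
  (forall y, e a y = [|| y == b, y == c | y == d]) ->
  thru [:: a] = thru [:: a; b] + thru [:: a; c] + thru [:: a; d].
Proof.
move=> bc bd cd N; rewrite -(sum_nbrs (f := fun y => thru [:: a; y]) bc bd cd).
  rewrite {1}/thru -sum1_card (partition_big (fun h : 7.-tuple G => nth a h 1) predT) //=.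
  apply: eq_bigr => y _; rewrite /thru -sum1_card; apply: eq_bigl => h.
  rewrite !inE; have [a' [b' [c' [d' [x' [y' [z' ->]]]]]]] := tuple7P h.
  by rewrite /= !andbT -andbA [b' == y]eq_sym.
move=> y; rewrite -lt0n -N => /card_gt0P[h]; have [a' [b' [c' [d' [x' [y' [z' ->]]]]]]] := tuple7P h.
by rewrite inE in_heps heptE /= => /andP[/andP[? _]] /and3P[/eqP -> /eqP -> _].
Qed.

Lemma thru2 a b c d : c != d -> a != c -> a != d ->
  (forall y, e b y = [|| y == a, y == c | y == d]) ->
  thru [:: a; b] = thru [:: a; b; c] + thru [:: a; b; d].
Proof.
move=> cd ac ad N; have := sum_nbrs (f := fun y => thru [:: a; b; y]) ac ad cd.
have -> : thru [:: a; b; a] = 0.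
  apply/eqP; rewrite -leqn0 leqNgt; apply/negP => /card_gt0P[h].
  have [a' [b' [c' [d' [x' [y' [z' ->]]]]]]] := tuple7P h.
  rewrite inE in_heps heptE /= => /andP[/and5P[? ? ? ? /and5P[? ? ? ac' _]]].
  by case/and4P=> /eqP aa _ /eqP ac'' _; rewrite -aa -ac'' eqxx in ac'.
rewrite add0n => <-; last first.
  move=> y; rewrite -lt0n -N => /card_gt0P[h]; have [a' [b' [c' [d' [x' [y' [z' ->]]]]]]] := tuple7P h.
  by rewrite inE in_heps heptE /= => /andP[/and3P[_ ? _]] /and4P[_ /eqP -> /eqP -> _].
rewrite {1}/thru -sum1_card (partition_big (fun h : 7.-tuple G => nth a h 2) predT) //=.
apply: eq_bigr => y _; rewrite /thru -sum1_card; apply: eq_bigl => h.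
rewrite !inE; have [a' [b' [c' [d' [x' [y' [z' ->]]]]]]] := tuple7P h.
by rewrite /= !andbT -!andbA [c' == y]eq_sym.
Qed.

Lemma thru3 a b c d f : d != f -> b != d -> b != f ->
  (forall y, e c y = [|| y == b, y == d | y == f]) ->
  thru [:: a; b; c] = thru [:: a; b; c; d] + thru [:: a; b; c; f].
Proof.
move=> df bd bf N; have := sum_nbrs (f := fun y => thru [:: a; b; c; y]) bd bf df.
have -> : thru [:: a; b; c; b] = 0.
  apply/eqP; rewrite -leqn0 leqNgt; apply/negP => /card_gt0P[h].
  have [a' [b' [c' [d' [x' [y' [z' ->]]]]]]] := tuple7P h.
  rewrite inE in_heps heptE /= => /andP[/and5P[? ? ? ? /and5P[? ? ? ac' /andP[bd' _]]]].
  by case/and5P=> _ /eqP aa _ /eqP ac'' _; rewrite -aa -ac'' eqxx in bd'.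
rewrite add0n => <-; last first.
  move=> y; rewrite -lt0n -N => /card_gt0P[h]; have [a' [b' [c' [d' [x' [y' [z' ->]]]]]]] := tuple7P h.
  by rewrite inE in_heps heptE /= => /andP[/and4P[_ _ ? _]] /and5P[_ _ /eqP -> /eqP -> _].
rewrite {1}/thru -sum1_card (partition_big (fun h : 7.-tuple G => nth a h 3) predT) //=.
apply: eq_bigr => y _; rewrite /thru -sum1_card; apply: eq_bigl => h.
rewrite !inE; have [a' [b' [c' [d' [x' [y' [z' ->]]]]]]] := tuple7P h.
by rewrite /= !andbT -!andbA [d' == y]eq_sym.
Qed.

(** An arbitrary choice between the two ways to leave v after arriving from
    p. It encodes a heptagon with given first three vertices by two
    booleans. *)
Definition turn p v : G := odflt v [pick q | e v q && (q != p)].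

Lemma turnP p v : e v p -> e v (turn p v) /\ turn p v != p.
Proof.
move=> vp; rewrite /turn; case: pickP => [q /andP[]|no] //=.
have [q [r [pq _ _ N]]] := nbr_split vp.
by have := no q; rewrite N eqxx orbT eq_sym pq.
Qed.

Lemma turn_inj p v q q' : e v p -> e v q -> e v q' -> q != p -> q' != p ->
  (q == turn p v) = (q' == turn p v) -> q = q'.
Proof.
move=> vp vq vq' qp q'p; have [vt tp] := turnP vp.
case: eqP => [->|/eqP qt]; first by move/esym/eqP.
move/esym/negbT => q't; apply: (third_uniq vp vt _ vq vq') => //.
by rewrite eq_sym.
Qed.

Definition code (h : seq G) : bool * bool :=
  if h is [:: a; b; c; d; x; y; z] then (d == turn b c, x == turn c d) else (true, true).

Lemma code_inj a b c : {in [set h : 7.-tuple G in heps G | prefix [:: a; b; c] h] &,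
  injective (fun h : 7.-tuple G => code h)}.
Proof.
move=> h h'.
have [a1 [b1 [c1 [d1 [x1 [y1 [z1 ->]]]]]]] := tuple7P h.
have [a2 [b2 [c2 [d2 [x2 [y2 [z2 ->]]]]]]] := tuple7P h'.
case/setIdP=> H1 /and4P[/eqP ? /eqP ? /eqP ? _].
case/setIdP=> H2 /and4P[/eqP ? /eqP ? /eqP ? _]; subst a1 b1 c1 a2 b2 c2.
rewrite !in_heps in H1 H2 *; case=> Ed Ex; have := H1; have := H2.
rewrite !heptE.
case/and5P=> ab bc cd2 dx2 /and5P[_ _ _ ac /and5P[bd2 cx2 _ _ _]].
case/and5P=> _ _ cd1 dx1 /and5P[_ _ _ _ /and5P[bd1 cx1 _ _ _]].
have cb : e c b by rewrite adj_sym.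
have dE : d1 = d2 by apply: turn_inj Ed; rewrite // eq_sym.
rewrite -{}dE in H2 dx2 Ex cd2 bd2 *.
have dc : e d1 c by rewrite adj_sym.
have xE : x1 = x2 by apply: turn_inj Ex; rewrite // eq_sym.
rewrite -{}xE in H2 *; have [-> ->] := hept_arc4 H1 H2; exact: val_inj.
Qed.
Arguments code : simpl never.

Lemma thru3_le a b c : thru [:: a; b; c] <= 4.
Proof.
rewrite /thru -(card_in_imset (@code_inj a b c)).
by apply: leq_trans (max_card _) _; rewrite card_prod card_bool.
Qed.

(** The bound 4 is the number of continuations of a 2-arc to a 4-arc, each
    of which lies on at most one heptagon. *)
Lemma thru3_full a b c d x : thru [:: a; b; c] = 4 ->
  e c d -> e d x -> b != d -> c != x -> e b c ->
  exists y z, hept a b c d x y z.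
Proof.
move=> F cd dx bd cx bc.
have/setP/(_ (d == turn b c, x == turn c d)) : (fun h : 7.-tuple G => code h) @:
   [set h : 7.-tuple G in heps G | prefix [:: a; b; c] h] = setT.
  apply/eqP; rewrite eqEcard subsetT /= card_in_imset; last exact: code_inj.
  by rewrite -/(thru _) F cardsT card_prod card_bool.
rewrite in_setT => /imsetP[h].
have [a1 [b1 [c1 [d1 [x1 [y1 [z1 ->]]]]]]] := tuple7P h.
rewrite inE in_heps => /andP[H1 /and4P[/eqP ? /eqP ? /eqP ? _]]; subst a1 b1 c1.
case=> Ed Ex; have := H1; rewrite heptE.
case/and5P=> ab _ cd2 dx2 /and5P[_ _ _ ac /and5P[bd2 cx2 _ _ _]].
have cb : e c b by rewrite adj_sym.
have dE : d = d1 by apply: turn_inj Ed; rewrite // eq_sym.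
subst d1; have dc : e d c by rewrite adj_sym.
have xE : x = x1 by apply: turn_inj Ex; rewrite // eq_sym.
by subst x1; exists y1, z1.
Qed.

Lemma thru2_le a b : thru [:: a; b] <= 8.
Proof.
case: (boolP (e b a)) => ba.
  have [c [d [ac ad cd N]]] := nbr_split ba.
  by rewrite (thru2 cd ac ad N); have := thru3_le a b c; have := thru3_le a b d; lia.
apply: leq_trans (_ : 0 <= _) => //; rewrite leqNgt; apply/negP=> /card_gt0P[h].
have [a1 [b1 [c1 [d1 [x1 [y1 [z1 ->]]]]]]] := tuple7P h.
rewrite inE in_heps heptE => /andP[/and3P[ab _ _] /and3P[/eqP aE /eqP bE _]].
by rewrite -aE -bE adj_sym (negPf ba) in ab.
Qed.

Lemma thru1_le a : thru [:: a] <= 24.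
Proof.
have [b [c [d [bc bd cd N]]]] := nbr_enum a; rewrite (thru1 bc bd cd N).
by have := thru2_le a b; have := thru2_le a c; have := thru2_le a d; lia.
Qed.

Lemma thru2_sym a b : thru [:: a; b] = thru [:: b; a].
Proof.
suff le u v : thru [:: u; v] <= thru [:: v; u] by apply/eqP; rewrite eqn_leq !le.
pose r (h : 7.-tuple G) : 7.-tuple G := [tuple of seq.rot 5 (rev h)].
have rE u1 v1 c1 d1 x1 y1 z1 : r [tuple u1; v1; c1; d1; x1; y1; z1] = [tuple v1; u1; z1; y1; x1; d1; c1].
  exact: val_inj.
have r_inj : injective r.
  by move=> h h' /(congr1 val) /rot_inj /(congr1 rev); rewrite !revK => /val_inj.
rewrite /thru -(card_imset _ r_inj); apply/subset_leq_card/subsetP => _ /imsetP[h + ->].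
have [a1 [b1 [c1 [d1 [x1 [y1 [z1 ->]]]]]]] := tuple7P h.
rewrite rE !inE -![ucycleb _ _]/(hept _ _ _ _ _ _ _) /= !andbT => /andP[/hept_rot/hept_rev -> /andP[-> ->]].
by [].
Qed.

Lemma thru3_sym a b c : thru [:: a; b; c] = thru [:: c; b; a].
Proof.
suff le u v w : thru [:: u; v; w] <= thru [:: w; v; u] by apply/eqP; rewrite eqn_leq !le.
pose r (h : 7.-tuple G) : 7.-tuple G := [tuple of seq.rot 4 (rev h)].
have rE u1 v1 c1 d1 x1 y1 z1 : r [tuple u1; v1; c1; d1; x1; y1; z1] = [tuple c1; v1; u1; z1; y1; x1; d1].
  exact: val_inj.
have r_inj : injective r.
  by move=> h h' /(congr1 val) /rot_inj /(congr1 rev); rewrite !revK => /val_inj.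
rewrite /thru -(card_imset _ r_inj); apply/subset_leq_card/subsetP => _ /imsetP[h + ->].
have [a1 [b1 [c1 [d1 [x1 [y1 [z1 ->]]]]]]] := tuple7P h.
rewrite rE !inE -![ucycleb _ _]/(hept _ _ _ _ _ _ _) /= !andbT.
by case/andP=> /hept_rot/hept_rot/hept_rev -> /and3P[-> -> ->].
Qed.

Lemma thru_aut s p : s \in graph_aut e -> thru (map s p) = thru p.
Proof.
suff le s' p' : s' \in graph_aut e -> thru p' <= thru (map s' p').
  move=> sA; apply/eqP; rewrite eqn_leq le // andbT.
  apply: leq_trans (le s^-1%g _ _) _; first by rewrite groupV.
  by rewrite -map_comp (eq_map (g := id)) ?map_id // => x; rewrite /= permK.
move=> sA; rewrite /thru -(card_imset _ (@mapH_inj _ s')); apply/subset_leq_card/subsetP => _ /imsetP[h + ->].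
rewrite inE => /andP[hH /prefixP[t hE]]; rewrite inE mapH_heps //=.
by apply/prefixP; exists (map s' t); rewrite /= hE map_cat.
Qed.

Lemma hept_ex_at v : (exists a b c d x y z : G, hept a b c d x y z) ->
  exists b c d x y z : G, hept v b c d x y z.
Proof.
case=> a [b [c [d [x [y [z H]]]]]]; have [s sA <-] := aut_to a v.
by exists (s b), (s c), (s d), (s x), (s y), (s z); rewrite hept_aut.
Qed.

(** The girth is defined as a search bounded by the order of the graph, so
    it is attained by a cycle as soon as there are seven vertices: a
    vertex, its neighbours and three of their neighbours. *)
Lemma hept_ex : exists a b c d x y z : G, hept a b c d x y z.
Proof.
pose P k := [exists F, kcycle e k F].
have fl : find P (iota 0 #|G|.+1) = 7 by exact: (adj_girth G).
have G7 : 6 < #|G|.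
  have vG : 0 < #|G|.
    rewrite lt0n; apply/eqP => G0; have := find_size P (iota 0 #|G|.+1).
    by rewrite fl size_iota G0.
  case/card_gt0P: vG => v _.
  have [b [c [d [bc bd cd N]]]] := nbr_enum v.
  have [vb vc vd] : [/\ e v b, e v c & e v d] by rewrite !N !eqxx !orbT.
  have bv : e b v by rewrite adj_sym.
  have [b1 [b2 [vb1 vb2 b12 Nb]]] := nbr_split bv.
  have [bb1 bb2] : e b b1 /\ e b b2 by rewrite !Nb !eqxx !orbT.
  have cv : e c v by rewrite adj_sym.
  have [c1 [c2 [vc1 vc2 c12 Nc]]] := nbr_split cv.
  have cc1 : e c c1 by rewrite Nc eqxx !orbT.
  have K f g : e f g -> f != g by apply: adj_neq.
  suff U : uniq [:: v; b; c; d; b1; b2; c1] by have := max_card (mem [:: v; b; c; d; b1; b2; c1]); rewrite (card_uniqP U).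
  rewrite /= !inE !negb_or vb1 vb2 vc1 bc bd cd b12.
  rewrite (K v b) // (K v c) // (K v d) // (K b b1) // (K b b2) // (K c c1) //=.
  have q f g h : e v f -> e v g -> e f h -> f != g -> v != h -> g != h.
    by move=> vf vg fh fg vh; apply/eqP => gh; rewrite -gh in fh; have ? := adj_neq vg;
    have ? := adj_neq vf; short v [:: f; g; v].
  have cb : c != b by rewrite eq_sym.
  rewrite (q b c b1) // (q b c b2) // (q b d b1) // (q b d b2) // (q c d c1) // (q c b c1) //=.
  by rewrite !andbT; apply/andP; split; apply/eqP=> E; subst c1;
    [short v [:: b; b1; c; v] | short v [:: b; b2; c; v]].
have : has P (iota 0 #|G|.+1) by rewrite has_find fl size_iota.
move/(nth_find 0); rewrite fl nth_iota //; case/existsP=> F /andP[_ /existsP[h /andP[hu _]]].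
have [a1 [b1 [c1 [d1 [x1 [y1 [z1 hE]]]]]]] := tuple7P h; rewrite hE in hu.
by exists a1, b1, c1, d1, x1, y1, z1.
Qed.
End Counting.

(** * Invariant perfect matchings *)

(** A perfect matching that every automorphism preserves. *)
Record matching (G : vtGraph7) := Matching {
  mate :> G -> G;
  mate_adj : forall v, adj v (mate v);
  mateK : involutive mate;
  mate_aut : forall s v, s \in graph_aut (@adj G) -> mate (s v) = s (mate v)
}.

(** The rank r orders each orbit {t, f t}. *)
Lemma even_card_involution (T : finType) (S : {set T}) (f : T -> T) (r : T -> nat) :
  (forall t, t \in S -> [/\ f t \in S, f (f t) = t & r (f t) != r t]) -> ~~ odd #|S|.
Proof.
move=> Hf; pose S1 := [set t in S | r t < r (f t)].
have S1S : S1 \subset S by apply/subsetP => t; rewrite inE => /andP[].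
have fE : f @: S1 = S :\: S1.
  apply/setP => t; apply/imsetP/idP => [[u]|].
    rewrite inE => /andP[uS ur] ->; have [fS ff fr] := Hf _ uS.
    by rewrite !inE fS ff /=; rewrite -leqNgt (ltnW ur).
  rewrite !inE => /andP[+ tS]; rewrite tS /= -leqNgt => tr.
  have [fS ff fr] := Hf _ tS; exists (f t); rewrite ?ff // inE fS ff.
  by rewrite ltn_neqAle fr.
have fi : {in S1 &, injective f}.
  move=> t u; rewrite !inE => /andP[tS _] /andP[uS _] E.
  by have [_ <- _] := Hf _ tS; have [_ <- _] := Hf _ uS; rewrite E.
have := cardsID S1 S; rewrite (setIidPr S1S) -fE (card_in_imset fi) => <-.
by rewrite addnn odd_double.
Qed.

(** A heptagon has no two consecutive edges in a matching, so the set of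
    its matching edges is, up to rotation, one of the five below; each word
    is a palindrome. The digits in the names of the last three are the
    lengths of the runs between edges of the matching. *)
Definition pat0 := nseq 7 false.
Definition pat1 := [:: false; false; false; true; false; false; false].
Definition pat23 := [:: false; true; false; false; false; true; false].
Definition pat14 := [:: false; false; true; false; true; false; false].
Definition pat112 := [:: false; true; false; true; false; true; false].

Definition patterns := [:: pat1; pat23; pat14; pat112].
Definition all_words := pat0 :: flatten [seq [seq seq.rot i P | i <- iota 0 7] | P <- patterns].

Section Matching.
Variable G : vtGraph7.
Variable M : matching G.
Local Notation e := (@adj G).
Implicit Types (a b c d x y z u v w : G) (s : {perm G}).

Definition letterM a b c d := b == M a.

Lemma letterM_inv : invariant_letter letterM.
Proof. by move=> s a b c d sA; rewrite /letterM (mate_aut M) // (inj_eq perm_inj). Qed.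

Lemma mate_inj : injective M. Proof. exact: inv_inj (@mateK _ M). Qed.

Lemma mate_sym a b : (a == M b) = (b == M a).
Proof. by apply/eqP/eqP => ->; rewrite mateK. Qed.

Definition froot (h : 7.-tuple G) := thead h.
Definition cnt v om := rooted_count froot letterM v om.

Lemma froot_trans v w : v \in setT -> w \in setT ->
  exists2 s, s \in graph_aut e & forall h : 7.-tuple G, froot h = v -> froot (mapH s h) = w.
Proof.
move=> _ _; have [s sA <-] := aut_to v w; exists s => // h <-.
by have [a [b [c1 [d [x [y [z ->]]]]]]] := tuple7P h.
Qed.

Lemma cnt_rot v w i om : cnt v (seq.rot i om) = cnt w om.
Proof.
have R1 u u' om' : cnt u om' = cnt u' (seq.rot 1 om').
  by apply: (count_rot letterM_inv (D := setT)); rewrite ?inE //; apply: froot_trans.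
have R0 u u' om' : cnt u om' = cnt u' om'.
  by apply: (count_const letterM_inv (D := setT)); rewrite ?inE //; apply: froot_trans.
case: (leqP i (size om)) => [|oi]; last by rewrite rot_oversize 1?ltnW.
elim: i => [|i IH] iom; first by rewrite rot0.
by rewrite -addn1 addnC rotD ?add1n // -(R1 v) IH // ltnW.
Qed.

Lemma word_all h : h \in heps G -> word letterM h \in all_words.
Proof.
have [a [b [c [d [x [y [z ->]]]]]]] := tuple7P h.
rewrite in_heps heptE => /and5P[_ _ _ _ /and5P[_ _ _ ac /and5P[bd cx dy xz /andP[ya zb]]]].
have no p q r : p != r -> ~~ (letterM p q q q && letterM q r r r).
  rewrite /letterM; apply: contra => /andP[/eqP -> /eqP ->].
  by rewrite mateK.
have := (no a b c ac, no b c d bd, no c d x cx, no d x y dy, no x y z xz, no y z a ya, no z a b zb).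
rewrite /word /letterM /=.
case: (b == _) (c == _) (d == _) (x == _) (y == _) (z == _) (a == _) => [] [] [] [] [] [] [];
  try (by move=> _); by case=> [[[[[[? ?] ?] ?] ?] ?] ?].
Qed.

Lemma uniq_all_words : uniq all_words. Proof. by []. Qed.

Lemma thru1_labels v h : (h \in [set h : 7.-tuple G in heps G | prefix [:: v] h]) =
  (h \in heps G) && (froot h == v).
Proof.
have [a [b [c [d [x [y [z ->]]]]]]] := tuple7P h.
by rewrite inE /= andbT; congr (_ && _); rewrite eq_sym.
Qed.

Lemma thru1E v : thru [:: v] = cnt v pat0 + 7 * (cnt v pat1 + cnt v pat23 + cnt v pat14 + cnt v pat112).
Proof.
rewrite /thru (card_by_label (f := fun h : 7.-tuple G => word letterM h) uniq_all_words); last first.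
  by move=> h; rewrite thru1_labels => /andP[/word_all].
rewrite (eq_bigr (cnt v)) => [|w _]; last first.
  by apply: eq_card => h; rewrite inE thru1_labels !inE -andbA; congr (_ && _); rewrite andbC.
rewrite /all_words big_cons big_flatten big_map /patterns !big_cons !big_nil /=.
have R i P : cnt v (seq.rot i P) = cnt v P by apply: cnt_rot.
by rewrite !R; lia.
Qed.

Lemma thru_mate v : thru [:: v; M v] =
  cnt v pat1 + 2 * cnt v pat23 + 2 * cnt v pat14 + 3 * cnt v pat112.
Proof.
rewrite /thru (card_by_label (f := fun h : 7.-tuple G => word letterM h) uniq_all_words); last first.
  by move=> h; rewrite inE => /andP[/word_all].
rewrite (eq_bigr (fun w : seq bool => head false w * cnt v w)) => [|w _]; last first.
  case hw: (head false w); rewrite ?mul1n ?mul0n; last first.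
    apply/eqP; rewrite cards_eq0 -subset0; apply/subsetP => h.
    have [a [b [c [d [x [y [z ->]]]]]]] := tuple7P h.
    rewrite inE => /andP[+ /eqP wE]; rewrite inE => /andP[_ /and3P[/eqP va /eqP bE _]].
    by rewrite -wE /= /letterM -bE va eqxx in hw.
  apply: eq_card => h; have [a [b [c [d [x [y [z ->]]]]]]] := tuple7P h.
  rewrite 2!inE [in RHS]inE -!andbA; congr (_ && _).
  have [wE|] := eqVneq (word letterM _) w; last by rewrite !andbF.
  move: hw; rewrite -wE /= {1}/letterM /froot /= !andbT [M v == b]eq_sym => /eqP ->.
  by rewrite [v == a]eq_sym; case: eqP => // ->; rewrite eqxx.
rewrite /all_words big_cons big_flatten big_map /patterns !big_cons !big_nil.
have R i P : cnt v (seq.rot i P) = cnt v P by apply: cnt_rot.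
by rewrite !R /= !mul0n !mul1n; lia.
Qed.

Definition revH (h : 7.-tuple G) : 7.-tuple G := [tuple of seq.rot 6 (rev h)].

Lemma revHE a b c d x y z : revH [tuple a; b; c; d; x; y; z] = [tuple a; z; y; x; d; c; b].
Proof. exact: val_inj. Qed.

(** Reversing a heptagon keeps its first vertex and, for a palindrome, its
    word; it changes the second vertex. *)
Lemma even_cnt v P : P = rev P -> ~~ odd (cnt v P).
Proof.
move=> PE; apply: (even_card_involution (f := revH) (r := fun h => enum_rank (nth v h 1))).
move=> h; have [a [b [c [d [x [y [z ->]]]]]]] := tuple7P h.
rewrite inE in_heps => /and3P[H /eqP wE rE]; rewrite !revHE; split=> //; last first.
  have := H; rewrite heptE => /and5P[_ _ _ _ /and5P[_ _ _ _ /and5P[_ _ _ _ /andP[_]]]].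
  by apply: contra => /eqP/val_inj/enum_rank_inj/= ->.
rewrite inE in_heps (hept_rev H) rE andbT /=; apply/eqP.
rewrite PE -wE /= /letterM /rev /=.
by rewrite !(mate_sym _ a) [y == _]mate_sym [x == _]mate_sym [d == _]mate_sym [c == _]mate_sym
  [b == M c]mate_sym [z == M y]mate_sym.
Qed.

(** The adjacency of the 2-factor complementary to the matching. *)
Definition off u v := e u v && (v != M u).
Local Notation F := off.

Lemma F_sym u v : F u v = F v u.
Proof. by rewrite /off adj_sym mate_sym. Qed.

Lemma F_step a b c c' : F a b -> F b c -> F b c' -> a != c -> a != c' -> c = c'.
Proof.
rewrite F_sym => /andP[ba aM] /andP[bc cM] /andP[bc' c'M] ac ac'.
by apply: (third_uniq ba (mate_adj M b) _ bc bc') => //; rewrite 1?eq_sym.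
Qed.

(** Without matching edges, a heptagon is determined by its first edge. *)
Lemma cnt0_le v : cnt v pat0 <= 2.
Proof.
pose f (h : 7.-tuple G) := nth v h 1 == turn (M v) v.
rewrite /cnt /rooted_count -(card_in_imset (f := f)); first by apply: leq_trans (max_card _) _; rewrite card_bool.
move=> h h'.
have [a1 [b1 [c1 [d1 [x1 [y1 [z1 ->]]]]]]] := tuple7P h.
have [a2 [b2 [c2 [d2 [x2 [y2 [z2 ->]]]]]]] := tuple7P h'.
rewrite inE [in X in _ -> X]inE !in_heps !heptE /froot /= /letterM.
case/and3P=> /and5P[ab bc cd dx /and5P[xy yz za ac /and5P[bd cx dy xz _]]].
case/eqP=> abM bcM cdM dxM xyM yzM zaM /eqP av; rewrite -[thead _]/a1 in av; subst a1.
case/and3P=> /and5P[ab' bc' cd' dx' /and5P[xy' yz' za' ac' /and5P[bd' cx' dy' xz' _]]].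
case/eqP=> abM' bcM' cdM' dxM' xyM' yzM' zaM' /eqP av; rewrite -[thead _]/a2 in av; subst a2.
rewrite /f /= => E; have FI p q : e p q -> (q == M p) = false -> F p q by rewrite /off => -> ->.
have b12 : b1 = b2 by apply: (turn_inj (mate_adj M v)) E => //; rewrite ?abM ?abM'.
subst b2; have c12 : c1 = c2 by apply: F_step (FI _ _ ab abM) (FI _ _ bc bcM) (FI _ _ bc' bcM') ac ac'.
subst c2; have d12 : d1 = d2 by apply: F_step (FI _ _ bc bcM) (FI _ _ cd cdM) (FI _ _ cd' cdM') bd bd'.
subst d2; have x12 : x1 = x2 by apply: F_step (FI _ _ cd cdM) (FI _ _ dx dxM) (FI _ _ dx' dxM') cx cx'.
subst x2; have y12 : y1 = y2 by apply: F_step (FI _ _ dx dxM) (FI _ _ xy xyM) (FI _ _ xy' xyM') dy dy'.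
subst y2; have z12 : z1 = z2 by apply: F_step (FI _ _ xy xyM) (FI _ _ yz yzM) (FI _ _ yz' yzM') xz xz'.
by subst z2.
Qed.

(** Every palindromic word is counted an even number of times, as reversal
    has no fixed heptagon; all seven rotations of a word are counted
    equally. Thus every pattern with a matching edge accounts for a
    multiple of 14 of the at most 24 rooted heptagons at v, and at most one
    occurs. *)
Lemma pattern_counts v : [/\ cnt v pat0 \in [:: 0; 2],
  thru [:: v] = cnt v pat0 + 7 * (cnt v pat1 + cnt v pat23 + cnt v pat14 + cnt v pat112),
  thru [:: v; M v] = cnt v pat1 + 2 * cnt v pat23 + 2 * cnt v pat14 + 3 * cnt v pat112 &
  (cnt v pat1, cnt v pat23, cnt v pat14, cnt v pat112) \in
    [:: (0, 0, 0, 0); (2, 0, 0, 0); (0, 2, 0, 0); (0, 0, 2, 0); (0, 0, 0, 2)]].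
Proof.
have := thru1_le v; rewrite thru_mate thru1E => le24.
have := @even_cnt v pat0 erefl; have := @even_cnt v pat1 erefl; have := @even_cnt v pat23 erefl.
have := @even_cnt v pat14 erefl; have := @even_cnt v pat112 erefl; have := cnt0_le v.
move: (cnt v pat0) (cnt v pat1) (cnt v pat23) (cnt v pat14) (cnt v pat112) le24.
move=> c0 c1 c2 c3 c4 le24 c02.
case: c4 le24 => [|[|[|[|]]]] //; case: c3 => [|[|[|[|]]]] //; case: c2 => [|[|[|[|]]]] //;
 case: c1 => [|[|[|[|]]]] //; case: c0 c02 => [|[|[|]]] //=; lia.
Qed.

Lemma cnt_ex v om : 0 < cnt v om ->
  exists b c d x y z, hept v b c d x y z /\ word letterM [:: v; b; c; d; x; y; z] = om.
Proof.
case/card_gt0P=> h; have [a [b [c [d [x [y [z ->]]]]]]] := tuple7P h.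
rewrite inE in_heps => /and3P[H /eqP wE /eqP rE]; rewrite -[froot _]/a in rE; subst a.
by exists b, c, d, x, y, z.
Qed.

Lemma cnt_gt0 v b c d x y z : hept v b c d x y z ->
  0 < cnt v (word letterM [:: v; b; c; d; x; y; z]).
Proof.
move=> H; apply/card_gt0P; exists [tuple v; b; c; d; x; y; z].
by rewrite inE in_heps H -[froot _]/v /= !eqxx.
Qed.

Lemma cnt_any v w om : cnt v om = cnt w om.
Proof. by rewrite -[om in LHS](rot0 om); apply: cnt_rot. Qed.
End Matching.

(** * Invariant matching or arc-transitivity *)

Definition arc_transitive (G : vtGraph7) := forall v a b : G, adj v a -> adj v b ->
  exists s, [/\ s \in graph_aut (@adj G), s v = v & s a = b].

Lemma distinct_values k l n : k != l -> k != n -> l != n ->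
  k \in [:: 0; 2; 4; 6] -> l \in [:: 0; 2; 4; 6] -> n \in [:: 0; 2; 4; 6] ->
  k + l + n \in [:: 2; 14; 16] -> False.
Proof.
rewrite !inE => kl kn ln /or4P Hk /or4P Hl /or4P Hn.
by case: Hk kl kn => /eqP->; case: Hl ln => /eqP->; case: Hn => /eqP->.
Qed.

Section Dichotomy.
Variable G : vtGraph7.
Local Notation e := (@adj G).
Implicit Types (a b c d x y z u v w : G) (s : {perm G}).

Definition equivariant (m : G -> G) := forall s v, s \in graph_aut e -> m (s v) = s (m v).

(** Transport the neighbour u0 of v0 by any automorphism; the choice does
    not matter. *)
Lemma equivariant_of_fixed v0 u0 :
  (forall s, s \in graph_aut e -> s v0 = v0 -> s u0 = u0) ->
  exists2 m : G -> G, m v0 = u0 & equivariant m.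
Proof.
move=> fixu.
have ex v : exists s, (s \in graph_aut e) && (s v0 == v).
  by have [s sA sv] := aut_to v0 v; exists s; rewrite sA sv eqxx.
pose g v := xchoose (ex v).
have gP v : g v \in graph_aut e /\ g v v0 = v.
  by have /andP[? /eqP] := xchooseP (ex v).
have K s t : s \in graph_aut e -> t \in graph_aut e -> s v0 = t v0 -> s u0 = t u0.
  move=> sA tA st; have := fixu (s * t^-1)%g; rewrite groupM ?groupV // => /(_ isT).
  by rewrite !permM st permK => /(_ erefl) /(canRL (permKV t)).
exists (fun v => g v u0) => [|s v sA].
  by have [gA gv] := gP v0; apply: fixu.
have [gA gv] := gP v; have [gA' gv'] := gP (s v).
rewrite -[RHS]permM; apply: K => //; first by rewrite groupM.
by rewrite permM gv.
Qed.

Lemma equivariant_inj m : equivariant m -> injective m.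
Proof.
move=> mE; have onto y : exists x, m x = y.
  have [s sA <-] := aut_to (m y) y; exists (s y).
  by rewrite mE.
suff /imset_injP mi : #|m @: [set: G]| == #|[set: G]| by move=> x y E; apply: mi; rewrite ?inE.
rewrite (_ : m @: _ = setT) //; apply/setP => y; rewrite inE.
by have [x <-] := onto y; apply: imset_f; rewrite inE.
Qed.

Lemma equivariant_adj m v0 : equivariant m -> e v0 (m v0) -> forall v, e v (m v).
Proof. by move=> mE e0 v; have [s sA <-] := aut_to v0 v; rewrite mE // autE. Qed.

Lemma equivariant_involutive m v0 : equivariant m -> m (m v0) = v0 -> involutive m.
Proof. by move=> mE e0 v; have [s sA <-] := aut_to v0 v; rewrite !mE // e0. Qed.

Lemma matching_of_equivariant m v0 : equivariant m -> e v0 (m v0) -> m (m v0) = v0 ->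
  exists2 M : matching G, M v0 = m v0 & forall v, M v = m v.
Proof.
move=> mE ma mm;
by exists (Matching (equivariant_adj mE ma) (equivariant_involutive mE mm) (fun s v sA => mE s v sA)).
Qed.

(** The point u0 defines an equivariant map m. If m is not an involution
    then u0 and the preimage of v0 are two neighbours fixed by the
    stabiliser of v0, hence so is the third neighbour, and the map that it
    defines is an involution. *)
Lemma matching_of_fixed v0 u0 : e v0 u0 ->
  (forall s, s \in graph_aut e -> s v0 = v0 -> s u0 = u0) -> exists M : matching G, true.
Proof.
move=> vu fixu; have [m m0 mE] := equivariant_of_fixed fixu.
have mi := equivariant_inj mE; have ma := equivariant_adj mE (v0 := v0); rewrite m0 in ma.
have [mm|mm] := eqVneq (m (m v0)) v0.
  by have [M] := matching_of_equivariant mE (ma vu v0) mm; exists M.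
have [p mp] : exists p, m p = v0.
  by have [s sA sv] := aut_to (m v0) v0; exists (s v0); rewrite mE.
have vp : e v0 p by rewrite -mp adj_sym ma.
have pu : u0 != p by apply: contraNneq mm => pu; rewrite m0 pu mp.
have [vq qu qp N] := thirdP vu vp pu; set q := third v0 u0 p in vq qu qp N.
have fixq s : s \in graph_aut e -> s v0 = v0 -> s q = q.
  move=> sA sv; have sp : s p = p by apply: mi; rewrite mE // mp.
  have su := fixu s sA sv.
  by rewrite -(third_aut sA vu vp pu) sv su sp.
have [m' m'0 m'E] := equivariant_of_fixed fixq.
have m'a : e v0 (m' v0) by rewrite m'0.
suff m'm' : m' (m' v0) = v0 by have [M] := matching_of_equivariant m'E m'a m'm'; exists M.
rewrite m'0; have [s sA sq] := aut_to v0 q.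
have : e v0 ((s^-1)%g v0) by rewrite -(autE _ _ sA) permKV sq adj_sym.
case/N=> /(congr1 s); rewrite permKV.
- by rewrite -m0 -mE // sq -mp => /mi E; rewrite E eqxx in qp.
- by move/(congr1 m); rewrite mE // mp sq m0 => E; rewrite E eqxx in qu.
- by rewrite -m'0 -m'E // sq m'0 => <-.
Qed.

(** A permutation group on three points fixes one of them or is transitive. *)
Lemma fixed_or_arc_transitive : (exists M : matching G, true) \/ arc_transitive G.
Proof.
have [a0 _] := hept_ex G.
have [b [c [d [bc bd cd N]]]] := nbr_enum a0.
have [ab ac ad] : [/\ e a0 b, e a0 c & e a0 d] by rewrite !N !eqxx !orbT.
pose R x y := exists s, [/\ s \in graph_aut e, s a0 = a0 & s x = y].
have Rs x y : R x y -> R y x.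
  case=> s [sA s0 sx]; exists (s^-1)%g; rewrite groupV sA; split=> //.
    by rewrite -{1}s0 permK.
  by rewrite -sx permK.
have Rt x y z : R x y -> R y z -> R x z.
  case=> s [sA s0 sx] [t [tA t0 tx]]; exists (s * t)%g.
  by rewrite groupM // !permM s0 t0 sx tx.
have Rr x : R x x by exists 1%g; rewrite group1 !perm1.
have step u : e a0 u -> (exists M : matching G, true) \/ exists2 u', R u u' & e a0 u' && (u' != u).
  move=> au; case: (boolP [forall s in graph_aut e, (s a0 == a0) ==> (s u == u)]).
    move=> H; left; apply: (matching_of_fixed au) => s sA s0.
    by have /forall_inP/(_ s sA) := H; rewrite s0 eqxx => /eqP.
  case/forall_inPn=> s sA; rewrite negb_imply => /andP[/eqP s0 su]; right.
  by exists (s u); [exists s | rewrite su -{1}s0 autE // au].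
have [|[b' Rb /andP[ab' b'b]]] := step b ab; first by left.
have [|[c' Rc /andP[ac' c'c]]] := step c ac; first by left.
have [|[d' Rd /andP[ad' d'd]]] := step d ad; first by left.
right.
have [Rbc Rbd] : R b c /\ R b d.
  move: ab' ac' ad' Rb Rc Rd b'b c'c d'd; rewrite !N.
  by case/or3P=> /eqP-> /or3P[]/eqP-> /or3P[]/eqP-> Hb Hc Hd; rewrite ?eqxx //;
   split; eauto.
have Rall x y : e a0 x -> e a0 y -> R x y.
  by rewrite !N => /or3P[]/eqP-> /or3P[]/eqP->; eauto.
move=> v x y vx vy; have [t tA tv] := aut_to v a0.
have [ax ay] : e a0 (t x) /\ e a0 (t y) by rewrite -tv !autE.
have [s [sA s0 sx]] := Rall _ _ ax ay.
exists (t * s * t^-1)%g; rewrite !groupM ?groupV // !permM tv s0 sx permK; split=> //.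
by rewrite -{1}tv permK.
Qed.

(** The edge at v0 that is singled out by its number of heptagons is
    singled out from both of its ends, since these numbers are symmetric. *)
Lemma matching_by_value v0 u0 n : e v0 u0 -> thru [:: v0; u0] = n ->
  (forall u, e v0 u -> thru [:: v0; u] = n -> u = u0) ->
  exists2 M : matching G, M v0 = u0 & forall v, thru [:: v; M v] = n.
Proof.
move=> vu tn un.
have fixu s : s \in graph_aut e -> s v0 = v0 -> s u0 = u0.
  move=> sA s0; apply: un; first by rewrite -{1}s0 autE.
  by rewrite -{1}s0 (thru_aut [:: v0; u0] sA).
have [m m0 mE] := equivariant_of_fixed fixu.
have tm v : thru [:: v; m v] = n.
  have [s sA <-] := aut_to v0 v; rewrite mE // (thru_aut [:: v0; m v0] sA) m0 //.
have um v u : e v u -> thru [:: v; u] = n -> u = m v.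
  have [s sA <-] := aut_to v0 v; rewrite -{1 2}[u](permKV s) autE // (thru_aut [:: v0; _] sA).
  by move=> H1 H2; rewrite mE // m0 -(un _ H1 H2) permKV.
have ma : e v0 (m v0) by rewrite m0.
have mm : m (m v0) = v0 by apply/esym/um; rewrite 1?adj_sym // thru2_sym.
have [M M0 ME] := matching_of_equivariant mE ma mm.
by exists M => [|v]; rewrite ?M0 ?ME.
Qed.

Lemma thru1_gt0 v : 0 < thru [:: v].
Proof.
have [b [c [d [x [y [z H]]]]]] := hept_ex_at v (hept_ex G).
by apply/card_gt0P; exists [tuple v; b; c; d; x; y; z]; rewrite inE in_heps H /= eqxx.
Qed.

Lemma matching_values (M : matching G) v :
  [/\ thru [:: v] \in [:: 2; 14; 16], thru [:: v; M v] \in [:: 0; 2; 4; 6]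
    & thru [:: v] = 2 -> thru [:: v; M v] = 0].
Proof.
have := thru1_gt0 v; have [c0 -> -> c] := pattern_counts M v; move: c0 c.
move: (cnt M v pat0) (cnt M v pat1) (cnt M v pat23) (cnt M v pat14) (cnt M v pat112) => c0 c1 c2 c3 c4.
by rewrite !inE => /orP[]/eqP -> /or4P[|||/orP[]]/eqP[-> -> -> ->].
Qed.

(** Compare the numbers of heptagons through the three edges at a vertex.
    If exactly one of them differs, it singles out a matching. If they are
    distinct, all three edges are in invariant matchings, so they are
    distinct numbers among 0, 2, 4 and 6 of sum 2, 14 or 16, which do not
    exist. If they are equal and an invariant matching exists, three times
    an even number at most 6 would be 2, 14 or 16; so there is none, and
    the stabiliser of the vertex is transitive on its neighbours. *)
Lemma matching_or_arc_transitive :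
  (exists M : matching G, forall v p q, off M v p -> off M v q -> thru [:: v; p] = thru [:: v; q])
  \/ arc_transitive G.
Proof.
have [a0 _] := hept_ex G.
have [b [c [d [bc bd cd N]]]] := nbr_enum a0.
have [ab ac ad] : [/\ e a0 b, e a0 c & e a0 d] by rewrite !N !eqxx !orbT.
have total := thru1 bc bd cd N.
have one u u1 u2 : e a0 u -> e a0 u1 -> e a0 u2 -> u != u1 -> u != u2 -> u1 != u2 ->
   thru [:: a0; u1] = thru [:: a0; u2] -> thru [:: a0; u] != thru [:: a0; u1] ->
   exists M : matching G, forall v p q, off M v p -> off M v q -> thru [:: v; p] = thru [:: v; q].
  move=> au au1 au2 uu1 uu2 u12 t12 tu.
  have [|M Mu Mt] := matching_by_value au erefl.
    move=> y ay; have [_ _ _ /(_ _ ay)] := thirdP au au1 uu1.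
    rewrite (third_eq au au1 au2) //; case=> // -> E; first by rewrite E eqxx in tu.
    by rewrite t12 -E eqxx in tu.
  exists M => v p q; have [s sA <-] := aut_to a0 v; rewrite /off.
  rewrite -[p](permKV s) -[q](permKV s) !autE // (mate_aut M _ sA) !(inj_eq perm_inj).
  rewrite !(thru_aut [:: a0; _] sA) Mu; move: (s^-1%g p) (s^-1%g q) => p' q'.
  case/andP=> ap pu /andP[aq qu].
  have [_ _ _ N'] := thirdP au au1 uu1; rewrite (third_eq au au1 au2) // in N'.
  by case: (N' _ ap) pu => ->; rewrite ?eqxx // => _; case: (N' _ aq) qu => ->; rewrite ?eqxx.
have [tbc|tbc] := eqVneq (thru [:: a0; b]) (thru [:: a0; c]).
  have [tbd|tbd] := eqVneq (thru [:: a0; b]) (thru [:: a0; d]); last first.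
    by left; apply: (one d b c) => //; rewrite eq_sym.
  case: fixed_or_arc_transitive => [[M _]|]; last by right.
  have [] := matching_values M a0.
  have : thru [:: a0; M a0] = thru [:: a0; b].
    by have := mate_adj M a0; rewrite N => /or3P[]/eqP ->.
  move=> ->; rewrite total -tbd -tbc !inE => /or3P Ht /or4P Hb; exfalso.
  by case: Hb Ht => /eqP-> [].
have [tbd|tbd] := eqVneq (thru [:: a0; b]) (thru [:: a0; d]).
  by left; apply: (one c b d) => //; rewrite eq_sym.
have [tcd|tcd] := eqVneq (thru [:: a0; c]) (thru [:: a0; d]).
  by left; apply: (one b c d).
have V u u1 u2 : e a0 u -> e a0 u1 -> e a0 u2 -> u != u1 -> u != u2 -> u1 != u2 ->
    thru [:: a0; u] != thru [:: a0; u1] -> thru [:: a0; u] != thru [:: a0; u2] ->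
    [/\ thru [:: a0] \in [:: 2; 14; 16], thru [:: a0; u] \in [:: 0; 2; 4; 6]
    & thru [:: a0] = 2 -> thru [:: a0; u] = 0].
  move=> au au1 au2 uu1 uu2 u12 t1 t2.
  have [|M <- _] := matching_by_value au erefl; last exact: matching_values.
  move=> y ay; have [_ _ _ /(_ _ ay)] := thirdP au au1 uu1.
  rewrite (third_eq au au1 au2) //; case=> // -> E; first by rewrite E eqxx in t1.
  by rewrite E eqxx in t2.
have [tot Vb _] := V b c d ab ac ad bc bd cd tbc tbd.
have [_ Vc _] : [/\ thru [:: a0] \in [:: 2; 14; 16], thru [:: a0; c] \in [:: 0; 2; 4; 6]
    & thru [:: a0] = 2 -> thru [:: a0; c] = 0] by apply: (V c b d); rewrite // eq_sym.
have [_ Vd _] : [/\ thru [:: a0] \in [:: 2; 14; 16], thru [:: a0; d] \in [:: 0; 2; 4; 6]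
    & thru [:: a0] = 2 -> thru [:: a0; d] = 0] by apply: (V d b c); rewrite // eq_sym.
by exfalso; apply: distinct_values tbc tbd tcd Vb Vc Vd _; rewrite -total.
Qed.
End Dichotomy.

(** * Faces and signatures *)

Lemma pair_eq (T : finType) (p q a b : T) : [set p; q] = [set a; b] -> (p = a /\ q = b) \/ (p = b /\ q = a).
Proof.
move/setP=> E; have := (E p, E q, E a, E b); rewrite !inE !eqxx ?orbT /=.
by case=> [[[/esym/orP[]/eqP ? /esym/orP[]/eqP ?] /orP[]/eqP ?] /orP[]/eqP ?]; subst; auto.
Qed.

Section Faces.
Variable G : vtGraph7.
Local Notation e := (@adj G).
Implicit Types (a b c d x y z t u v w p q r o : G) (s : {perm G}) (F : {set {set G}}).

Definition face a b c d x y z : {set {set G}} := cycle_edges [:: a; b; c; d; x; y; z].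

Lemma in_face a b c d x y z E : hept a b c d x y z ->
  (E \in face a b c d x y z) = [|| E == [set a; b], E == [set b; c], E == [set c; d], E == [set d; x],
    E == [set x; y], E == [set y; z] | E == [set z; a]].
Proof.
move=> H; have := H; rewrite /hept /ucycleb => /andP[_ U].
have N (i : nat) : (i < 7)%N -> next [:: a; b; c; d; x; y; z] (nth a [:: a; b; c; d; x; y; z] i) =
    nth a [:: a; b; c; d; x; y; z] (if i == 6 then 0 else i.+1).
  move=> i7; rewrite next_nth mem_nth // index_uniq //.
  by case: i i7 => [|[|[|[|[|[|[|]]]]]]].
set h := [:: a; b; c; d; x; y; z] in N *.
have Na : next h a = b := N 0 isT.
have Nb : next h b = c := N 1 isT.
have Nc : next h c = d := N 2 isT.
have Nd : next h d = x := N 3 isT.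
have Nx : next h x = y := N 4 isT.
have Ny : next h y = z := N 5 isT.
have Nz : next h z = a := N 6 isT.
apply/imsetP/idP => [[t]|].
  by rewrite !inE => + ->; do 6?case/orP; move/eqP->; rewrite ?(Na, Nb, Nc, Nd, Nx, Ny, Nz) eqxx ?orbT.
do 6?case/orP; move/eqP->.
- by exists a; rewrite ?Na // !inE eqxx ?orbT.
- by exists b; rewrite ?Nb // !inE eqxx ?orbT.
- by exists c; rewrite ?Nc // !inE eqxx ?orbT.
- by exists d; rewrite ?Nd // !inE eqxx ?orbT.
- by exists x; rewrite ?Nx // !inE eqxx ?orbT.
- by exists y; rewrite ?Ny // !inE eqxx ?orbT.
- by exists z; rewrite ?Nz // !inE eqxx ?orbT.
Qed.

Lemma face_rot a b c d x y z : hept a b c d x y z -> face b c d x y z a = face a b c d x y z.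
Proof.
move=> H; apply/setP => E; rewrite (in_face _ H) (in_face _ (hept_rot H)).
by apply/idP/idP; do 6?case/orP; move=> ->; rewrite ?orbT.
Qed.

Lemma face_rev a b c d x y z : hept a b c d x y z -> face a z y x d c b = face a b c d x y z.
Proof.
move=> H; apply/setP => E; rewrite (in_face _ H) (in_face _ (hept_rev H)).
rewrite [[set a; z]]setUC [[set z; y]]setUC [[set y; x]]setUC [[set x; d]]setUC.
rewrite [[set d; c]]setUC [[set c; b]]setUC [[set b; a]]setUC.
by apply/idP/idP; do 6?case/orP; move=> ->; rewrite ?orbT.
Qed.

Lemma kcycle7P F : reflect (exists a b c d x y z, hept a b c d x y z /\ F = face a b c d x y z) (kcycle e 7 F).
Proof.
apply: (iffP existsP) => [[h]|[a [b [c [d [x [y [z [H ->]]]]]]]]]; last first.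
  by exists [tuple a; b; c; d; x; y; z]; apply/andP; split => //=.
have [a [b [c [d [x [y [z ->]]]]]]] := tuple7P h.
by case/andP=> H /eqP ->; exists a, b, c, d, x, y, z.
Qed.

Lemma kcycle_through F v w : kcycle e 7 F -> [set v; w] \in F ->
  exists c d x y z, hept v w c d x y z /\ F = face v w c d x y z.
Proof.
case/kcycle7P=> [a [b [c [d [x [y [z [H ->]]]]]]]]; rewrite (in_face _ H).
have st p q r o t u' w' : hept p q r o t u' w' -> face p q r o t u' w' = face a b c d x y z ->
    [set v; w] == [set p; q] -> exists c' d' x' y' z', hept v w c' d' x' y' z' /\ face a b c d x y z = face v w c' d' x' y' z'.
  move=> H' <- /eqP/pair_eq[[-> ->]|[-> ->]]; first by exists r, o, t, u', w'.
  exists w', u', t, o, r; split; first exact/hept_rev/hept_rot.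
  by rewrite -(face_rot H') -(face_rev (hept_rot H')).
have H1 := hept_rot H; have H2 := hept_rot H1; have H3 := hept_rot H2; have H4 := hept_rot H3.
have H5 := hept_rot H4; have H6 := hept_rot H5.
do 6?case/orP; [exact: st H _|apply: st H1 _|apply: st H2 _|apply: st H3 _|apply: st H4 _|apply: st H5 _|apply: st H6 _];
 by rewrite ?(face_rot H5) ?(face_rot H4) ?(face_rot H3) ?(face_rot H2) ?(face_rot H1) ?(face_rot H).
Qed.

Lemma face_step a b c d x y z q : hept a b c d x y z -> [set b; q] \in face a b c d x y z -> q != a -> q = c.
Proof.
move=> H; rewrite (in_face _ H) => + qa.
have := H; rewrite /hept /ucycleb /= !inE !negb_or => /andP[_].
case/andP=> /and5P[ab _ _ _ _] /andP[/and5P[bc bd bx by_ bz] _].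
by do 6?case/orP; move/eqP/pair_eq => [[E1 E2]|[E1 E2]]; rewrite // ?E1 ?E2 ?eqxx // in ab bc bd bx by_ bz qa *.
Qed.

Lemma face_uniq a b c d x y z c' d' x' y' z' : hept a b c d x y z -> hept a b c' d' x' y' z' ->
  face a b c d x y z = face a b c' d' x' y' z' -> [/\ c = c', d = d', x = x', y = y' & z = z'].
Proof.
move=> H H' E.
have next p q r o t u' w' q' r' o' t' u'' w'' : hept p q r o t u' w' -> hept p q r' o' t' u'' w'' ->
    face p q r o t u' w' = face p q r' o' t' u'' w'' -> q' = r' -> r = r'.
  move=> K K' EF _; apply/esym; apply: (face_step K).
    by rewrite EF (in_face _ K') eqxx orbT.
  by move: K'; rewrite heptE eq_sym => /and5P[_ _ _ _ /and4P[_ _ _ /andP[]]].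
have cE : c = c' by apply: next H H' E erefl.
subst c'; have K := hept_rot H; have K' := hept_rot H'; rewrite -(face_rot H) -(face_rot H') in E.
have dE : d = d' by apply: next K K' E erefl.
subst d'; have L := hept_rot K; have L' := hept_rot K'; rewrite -(face_rot K) -(face_rot K') in E.
have xE : x = x' by apply: next L L' E erefl.
by subst x'; have [-> ->] := hept_arc4 H H'.
Qed.

(** A cycle through the edge v, w can be read in one way from v over w. *)
Lemma girth_through v w : girth_cycles_through e [set v; w] = thru [:: v; w].
Proof.
rewrite /girth_cycles_through (adj_girth G) /thru -(card_in_imset (f := fun h : 7.-tuple G => cycle_edges h)).
  apply: eq_card => F; apply/setIdP/imsetP => [[FK vF]|[h]].
    have [c [d [x [y [z [H FE]]]]]] := kcycle_through FK vF.
    exists [tuple v; w; c; d; x; y; z] => //.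
    by apply/setIdP; split; [rewrite in_heps | rewrite /= !eqxx].
  have [a [b [c [d [x [y [z ->]]]]]]] := tuple7P h.
  case/setIdP=> H /and3P[/eqP -> /eqP -> _] ->; rewrite in_heps in H; split; last first.
    by rewrite (in_face _ H) eqxx.
  by apply/kcycle7P; exists a, b, c, d, x, y, z.
move=> h h'; have [a [b [c [d [x [y [z ->]]]]]]] := tuple7P h.
have [a' [b' [c' [d' [x' [y' [z' ->]]]]]]] := tuple7P h'.
rewrite [[tuple _; _; _; _; _; _; _] \in _](_ : _ = hept a b c d x y z && ((v == a) && (w == b))); last first.
  by rewrite inE in_heps /= andbT.
rewrite [[tuple _; _; _; _; _; _; _] \in _](_ : _ = hept a' b' c' d' x' y' z' && ((v == a') && (w == b'))); last first.
  by rewrite inE in_heps /= andbT.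
case/and3P=> H /eqP va /eqP wb; case/and3P=> H' /eqP va' /eqP wb' E; subst.
by subst; have [-> -> -> -> ->] := face_uniq H H' E.
Qed.

Lemma edge_mem v w : ([set v; w] \in edges e) = e v w.
Proof.
apply/imsetP/idP => [[[a b]]|vw]; last by exists (v, w); rewrite ?inE.
rewrite inE /= => ab /pair_eq[[-> ->]|[-> ->]] //; by rewrite adj_sym.
Qed.

Lemma edges_atE v E : (E \in edges_at e v) = [exists w, e v w && (E == [set v; w])].
Proof.
apply/setIdP/existsP => [[/imsetP[[a b]]]|[w /andP[vw /eqP ->]]].
  rewrite !inE /= => ab ->; rewrite !inE => /orP[]/eqP ->.
    by exists b; rewrite ab eqxx.
  by exists a; rewrite adj_sym ab setUC eqxx.
by rewrite edge_mem vw set21.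
Qed.

Lemma signature_thru v a b c : e v a -> e v b -> e v c -> a != b -> a != c -> b != c ->
  vertex_signature e v = sort leq [:: thru [:: v; a]; thru [:: v; b]; thru [:: v; c]].
Proof.
move=> va vb vc ab ac bc; rewrite /vertex_signature -!girth_through.
apply/perm_sortP; [exact: leq_total|exact: leq_trans|exact: anti_leq|].
apply: (@perm_map _ _ (girth_cycles_through e) (enum (edges_at e v)) [:: [set v; a]; [set v; b]; [set v; c]]).
have inj w w' : [set v; w] = [set v; w'] -> w = w' by case/pair_eq=> [[]|[-> ->]].
apply: uniq_perm; first exact: enum_uniq.
  have ninj w w' : w != w' -> [set v; w] != [set v; w'] by apply: contraNneq => /inj ->.
  by rewrite /= !inE negb_or !ninj.
move=> E; rewrite mem_enum edges_atE !inE; apply/existsP/idP => [[w /andP[vw /eqP ->]]|].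
  have [_ _ _ /(_ _ vw)] := thirdP va vb ab; rewrite (third_eq va vb vc ab ac bc).
  by case=> ->; rewrite eqxx ?orbT.
by case/or3P=> /eqP ->; [exists a|exists b|exists c]; rewrite eqxx andbT.
Qed.
End Faces.

(** * Disjoint heptagons and truncations *)

(** A permutation that respects the fibres of a surjection acts on the
    quotient. *)
Lemma induced_perm (T X : finType) (q : T -> X) (s : {perm T}) :
  (forall x, exists v, q v = x) -> (forall v w, (q (s v) == q (s w)) = (q v == q w)) ->
  exists t : {perm X}, forall v, t (q v) = q (s v).
Proof.
move=> onto qs; have [p pK] := fin_all_exists onto.
have inj : injective (fun x => q (s (p x))).
  by move=> x y /eqP; rewrite qs !pK => /eqP.
by exists (perm inj) => v; rewrite permE; apply/eqP; rewrite qs pK.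
Qed.

Section Truncation.
Variable G : vtGraph7.
Variable M : matching G.
Local Notation e := (@adj G).
Local Notation F := (off M).
Hypothesis M0 : forall v, thru [:: v; M v] = 0.
Implicit Types (a b c d x y z u v w : G) (s : {perm G}).

Lemma hept_F a b c d x y z : hept a b c d x y z -> F a b.
Proof.
move=> H; have := H; rewrite heptE => /andP[ab _]; rewrite /off ab /=; apply/eqP => bM.
have := M0 a; apply/eqP; rewrite -lt0n; apply/card_gt0P; exists [tuple a; b; c; d; x; y; z].
by apply/setIdP; rewrite in_heps -bM /= !eqxx.
Qed.

Lemma F_irr : irreflexive F. Proof. by move=> v; rewrite /off adj_irr. Qed.

Lemma F_csym : connect_sym F.
Proof. by apply: sym_connect_sym => v w; rewrite F_sym. Qed.

Lemma F_nbrs a b z w : F a b -> F a z -> b != z -> F a w = (w == b) || (w == z).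
Proof.
move=> /andP[ab nb] /andP[az nz] bz; apply/idP/orP => [/andP[aw nw]|[]/eqP ->]; rewrite /off ?ab ?az //.
have [_ _ _ /(_ _ aw)] := thirdP ab az bz.
rewrite (third_eq ab az (mate_adj M a)) // => -[->|->|wM]; rewrite ?eqxx; auto.
by rewrite wM eqxx in nw.
Qed.

(** With no heptagon through the matching, the edges of heptagons are the
    edges off the matching, and their components are the heptagons. *)
Lemma heptagon_at v : exists b c d x y z, [/\ hept v b c d x y z,
  uniq [:: v; b; c; d; x; y; z], forall w, connect F v w = (w \in [:: v; b; c; d; x; y; z]) &
  {in [:: v; b; c; d; x; y; z] &, forall t w, F t w =
    (w == next [:: v; b; c; d; x; y; z] t) || (t == next [:: v; b; c; d; x; y; z] w)}].
Proof.
have [b [c [d [x [y [z H]]]]]] := hept_ex_at v (hept_ex G).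
exists b, c, d, x, y, z; have /andP[_ U] := H.
have H1 := hept_rot H; have H2 := hept_rot H1; have H3 := hept_rot H2; have H4 := hept_rot H3.
have H5 := hept_rot H4; have H6 := hept_rot H5; set h := [:: v; b; c; d; x; y; z] in U *.
have step t : t \in h -> F t (next h t) /\ F t (prev h t).
  suff S t' : t' \in h -> F t' (next h t').
    move=> th; split; first exact: S; rewrite F_sym -{2}(next_prev U t).
    by apply: S; rewrite mem_prev.
  move=> t'h; have i7 : index t' h < 7 by rewrite index_mem.
  have := next_nth h t'; rewrite t'h => ->; rewrite -{1}(nth_index v t'h).
  case: (index t' h) i7 => [|[|[|[|[|[|[|]]]]]]] // _;
    [exact: hept_F H|exact: hept_F H1|exact: hept_F H2|exact: hept_F H3|exact: hept_F H4|exact: hept_F H5|exact: hept_F H6].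
have FE t w : t \in h -> F t w = (w == next h t) || (w == prev h t).
  move=> th; have [f1 f2] := step t th; apply: F_nbrs => //.
  apply/eqP => E; have := next_prev U t; rewrite -E.
  have i7 : index t h < 7 by rewrite index_mem.
  have hn k : k < 7 -> next h (nth v h k) = nth v h (k.+1 %% 7).
    move=> k7; rewrite next_nth mem_nth // index_uniq //.
    by case: k k7 => [|[|[|[|[|[|[|]]]]]]].
  rewrite -(nth_index v th) !hn ?ltn_pmod // => /eqP; rewrite nth_uniq ?ltn_pmod //.
  by case: (index t h) i7 => [|[|[|[|[|[|[|]]]]]]].
split=> //.
  move=> w; apply/connectP/idP => [[p]|wh].
    elim/last_ind: p w => [|p t IH] w /=; first by move=> _ ->; rewrite inE eqxx.
    rewrite rcons_path last_rcons => /andP[pp ft] ->; have th := IH _ pp erefl.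
    by move: ft; rewrite FE // => /orP[]/eqP ->; rewrite ?mem_next ?mem_prev.
  apply/connectP; have i7 : index w h < 7 by rewrite index_mem.
  rewrite -(nth_index v wh); elim: (index w h) i7 => [|k IH] k7; first exact: connect0.
  apply: connect_trans (IH (ltnW k7)) (connect1 _).
  by case: k {IH} k7 => [|[|[|[|[|[|]]]]]] // _;
   [exact: hept_F H|exact: hept_F H1|exact: hept_F H2|exact: hept_F H3|exact: hept_F H4|exact: hept_F H5].
move=> t w th wh; rewrite FE //; congr (_ || _).
apply/eqP/eqP => [->|->]; first by rewrite next_prev.
by rewrite prev_next.
Qed.

(** A chord of a heptagon would close a shorter cycle. *)
Lemma mate_apart v : ~~ connect F v (M v).
Proof.
have [b [c [d [x [y [z [H U -> _]]]]]]] := heptagon_at v; have vM := mate_adj M v.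
have [_ FM1] := andP (hept_F H); have [_ FM2] := andP (hept_F (hept_rev H)).
move: H; rewrite heptE => /and5P[vb bc cd dx /and5P[xy yz zv vc /and5P[bd cx dy xz /andP[yv zb]]]].
apply/negP; rewrite !inE => /orP[/eqP E|/or4P[|||/or3P[]]] //.
- by rewrite E adj_irr in vM.
- by rewrite eq_sym (negbTE FM1).
- by move/eqP=> E; rewrite E in vM; have n := adj_neq vb; short v [:: b; c; v].
- by move/eqP=> E; rewrite E in vM; short v [:: b; c; d; v].
- by move/eqP=> E; rewrite E in vM; short v [:: z; y; x; v].
- by move/eqP=> E; rewrite E in vM; have n := adj_neq zv; short v [:: z; y; v].
- by rewrite eq_sym (negbTE FM2).
Qed.

(** The vertices of the quotient graph are the heptagons and its edges are
    the edges of the matching. *)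
Definition block v : {set G} := [set w | connect F v w].
Definition block_type : finType := {B : {set G} | B \in [set block v | v : G]}.
Definition bond_type : finType := {E : {set G} | E \in [set [set v; M v] | v : G]}.

Fact block_mem v : block v \in [set block w | w : G]. Proof. exact: imset_f. Qed.
Fact bond_mem v : [set v; M v] \in [set [set w; M w] | w : G].
Proof. exact: (imset_f (fun w => [set w; M w])). Qed.

Definition block_of v : block_type := Sub (block v) (block_mem v).
Definition bond_of v : bond_type := Sub [set v; M v] (bond_mem v).

Lemma block_of_onto B : exists v, block_of v = B.
Proof. by case: B => B BP; have /imsetP[v _ E] := BP; exists v; apply: val_inj. Qed.

Lemma bond_of_onto D : exists v, bond_of v = D.
Proof. by case: D => D DP; have /imsetP[v _ E] := DP; exists v; apply: val_inj. Qed.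

Lemma block_ofE v w : (block_of v == block_of w) = connect F v w.
Proof.
rewrite -(inj_eq val_inj) /=; apply/eqP/idP => [E|vw].
  have : w \in block w by rewrite inE connect0.
  by rewrite -E inE.
by apply/setP => t; rewrite !inE (same_connect F_csym vw).
Qed.

Lemma bond_ofE v w : (bond_of v == bond_of w) = (w == v) || (w == M v).
Proof.
rewrite -(inj_eq val_inj) /=; apply/eqP/idP => [/setP/(_ w)|/orP[]/eqP ->] //.
  by rewrite !inE eqxx => ->.
by rewrite mateK setUC.
Qed.

Definition bond_ends (D : bond_type) : {set block_type} := [set block_of w | w in val D].

Lemma bond_endsE v : bond_ends (bond_of v) = [set block_of v; block_of (M v)].
Proof. by rewrite /bond_ends /= imsetU !imset_set1. Qed.

Lemma bond_endsP D : #|bond_ends D| = 2.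
Proof.
by have [v <-] := bond_of_onto D; rewrite bond_endsE cards2 block_ofE mate_apart.
Qed.

(** Parallel edges occur when two heptagons are joined by several matching
    edges. *)
Definition quotient_graph := Multigraph bond_endsP.

(** The vertex v is the arc along the matching edge at v that begins at the
    heptagon of v. *)
Definition arc_of v : mg_arc quotient_graph.
Proof.
by exists (bond_of v, block_of v); rewrite [mg_ends _]bond_endsE set21.
Defined.

Lemma arc_of_inj : injective arc_of.
Proof.
move=> v w E; have /eqP : block_of v = block_of w := congr1 (@arc_begin _) E.
have /eqP : bond_of v = bond_of w := congr1 (@arc_edge _) E.
by rewrite bond_ofE block_ofE => /orP[/eqP //|/eqP ->]; rewrite (negbTE (mate_apart v)).
Qed.

Lemma arc_of_onto A : exists v, arc_of v = A.
Proof.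
case: A => -[D B] /= DB; have [v vD] := bond_of_onto D; subst D.
have : B \in bond_ends (bond_of v) := DB.
rewrite bond_endsE !inE => /orP[]/eqP BE; subst B.
  by exists v; apply: val_inj.
exists (M v); apply: val_inj; congr (_, _); apply/eqP.
by rewrite -[_ == _]/(bond_of (M v) == bond_of v) bond_ofE mateK eqxx orbT.
Qed.

Lemma arc_inverse : exists g, cancel arc_of g /\ cancel g arc_of.
Proof.
have [g gK] := fin_all_exists arc_of_onto; exists g; split=> // v.
by apply: arc_of_inj; rewrite gK.
Qed.

Lemma card_block v : #|block v| = 7.
Proof.
have [b [c [d [x [y [z [_ U vE _]]]]]]] := heptagon_at v.
transitivity #|[:: v; b; c; d; x; y; z]|; last exact: card_uniqP.
by apply: eq_card => w; rewrite inE vE.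
Qed.

Lemma card_bonds B : #|[set D : bond_type | B \in bond_ends D]| = 7.
Proof.
have [v <-] := block_of_onto B; rewrite -(card_block v) -(card_in_imset (f := bond_of)); last first.
  move=> t w; rewrite !in_set => vt vw /eqP; rewrite bond_ofE => /orP[/eqP //|/eqP wM].
  by case/negP: (mate_apart t); rewrite -wM; apply: connect_trans vw; rewrite F_csym.
apply: eq_card => D; rewrite in_set; apply/idP/imsetP => [|[w]].
  have [w <-] := bond_of_onto D; rewrite bond_endsE in_setU !in_set1 !block_ofE.
  case/orP=> vw; first by exists w; rewrite // in_set.
  by exists (M w); rewrite ?in_set //; apply/eqP; rewrite bond_ofE eqxx orbT.
by rewrite in_set => vw ->; rewrite bond_endsE in_setU !in_set1 block_ofE vw.
Qed.

Lemma quotient_regular : mg_regular quotient_graph 7.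
Proof. exact: card_bonds. Qed.

(** The dihedral scheme is the adjacency on the heptagons, transported to
    arcs; an automorphism of the graph acts on heptagons and on matching
    edges. *)
Lemma truncation_of_quotient : exists (L : multigraph) (r : rel (mg_arc L)),
  [/\ mg_regular L 7, dihedral_scheme r, scheme_arc_transitive r & graph_iso e (truncation r)].
Proof.
have [g [fK gK]] := arc_inverse.
exists quotient_graph, (fun A B => F (g A) (g B)); split.
- exact: quotient_regular.
- have cE A B : connect (fun A B => F (g A) (g B)) A B = connect F (g A) (g B).
    apply/connectP/connectP => [[p pp ->]|[p pp E]].
      by exists (map g p); rewrite ?last_map // path_map.
    exists (map arc_of p); last by rewrite -(gK A) last_map -E gK.
    rewrite -{1}(gK A) path_map; apply: sub_path pp => t w /=.
    by rewrite !fK.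
  split.
  + by move=> A; rewrite F_irr.
  + by move=> A B; rewrite F_sym.
  + move=> A; have [b [c [d [x [y [z [_ U vE N]]]]]]] := heptagon_at (g A).
    exists (map arc_of [:: g A; b; c; d; x; y; z]); split=> //.
    * by rewrite map_inj_uniq //; exact: arc_of_inj.
    * move=> B; rewrite -{1}(gK B) mem_map; last exact: arc_of_inj.
      by rewrite -vE -cE.
    * move=> B C; rewrite -(gK B) -(gK C) !mem_map; try exact: arc_of_inj.
      move=> hB hC; rewrite !fK N // !next_map; try exact: arc_of_inj; rewrite // !(inj_eq arc_of_inj) //.
  move=> A B; rewrite cE -block_ofE -{2}(gK A) -{2}(gK B).
  by [].
- move=> A B; have [s sA sAB] := aut_to (g A) (g B).
  have Fs v w : F (s v) (s w) = F v w by rewrite /off (autE _ _ sA) mate_aut // (inj_eq perm_inj).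
  have cs v w : connect F (s v) (s w) = connect F v w.
    have le s' v' w' : (forall v w, F (s' v) (s' w) = F v w) -> connect F v' w' -> connect F (s' v') (s' w').
      move=> Fs' /connectP[p pp ->]; apply/connectP; exists (map s' p); last by rewrite last_map.
      by rewrite path_map; apply: sub_path pp => t u; rewrite /= Fs'.
    apply/idP/idP; last exact: le.
    move/(le s^-1%g); rewrite !permK; apply=> v' w'.
    by rewrite -[in RHS](permKV s v') -[in RHS](permKV s w') Fs.
  have [tV tVE] := induced_perm (s := s) block_of_onto (fun v w => etrans (block_ofE _ _) (etrans (cs v w) (esym (block_ofE _ _)))).
  have bs v w : (bond_of (s v) == bond_of (s w)) = (bond_of v == bond_of w).
    by rewrite !bond_ofE mate_aut // !(inj_eq perm_inj).
  have [tE tEE] := induced_perm bond_of_onto bs.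
  have tP D : bond_ends (tE D) = tV @: bond_ends D.
    have [v <-] := bond_of_onto D; rewrite tEE !bond_endsE imsetU !imset_set1.
    by rewrite !tVE mate_aut.
  pose t := @MgAut quotient_graph tV tE tP.
  have tarc v : mg_aut_arc t (arc_of v) = arc_of (s v).
    by apply: val_inj; rewrite /= /arc_edge /arc_begin /= tVE tEE.
  exists t; last by rewrite -(gK A) tarc sAB gK.
  by move=> C D; rewrite -(gK C) -(gK D) !tarc !fK Fs.
exists arc_of; first by exists g.
move=> v w; rewrite /truncation !fK (inj_eq arc_of_inj).
rewrite -[arc_edge _ == _]/(bond_of v == bond_of w) bond_ofE.
rewrite /off; have [-> | vw] := eqVneq v w; first by rewrite adj_irr.
rewrite /=; have [->|] := eqVneq w (M v); first by rewrite (mate_adj M).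
by rewrite andbT orbF.
Qed.
End Truncation.

Local Open Scope ring_scope.

(** * The lines complementary to a matching *)

Lemma int_shift_ind (P : int -> Prop) : P 0 -> (forall i, P i -> P (i + 1)) ->
  (forall i, P i -> P (i - 1)) -> forall i, P i.
Proof.
move=> P0 Pp Pm; case; elim=> [|n IH] //.
- by rewrite (_ : Posz n.+1 = Posz n + 1); [apply: Pp | lia].
- by rewrite (_ : Negz 0 = 0 - 1); [apply: Pm | lia].
- by rewrite (_ : Negz n.+1 = Negz n - 1); [apply: Pm | lia].
Qed.

Section Lines.
Variable G : vtGraph7.
Variable M : matching G.
Local Notation e := (@adj G).
Local Notation F := (off M).
Implicit Types (a b c d u v w : G) (s : {perm G}) (i j k : int) (x y : int -> G).

(** The connected components of the 2-factor off M are cycles; they are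
    unrolled to maps from the integers, which may repeat. *)
Definition line x := forall i, F (x i) (x (i + 1)) /\ x i != x (i + 2).

(** One step along the 2-factor, on its oriented edges; backward is the
    inverse step. *)
Definition onward (p : G * G) := (p.2, third p.2 (M p.2) p.1).
Definition backward (p : G * G) := (third p.1 (M p.1) p.2, p.1).

Lemma F_adj a b : F a b -> e a b. Proof. by case/andP. Qed.
Lemma F_mate a b : F a b -> b != M a. Proof. by case/andP. Qed.

Lemma onwardP p : F p.1 p.2 -> F (onward p).1 (onward p).2 /\ (onward p).2 != p.1.
Proof.
case: p => a b /=; rewrite F_sym => /andP[ba aM].
have Ma : M b != a by rewrite eq_sym.
have [H1 H2 H3 _] := thirdP (mate_adj M b) ba Ma.
by rewrite /off /= H1 H2.
Qed.

Lemma onwardK p : F p.1 p.2 -> backward (onward p) = p.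
Proof.
case: p => a b /=; rewrite F_sym => /andP[ba aM].
have Ma : M b != a by rewrite eq_sym.
have [H1 H2 H3 _] := thirdP (mate_adj M b) ba Ma.
rewrite /backward /=; congr (_, _).
by apply: third_eq; rewrite ?mate_adj // eq_sym.
Qed.

Lemma backwardP p : F p.1 p.2 -> F (backward p).1 (backward p).2 /\ (backward p).1 != p.2.
Proof.
case: p => a b /= ab; have ba : F b a by rewrite F_sym.
by have [H1 H2] := onwardP (p := (b, a)) ba; rewrite F_sym.
Qed.

Lemma backwardK p : F p.1 p.2 -> onward (backward p) = p.
Proof.
case: p => a b /= ab; have := @onwardK (b, a); rewrite /= F_sym => /(_ ab).
by rewrite /backward /onward /= => -[->].
Qed.

Definition dart_at p i := match i with Posz n => iter n onward p | Negz n => iter n.+1 backward p end.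

Lemma dart_F p i : F p.1 p.2 -> F (dart_at p i).1 (dart_at p i).2.
Proof.
move=> Fp; case: i => n; first by elim: n => // n IH; case: (onwardP IH).
by rewrite /dart_at; elim: n.+1 => // k IH; case: (backwardP IH).
Qed.

Lemma dart_succ p i : F p.1 p.2 -> dart_at p (i + 1) = onward (dart_at p i).
Proof.
move=> Fp; case: i => n.
  by rewrite (_ : Posz n + 1 = Posz n.+1) //; lia.
case: n => [|n]; first by rewrite (_ : Negz 0 + 1 = Posz 0) //= backwardK.
rewrite (_ : Negz n.+1 + 1 = Negz n); last by lia.
by rewrite [dart_at p (Negz n.+1)]/= backwardK // -/(dart_at p (Negz n)) ; apply: (dart_F (Negz n)).
Qed.

Lemma line_ex a b : F a b -> exists2 x, line x & x 0 = a /\ x 1 = b.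
Proof.
move=> ab; have H i : F (dart_at (a, b) i).1 (dart_at (a, b) i).2 by apply: dart_F.
have S i : (dart_at (a, b) (i + 1)).1 = (dart_at (a, b) i).2 by rewrite dart_succ.
exists (fun i => (dart_at (a, b) i).1) => // i; rewrite S; split=> //.
have -> : i + 2 = i + 1 + 1 by lia.
rewrite S dart_succ // eq_sym; by have [] := onwardP (H i).
Qed.

Lemma line_shift x k : line x -> line (fun i => x (i + k)).
Proof.
move=> lx i; have [H1 H2] := lx (i + k).
by rewrite !(addrAC i _ k).
Qed.

Lemma line_rev x k : line x -> line (fun i => x (k - i)).
Proof.
move=> lx i; have [H1 _] := lx (k - (i + 1)); have [_ H2] := lx (k - (i + 2)).
have E1 : k - (i + 1) + 1 = k - i by lia.
have E2 : k - (i + 2) + 2 = k - i by lia.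
by rewrite E1 F_sym in H1; rewrite E2 eq_sym in H2; split.
Qed.

Lemma line_aut s x : s \in graph_aut e -> line x -> line (fun i => s (x i)).
Proof.
move=> sA lx i; have [/andP[H1 H2] H3] := lx i.
by rewrite /off autE // (mate_aut M _ sA) !(inj_eq perm_inj) H1 H2.
Qed.

Lemma lineF x i : line x -> F (x i) (x (i + 1)). Proof. by case/(_ i). Qed.
Lemma lineFV x i : line x -> F (x i) (x (i - 1)).
Proof. by case/(_ (i - 1)); rewrite subrK F_sym. Qed.
Lemma line_back x i : line x -> x (i + 1) != x (i - 1).
Proof. by case/(_ (i - 1)) => _; rewrite eq_sym (_ : i - 1 + 2 = i + 1) //; lia. Qed.

Lemma F_split v a b c : F v a -> F v b -> a != b -> F v c -> c = a \/ c = b.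
Proof.
case/andP=> va aM /andP[vb bM] ab /andP[vc cM].
have [_ _ _ /(_ _ vc)] := thirdP va vb ab; case=> [|->|]; [by left|by right|].
rewrite (third_eq va vb (mate_adj M v)) //.
by move/eqP; rewrite (negPf cM).
Qed.

Lemma line_nbr x i u : line x -> F (x i) u -> u = x (i + 1) \/ u = x (i - 1).
Proof. by move=> lx; apply: F_split; rewrite ?line_back //; [apply: lineF|apply: lineFV]. Qed.

Lemma line_eq x y i j : line x -> line y -> x i = y j -> x (i + 1) = y (j + 1) ->
  forall k, x (i + k) = y (j + k).
Proof.
move=> lx ly E0 E1 k; suff [] : x (i + k) = y (j + k) /\ x (i + k + 1) = y (j + k + 1) by [].
elim/int_shift_ind: k => [|k [IH1 IH2]|k [IH1 IH2]].
- by rewrite !addr0.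
- rewrite !addrA; split=> //.
  have := lineF (i + k + 1) lx; rewrite IH2 => /(line_nbr ly); rewrite addrK => -[] // E.
  by have := line_back (i + k + 1) lx; rewrite addrK E IH1 eqxx.
- rewrite !addrA !subrK; split=> //.
  have := lineFV (i + k) lx; rewrite IH1 => /(line_nbr ly) [] // E.
  by have := line_back (i + k) lx; rewrite E IH2 eqxx.
Qed.

(** The 2-factor has one continuation in each direction. *)
Lemma line_meet x y i j : line x -> line y -> x i = y j ->
  (forall k, x (i + k) = y (j + k)) \/ (forall k, x (i + k) = y (j - k)).
Proof.
move=> lx ly E; have := lineF i lx; rewrite E => /(line_nbr ly) [] E1; first by left; apply: line_eq.
right=> k; have lz := line_rev 0 ly.
have := @line_eq x _ i (- j) lx lz; rewrite /= !sub0r !opprK => /(_ E).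
rewrite (_ : - (- j + 1) = j - 1) => [/(_ E1 k) ->|]; last by lia.
by congr y; lia.
Qed.

(** A line cannot return to a vertex in the opposite direction: folding it
    would identify two of its vertices at distance one or two. *)
Lemma line_self x i j : line x -> x i = x j -> forall k, x (i + k) = x (j + k).
Proof.
move=> lx E; case: (line_meet lx lx E) => // R; exfalso.
have [[h hE]|[h hE]] : (exists h, j - i = 2 * h) \/ (exists h, j - i = 2 * h + 1).
  by case: (boolP (2 %| j - i)%Z) => H; [left; exists ((j - i) %/ 2)%Z|right; exists ((j - i) %/ 2)%Z]; lia.
  have := line_back (i + h) lx; rewrite -addrA (R (h + 1)) (_ : j - (h + 1) = i + h - 1) ?eqxx //; lia.
have := adj_neq (F_adj (lineF (i + h) lx)); rewrite -addrA (R (h + 1)) (_ : j - (h + 1) = i + h) ?eqxx //; lia.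
Qed.

Definition period x k := forall i, x (i + k) = x i.

Lemma period_eq x i k : line x -> x (i + k) = x i -> period x k.
Proof.
move=> lx E j; have := line_self lx E (j - i).
have E1 : i + k + (j - i) = j + k by lia.
have E2 : i + (j - i) = j by lia.
by rewrite E1 E2.
Qed.

Lemma line_walk x i n : line x -> (0 < n <= 6)%N -> x i != x (i + n%:Z).
Proof.
move=> lx n6; have := @nbw_fun G (fun t => x (i + t%:Z)) n n6; rewrite addr0; apply.
  by move=> t _; have -> : i + t.+1%:Z = i + t%:Z + 1 by [lia]; apply: F_adj (lineF _ lx).
move=> t _; have [_] := lx (i + t%:Z).
by rewrite (_ : i + t%:Z + 2 = i + t.+2%:Z) //; lia.
Qed.

(** The walk from M (x i) through x i to x (i + n) has length at most six. *)
Lemma line_mate x i n : line x -> (0 < n <= 5)%N -> M (x i) != x (i + n%:Z).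
Proof.
move=> lx n5; apply/eqP => E.
have [k [kE k1]] : exists k : nat, n = k.+1 /\ (k < 5)%N by exists n.-1; lia.
have := @nbw_fun G (fun t => if t is t'.+1 then x (i + t'%:Z) else M (x i)) k.+2.
rewrite /= -kE -E eqxx => W; suff: ~~ true by []; apply: W; first by lia.
  move=> [_|t _]; first by rewrite addr0 adj_sym mate_adj.
  by have -> : i + t.+1%:Z = i + t%:Z + 1 by [lia]; apply: F_adj (lineF _ lx).
move=> [_|t _]; first by rewrite eq_sym; exact: F_mate (lineF i lx).
have [_] := lx (i + t%:Z).
by rewrite (_ : i + t%:Z + 2 = i + t.+2%:Z) //; lia.
Qed.

Lemma line_period x : line x ->
  exists2 l : nat, (7 <= l)%N & forall i j, (x i = x j) <-> (l%:Z %| i - j)%Z.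
Proof.
move=> lx.
have [n n0 pn] : exists2 n : nat, (0 < n)%N & period x n%:Z.
  have : ~~ injectiveb (fun t : 'I_#|G|.+1 => x (t%:Z)).
    apply/negP => /injectiveP inj.
    by have := leq_card _ inj; rewrite card_ord ltnn.
  case/injectivePn=> t [t' ne E]; wlog lt : t t' ne E / (t < t')%N.
    move=> W; case: (ltngtP t t') => H; [exact: W H| |by move: ne; rewrite (val_inj H) eqxx].
    by apply: (W t' t) => //; rewrite eq_sym.
  exists (t' - t)%N; first by rewrite subn_gt0.
  by apply: (@period_eq x t%:Z) => //; rewrite E; congr x; lia.
have ex : exists n, (0 < n)%N && [forall v, (x 0 == v) ==> (x n%:Z == v)].
  by exists n; rewrite n0; apply/forallP => v; have := pn 0; rewrite add0r => ->; apply/implyP.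
case: (ex_minnP ex) => l /andP[l0 /forallP/(_ (x 0)) /[!eqxx] /eqP xl] lmin.
have pl : period x l%:Z by apply: (@period_eq x 0) => //; rewrite add0r.
have plm k : period x (k * l%:Z).
  elim/int_shift_ind: k => [|k IH|k IH] i; first by rewrite mul0r addr0.
    by rewrite mulrDl mul1r addrA pl.
  by rewrite -(pl (i + _)) mulrBl mul1r addrA subrK.
exists l.
  rewrite ltnNge; apply/negP => l6; have := line_walk 0 lx (n := l).
  by rewrite l0 l6 add0r xl eqxx => /(_ isT).
move=> i j; split=> [E|/dvdzP[k kE]]; last first.
  by rewrite -(plm k j) -kE; congr x; lia.
have pij : period x (i - j) by apply: (@period_eq x j) => //; rewrite addrC subrK.
have := divz_eq (i - j) l%:Z; set q := ((i - j) %/ l%:Z)%Z; set r := ((i - j) %% l%:Z)%Z => rE.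
have [r0 rl] : 0 <= r /\ r < l%:Z by rewrite /r; split; lia.
have pr : period x r.
  by move=> k; rewrite -(plm q) -addrA [r + _]addrC -rE.
have [r00|rn0] := eqVneq r 0; first by apply/dvdzP; exists q; rewrite rE r00 addr0.
exfalso; have := lmin `|r|%N.
have -> : (0 < `|r|)%N by lia.
have -> : Posz `|r|%N = r by lia.
have -> : [forall v, (x 0 == v) ==> (x r == v)].
  by apply/forallP => v; have := pr 0; rewrite add0r => ->; apply/implyP.
by move=> /(_ isT); lia.
Qed.
End Lines.

(** * Coverings and stretches of lines *)

(** The image of g is closed under adjacency, hence everything. This
    reduces an isomorphism with a concrete cubic graph to injectivity and a
    check of neighbours. *)
Lemma iso_of_covering (G : vtGraph7) (U : Type) (e' : rel U) (g : U -> G) (u0 : U) :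
  injective g -> (forall u u', e' u u' -> adj (g u) (g u')) ->
  (forall u y, adj (g u) y -> exists2 u', g u' = y & e' u u') ->
  graph_iso (@adj G) e'.
Proof.
move=> gi ge lift.
have onto y : exists u, g u = y.
  have /connectP[p] := adj_conn (g u0) y; elim: p (u0) => [|z p IH] u /=.
    by move=> _ ->; exists u.
  by case/andP=> /lift[u' <- _]; apply: IH.
have [f fK] := fin_all_exists onto.
have gK : cancel g f by move=> u; apply: gi; rewrite fK.
exists f; first by exists g.
move=> x y; apply/idP/idP => [/ge|xy]; first by rewrite !fK.
have [|u' uE eu] := lift (f x) y; first by rewrite fK.
by rewrite -uE gK.
Qed.

Lemma adj_cases (G : vtGraph7) (v a b c y : G) : adj v a -> adj v b -> adj v c ->
  a != b -> a != c -> b != c -> adj v y -> [\/ y = a, y = b | y = c].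
Proof.
move=> va vb vc ab ac bc vy; have [_ _ _ /(_ _ vy)] := thirdP va vb ab.
by rewrite (third_eq va vb vc).
Qed.

Lemma Zp_int_val (n : nat) (k : int) : (1 < n)%N -> (n%:Z %| (nat_of_ord (k%:~R : 'Z_n))%:Z - k)%Z.
Proof.
move=> n1; have n0 : n%:Z != 0 by lia.
have [m mE] : exists m : nat, (k %% n%:Z)%Z = m%:Z by exists `|(k %% n%:Z)%Z|%N; lia.
have kE := divz_eq k n%:Z; rewrite mE in kE.
have -> : k%:~R = m%:R :> 'Z_n.
  by rewrite kE intrD intrM -[n%:Z%:~R]/(n%:R) pchar_Zp // mulr0 add0r.
rewrite val_Zp_nat // -modz_nat kE; have := divz_eq m%:Z n%:Z.
move: (_ %/ _)%Z (m%:Z %/ _)%Z => q q' E.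
apply/dvdzP; exists (- q' - q); move: E; lia.
Qed.

Section Pet.
Variable G : vtGraph7.
Variable M : matching G.
Local Notation e := (@adj G).
Local Notation F := (off M).
Local Notation line := (line M).
Implicit Types (a b c d u v w : G) (s : {perm G}) (i j k : int) (x y : int -> G).

Lemma mate_square a b : F a b -> F (M a) (M b) -> False.
Proof.
case/andP=> ab bM /andP[ab' _]; have aM : a != M b by rewrite mate_sym.
have ? := mate_adj M a; have ? := mate_adj M b.
by short a [:: b; M b; M a; a].
Qed.

Lemma line_next x i a b c : line x -> x i = a -> x (i + 1) = b -> F b c -> a != c -> c = x (i + 2).
Proof.
move=> lx <- <- Fc ne; have := Fc => /(line_nbr lx) [->|E].
  by congr x; lia.
by rewrite E addrK eqxx in ne.
Qed.

Lemma line_next3 x i a b c d : line x -> x i = a -> x (i + 1) = b -> F b c -> F c d ->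
  a != c -> b != d -> d = x (i + 3).
Proof.
move=> lx xa xb Fc Fd ac bd; have cE := line_next lx xa xb Fc ac.
rewrite (_ : i + 3 = i + 1 + 2); last by lia.
apply: line_next xb _ Fd bd => //; rewrite cE; congr x; lia.
Qed.

(** A path off the matching is a stretch of the line through its first
    vertex, in one of the two directions. *)
Lemma path3_line x i b c d : line x -> F (x i) b -> F b c -> F c d ->
  x i != c -> b != d -> (b = x (i + 1) /\ d = x (i + 3)) \/ (b = x (i - 1) /\ d = x (i - 3)).
Proof.
move=> lx Fb Fc Fd nc nd; case: (line_nbr lx Fb) => E; [left|right]; split=> //.
  exact: line_next3 (esym E) Fc Fd nc nd.
have -> : x (i - 3) = x (0 - (- i + 3)) by congr x; lia.
apply: (@line_next3 (fun t => x (0 - t)) (- i) (x i) b c d (line_rev 0 lx)) => //; rewrite ?E; congr x; lia.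
Qed.

Lemma path4_line x i b c d f : line x -> F (x i) b -> F b c -> F c d -> F d f ->
  x i != c -> b != d -> c != f -> f = x (i + 4) \/ f = x (i - 4).
Proof.
move=> lx Fb Fc Fd Ff nc nd nf; case: (line_nbr lx Fb) => bE; [left|right].
  have cE := line_next lx erefl (esym bE) Fc nc.
  have -> : x (i + 4) = x (i + 1 + 3) by congr x; lia.
  apply: (@line_next3 x (i + 1) b c d f lx) => //; rewrite cE; congr x; lia.
have lr := line_rev 0 lx.
have cE : c = x (0 - (- i + 2)).
  by apply: (@line_next _ (- i) (x i) b c lr) => //; rewrite ?bE; congr x; lia.
have -> : x (i - 4) = x (0 - (- i + 1 + 3)) by congr x; lia.
apply: (@line_next3 _ (- i + 1) b c d f lr) => //; rewrite ?bE ?cE; congr x; lia.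
Qed.

(** Vertex-transitivity carries a property of one line to all lines, if it
    is insensitive to the parametrisation. *)
Lemma all_lines (P : (int -> G) -> Prop) x0 : line x0 ->
  (forall s x, s \in graph_aut e -> P x -> P (fun i => s (x i))) ->
  (forall x y, (forall k, y k = x k) -> P x -> P y) ->
  (forall x k, P x -> P (fun i => x (i + k))) -> (forall x, P x -> P (fun i => x (0 - i))) ->
  P x0 -> forall x, line x -> P x.
Proof.
move=> l0 Ps Pe Psh Pr P0 x lx; have [s sA sx] := aut_to (x0 0) (x 0).
have ls := line_aut sA l0.
have := @line_meet G M x (fun i => s (x0 i)) 0 0 lx ls; rewrite sx => /(_ erefl).
case=> H; first by apply: Pe (Psh _ 0 (Ps _ _ sA P0)) => k; rewrite -[k in LHS]add0r H addrC.
by apply: Pe (Pr _ (Ps _ _ sA P0)) => k; rewrite -[k in LHS]add0r H.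
Qed.

(** A heptagon without matching edges is a line that closes after seven
    steps. *)
Lemma pat0_line v x : (0 < cnt M v pat0)%N -> line x -> period x 7.
Proof.
move=> c0 lx; rewrite (cnt_any M v (x 0)) in c0.
have [b [c [d [x' [y [z [H]]]]]]] := cnt_ex c0.
move: H; rewrite heptE => /and5P[ab bc cd dx /and5P[xy yz za ac /and5P[bd cx dy xz /andP[ya zb]]]].
case=> lab lbc lcd ldx lxy lyz lza.
have FI p q : e p q -> letterM M p q q q = false -> F p q by rewrite /off /letterM => -> ->.
suff W (w : int -> G) : line w -> w 0 = x 0 -> w 1 = b -> w 7 = w 0.
  case: (line_nbr lx (FI _ _ ab lab)) => E.
    by apply: (@period_eq G M x 0) => //; rewrite add0r W // -E.
  have := W _ (line_rev 0 lx); rewrite !sub0r oppr0 => /(_ erefl) H.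
  rewrite add0r in E; have {}H := H (esym E).
  have P' : period x (-7) by apply: (@period_eq G M x 0) => //; rewrite add0r.
  by move=> i; rewrite -[LHS]P' addrK.
move=> lw w0 w1.
have w2 : c = w 2 by apply: (@line_next w 0 (x 0) b) => //; apply: FI bc lbc.
have w3 : d = w 3 by apply: (@line_next w 1 b c) => //; apply: FI cd lcd.
have w4 : x' = w 4 by apply: (@line_next w 2 c d) => //; apply: FI dx ldx.
have w5 : y = w 5 by apply: (@line_next w 3 d x') => //; apply: FI xy lxy.
have w6 : z = w 6 by apply: (@line_next w 4 x' y) => //; apply: FI yz lyz.
by rewrite w0; apply/esym/(@line_next w 5 y z) => //; apply: FI za lza.
Qed.

Lemma F_line v : exists2 x, line x & x 0 = v.
Proof.
have [b [c [nb nc bc N]]] := nbr_split (mate_adj M v).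
have Fb : F v b by rewrite /off N eqxx orbT eq_sym nb.
by have [x lx [x0 _]] := line_ex Fb; exists x.
Qed.

(** Read from its middle, a heptagon with one matching edge shows that M
    exchanges x (i + 3) and x (i - 3). Then M maps the edge x 6, x 7 to the
    edge x 0, x 1, which closes a 4-cycle. *)
Lemma no_pat1 v : cnt M v pat1 = 0.
Proof.
apply/eqP; rewrite -leqn0 leqNgt; apply/negP => c1.
have [x lx x0] := F_line v.
have S i : M (x (i + 3)) = x (i - 3).
  have c1' : (0 < cnt M (x i) pat1)%N by rewrite -(cnt_any M v).
  have [b [c [d [x' [y [z [H]]]]]]] := cnt_ex c1'.
  move: H; rewrite heptE => /and5P[ab bc cd dx /and5P[xy yz za ac /and5P[bd cx dy xz /andP[ya zb]]]].
  case=> lab lbc lcd ldx lxy lyz lza.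
  have FI p q : e p q -> letterM M p q q q = false -> F p q by rewrite /off /letterM => -> ->.
  have Fz : F (x i) z by rewrite F_sym; apply: FI.
  have Fy : F z y by rewrite F_sym; apply: FI.
  have Fx : F y x' by rewrite F_sym; apply: FI.
  have xM : x' = M d by apply/eqP.
  have xiy : x i != y by rewrite eq_sym.
  have zx : z != x' by rewrite eq_sym.
  case: (path3_line lx (FI _ _ ab lab) (FI _ _ bc lbc) (FI _ _ cd lcd) ac bd)
    (path3_line lx Fz Fy Fx xiy zx) => -[bE dE] [] [zE xE].
  - by rewrite bE zE eqxx in zb.
  - by rewrite -dE -xM.
  - by rewrite -xE xM mateK.
  - by rewrite bE zE eqxx in zb.
have E6 : M (x 6) = x 0 by have := S 3.
have E6' : M (x 0) = x (-6) by have := S (-3).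
have E7 : M (x 7) = x 1 by have := S 4.
apply: (@mate_square (x 6) (x 7)); first exact: (lineF 6 lx).
by rewrite E6 E7; apply: (lineF 0 lx).
Qed.

End Pet.

(** * The graph Pet(13, 5) *)

Lemma Zp_int_eq (n : nat) (k l : int) : (1 < n)%N -> (n%:Z %| k - l)%Z ->
  k%:~R = l%:~R :> 'Z_n.
Proof.
move=> n1 /dvdzP[q qE]; apply/eqP; rewrite -subr_eq0 -intrB qE intrM.
by rewrite -[n%:Z%:~R]/(n%:R) pchar_Zp // mulr0.
Qed.

Section Petersen.
Variable G : vtGraph7.
Variable M : matching G.
Local Notation e := (@adj G).
Local Notation F := (off M).
Local Notation line := (line M).
Implicit Types (a b c d u v w : G) (s : {perm G}) (i j k : int) (x y : int -> G).

(** The rim of Pet(n, k) is the line x and its inner vertices are the mates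
    of the rim. *)
Lemma pet_iso (n k : nat) x : (1 < n)%N -> line x ->
  (forall i j, (x i = x j) <-> (n%:Z %| i - j)%Z) ->
  (forall i, F (M (x i)) (M (x (i + k%:Z)))) -> ~~ (n%:Z %| 2 * k%:Z)%Z ->
  (forall i j, M (x i) != x j) -> graph_iso e (Pet n k).
Proof.
move=> n1 lx xP Fk nk dis.
pose X (i : 'Z_n) := x (nat_of_ord i)%:Z.
have XE (i : int) : X i%:~R = x i by apply/xP/Zp_int_val.
have reprZ (i : 'Z_n) : exists j : int, i = j%:~R.
  by exists (nat_of_ord i)%:Z; apply/esym/natr_Zp.
have natZ (i : 'Z_n) : ((nat_of_ord i)%:Z)%:~R = i by exact: natr_Zp.
have Xinj : injective X by move=> i j /xP /(Zp_int_eq n1); rewrite !natZ.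
pose g (u : PetVertex n) := match u return vert G with Pu i => X i | Pv i => M (X i) end.
have X1 (i : 'Z_n) : X (i + 1) = x (nat_of_ord i + 1)%N%:Z.
  by have [i' iE] := reprZ i; rewrite -XE PoszD intrD natZ.
have Xk (i : 'Z_n) : X (i + k%:R) = x ((nat_of_ord i)%:Z + k%:Z).
  by rewrite -XE intrD natZ.
have ge (u u' : PetVertex n) : PetArc k u u' -> e (g u) (g u').
  case: u u' => i [] j //= /eqP ->.
  - by rewrite X1 PoszD; apply: F_adj (lineF _ lx).
  - exact: mate_adj.
  - by rewrite Xk; apply: F_adj (Fk _).
have dis' (i j : 'Z_n) : X i != M (X j) by rewrite eq_sym; apply: dis.
apply: (@iso_of_covering G _ _ g (Pu 0)).
- move=> [i|i] [j|j] /= E; try by have := dis (nat_of_ord i) (nat_of_ord j); have := dis (nat_of_ord j) (nat_of_ord i); rewrite -/(X i) -/(X j) E eqxx.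
    by rewrite (Xinj _ _ E).
  by rewrite (Xinj _ _ (mate_inj E)).
- by move=> u u' /orP[/ge //|/ge]; rewrite adj_sym.
have Xm1 (i : 'Z_n) : X i = x ((nat_of_ord (i - 1))%:Z + 1) by rewrite -[in LHS](subrK 1 i) X1 PoszD.
have XmK (i : 'Z_n) : X i = x ((nat_of_ord (i - k%:R))%:Z + k%:Z) by rewrite -[in LHS](subrK k%:R i) Xk.
move=> [i|i] y /= ey.
- have a1 : e (X i) (X (i + 1)) by rewrite X1 PoszD; apply: F_adj (lineF _ lx).
  have a2 : e (X i) (X (i - 1)) by rewrite adj_sym [X i]Xm1; apply: F_adj (lineF _ lx).
  have [] := adj_cases a1 a2 (mate_adj M (X i)) _ _ _ ey.
  + have := line_back (nat_of_ord i)%:Z lx; rewrite X1 PoszD; apply: contraNneq => ->.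
    apply/eqP; rewrite /X; apply/xP; have [i' iE] := reprZ i; have D1 := Zp_int_val (i' - 1) n1; have D2 := Zp_int_val i' n1.
    rewrite intrB -iE mulr1z in D1; rewrite -iE in D2.
    case/dvdzP: D1 => q1 E1; case/dvdzP: D2 => q2 E2; apply/dvdzP.
    move: (nat_of_ord (i - 1)) (nat_of_ord i) E1 E2 => p1 p2 E1 E2; exists (q1 - q2); rewrite mulrBl.
    move: (q1 * _) (q2 * _) E1 E2 => r1 r2. lia.
  + exact: dis'.
  + exact: dis'.
  + by move=> ->; exists (Pu (i + 1)) => //; rewrite /Pet /= eqxx.
  + by move=> ->; exists (Pu (i - 1)) => //; rewrite /Pet /= subrK eqxx orbT.
  + by move=> ->; exists (Pv i) => //; rewrite /Pet /= eqxx.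
have a1 : e (M (X i)) (M (X (i + k%:R))) by rewrite Xk; apply: F_adj (Fk _).
have a2 : e (M (X i)) (M (X (i - k%:R))) by rewrite adj_sym [X i]XmK; apply: F_adj (Fk _).
have a3 : e (M (X i)) (X i) by rewrite adj_sym mate_adj.
have [] := adj_cases a1 a2 a3 _ _ _ ey.
+ apply/eqP => /mate_inj /Xinj E.
  have {E} : (i + k%:R) - (i - k%:R) = 0 by rewrite E subrr.
  rewrite opprD opprK addrACA subrr add0r => E.
  have := Zp_int_val (2 * k%:Z) n1; rewrite intrM.
  rewrite -[k%:~R]/(k%:R) -[2%:~R]/(1 + 1) mulrDl mul1r E sub0r rpredN; exact/negP.
+ exact: dis.
+ exact: dis.
+ by move=> ->; exists (Pv (i + k%:R)) => //; rewrite /Pet /= eqxx.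
+ by move=> ->; exists (Pv (i - k%:R)) => //; rewrite /Pet /= subrK eqxx orbT.
+ by move=> ->; exists (Pu i) => //; rewrite /Pet /= eqxx.
Qed.

(** In the heptagon around x i with this pattern, the mates of x (i - 1)
    and x (i + 1) are joined by three edges off M. *)
Lemma step23 v x y i j : (0 < cnt M v pat23)%N -> line x -> line y ->
  y j = M (x (i - 1)) -> M (x (i + 1)) = y (j + 3) \/ M (x (i + 1)) = y (j - 3).
Proof.
move=> c0 lx ly yj; rewrite (cnt_any M v (x i)) in c0.
have [b [c [d [x' [y' [z [H]]]]]]] := cnt_ex c0.
move: H; rewrite heptE => /and5P[ab bc cd dx /and5P[xy yz za ac /and5P[bd cx dy xz /andP[ya zb]]]].
case=> lab /eqP lbc lcd ldx lxy /eqP lyz lza.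
have FI p q : e p q -> letterM M p q q q = false -> F p q by rewrite /off /letterM => -> ->.
have Fz : F (x i) z by rewrite F_sym; apply: FI.
have Fcd := FI _ _ cd lcd; have Fdx := FI _ _ dx ldx; have Fxy := FI _ _ xy lxy.
have y'E : y' = M z by rewrite lyz mateK.
have xd : x' != d by rewrite eq_sym adj_neq.
have S p1 p2 q r : y j = p1 -> F p1 q -> F q r -> F r p2 -> p1 != r -> q != p2 ->
    p2 = y (j + 3) \/ p2 = y (j - 3).
  move=> <- Fq Fr Fp n1 n2.
  by case: (path3_line ly Fq Fr Fp n1 n2) => -[_ ->]; [left|right].
case: (line_nbr lx (FI _ _ ab lab)) (line_nbr lx Fz) => bE [] zE; try by rewrite bE zE eqxx in zb.
  rewrite -bE -lbc; apply: (S y' c x' d); rewrite 1?[off M _ _]F_sym // 1?eq_sym //.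
  by rewrite y'E zE.
by rewrite -zE -y'E; apply: (S c y' d x') => //; rewrite lbc bE.
Qed.

(** The stretches of length three of the previous lemma fit together:
    turning back would identify mates of vertices at distance four. *)
Lemma line23 v x : (0 < cnt M v pat23)%N -> line x ->
  exists2 y, line y & forall k, M (x (2 * k)) = y (3 * k).
Proof.
move=> c0 lx.
have [y ly [y0 y3]] : exists2 y, line y & M (x 0) = y 0 /\ M (x 2) = y 3.
  have [y ly y0] := F_line M (M (x 0)).
  have [H|H] := step23 (i := 1) (j := 0) c0 lx ly y0; rewrite add0r in H.
    by exists y.
  by exists (fun t => y (0 - t)); [apply: line_rev | split; rewrite // sub0r oppr0].
exists y => // k.
suff [] : M (x (2 * k)) = y (3 * k) /\ M (x (2 * k + 2)) = y (3 * k + 3) by [].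
elim/int_shift_ind: k => [|k [IH1 IH2]|k [IH1 IH2]].
- by rewrite !mulr0 !add0r.
- have E1 : x (2 * (k + 1)) = x (2 * k + 2) by congr x; lia.
  have E2 : y (3 * (k + 1)) = y (3 * k + 3) by congr y; lia.
  rewrite E1 E2; split=> //.
  have := @step23 v x y (2 * k + 3) (3 * k + 3) c0 lx ly.
  have -> : x (2 * k + 3 - 1) = x (2 * k + 2) by congr x; lia.
  have -> : x (2 * k + 3 + 1) = x (2 * (k + 1) + 2) by congr x; lia.
  have -> : y (3 * k + 3 + 3) = y (3 * (k + 1) + 3) by congr y; lia.
  rewrite addrK -IH1 -IH2 => /(_ erefl) [] // /mate_inj E.
  have := line_walk (2 * k) lx (n := 4); rewrite -E => /(_ isT)/eqP[]; congr x; lia.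
- have E1 : x (2 * (k - 1) + 2) = x (2 * k) by congr x; lia.
  have E2 : y (3 * (k - 1) + 3) = y (3 * k) by congr y; lia.
  rewrite E1 E2; split=> //.
  have := @step23 v (fun t => x (0 - t)) y (1 - 2 * k) (3 * k) c0 (line_rev 0 lx) ly.
  have -> : x (0 - (1 - 2 * k - 1)) = x (2 * k) by congr x; lia.
  have -> : x (0 - (1 - 2 * k + 1)) = x (2 * (k - 1)) by congr x; lia.
  have -> : y (3 * k - 3) = y (3 * (k - 1)) by congr y; lia.
  rewrite -IH1 -IH2 => /(_ erefl) [] // /mate_inj E.
  have := line_walk (2 * (k - 1)) lx (n := 4); rewrite E => /(_ isT)/eqP[]; congr x; lia.
Qed.

Lemma period_dvd x (n : nat) : line x -> period x n%:Z ->
  (forall l : nat, (7 <= l)%N -> (l %| n)%N -> l = n) ->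
  forall i j, (x i = x j) <-> (n%:Z %| i - j)%Z.
Proof.
move=> lx pn Hn; have [l l7 lP] := line_period lx.
suff <- : l = n by [].
apply: Hn => //; have := pn 0; rewrite add0r => /lP; rewrite subr0.
by rewrite dvdzE.
Qed.

(** The construction of y from x, applied twice, leads back to the line x:
    the line z that it gives satisfies z 0 = x 0 and z 9 = x 4. As x 4 is
    not x 9, z runs against x and x 4 = x (-9). *)
Lemma line23_period v x : (0 < cnt M v pat23)%N -> line x -> period x 13.
Proof.
move=> c0 lx; have [y ly My] := line23 c0 lx; have [z lz Mz] := line23 c0 ly.
have z0 : x 0 = z 0 by have := Mz 0; rewrite !mulr0 -(My 0) mulr0 mateK.
have y6 : y (2 * 3) = M (x 4) by exact: esym (My 2).
have z9 : x 4 = z 9 by have := Mz 3; rewrite y6 mateK.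
case: (line_meet lx lz z0) => H.
  have N : x 4 != x 9 by exact: (line_walk 4 lx (n := 5) isT).
  by have := H 9; rewrite !add0r -z9 => E; rewrite E eqxx in N.
have E : x 4 = x (-9) by rewrite z9; have := H (-9); rewrite !add0r opprK.
by move=> i; have := line_self lx E (i + 9); have -> : x (4 + (i + 9)) = x (i + 13) by [congr x; lia]; move=> ->; congr x; lia.
Qed.

(** All lines have period exactly 13, where M (x i) = y (8 i) because 8 is
    3 / 2 modulo 13, and 5 is the inverse of 8. If y were the line x, the
    mate would act on indices as multiplication by 8 or -8 and a
    translation, which is not an involution modulo 13. *)
Lemma pet13 v : (0 < cnt M v pat23)%N -> graph_iso e (Pet 13 5) /\ cnt M v pat0 = 0.
Proof.
move=> c0; have [x lx _] := F_line M v.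
have P13 y : line y -> forall i j, (y i = y j) <-> (13 %| i - j)%Z.
  move=> ly; apply: (@period_dvd y 13 ly); first exact: line23_period c0 ly.
  by move=> l l7 /dvdnP[q qE]; have : (q <= 1)%N by [nia]; case: q qE => [|[|]] //; lia.
split; last first.
  apply/eqP; rewrite -leqn0 leqNgt; apply/negP => /pat0_line/(_ lx)/(_ 0)/(P13 _ lx).
  by [].
have [y ly My] := line23 c0 lx.
have MxE i : M (x i) = y (8 * i).
  have /(P13 _ lx) -> : (13 %| i - 2 * (7 * i))%Z by apply/dvdzP; exists (- i); lia.
  by rewrite My; apply/(P13 _ ly)/dvdzP; exists i; lia.
apply: (@pet_iso 13 5 x) => //.
- exact: P13.
- move=> i; rewrite !MxE; have -> : y (8 * (i + 5)) = y (8 * i + 1); last exact: lineF.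
  by apply/(P13 _ ly)/dvdzP; exists 3; lia.
move=> i j; apply/eqP => E; rewrite MxE in E.
have [H|H] := line_meet ly lx E.
  have Mi k : x k = x (8 * (8 * k - 8 * i + j) - 8 * i + j).
    have Mk t : M (x t) = x (8 * t - 8 * i + j).
      by rewrite MxE; have := H (8 * t - 8 * i); rewrite addrC subrK addrC.
    by rewrite -Mk -Mk mateK.
  have /(P13 _ lx)/dvdzP[q0 Q0] := Mi 0; have /(P13 _ lx)/dvdzP[q1 Q1] := Mi 1; lia.
have Mi k : x k = x (j - (8 * (j - (8 * k - 8 * i)) - 8 * i)).
  have Mk t : M (x t) = x (j - (8 * t - 8 * i)).
    by rewrite MxE; have := H (8 * t - 8 * i); rewrite addrC subrK.
  by rewrite -Mk -Mk mateK.
have /(P13 _ lx)/dvdzP[q0 Q0] := Mi 0; have /(P13 _ lx)/dvdzP[q1 Q1] := Mi 1; lia.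
Qed.
End Petersen.

(** * The graphs Pet(15, 4) and Pet(17, 4) *)

Section Pattern14.
Variable G : vtGraph7.
Variable M : matching G.
Local Notation e := (@adj G).
Local Notation F := (off M).
Local Notation line := (line M).
Implicit Types (a b c d u v w : G) (s : {perm G}) (i j k : int) (x y : int -> G).
Hypothesis Feq : forall v p q, F v p -> F v q -> thru [:: v; p] = thru [:: v; q].
Variable v0 : G.
Hypothesis c14 : (0 < cnt M v0 pat14)%N.

(** The heptagon around x (i + 2) with this pattern runs over x i, ..., x
    (i + 4) and closes through the mates of x i and x (i + 4). *)
Lemma step14 x i : line x -> F (M (x i)) (M (x (i + 4))).
Proof.
move=> lx; have c0 := c14; rewrite (cnt_any M v0 (x (i + 2))) in c0.
have [b [c [d [x' [y' [z [H]]]]]]] := cnt_ex c0.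
move: H; rewrite heptE => /and5P[ab bc cd dx /and5P[xy yz za ac /and5P[bd cx dy xz /andP[ya zb]]]].
case=> lab lbc /eqP lcd ldx /eqP lxy lyz lza.
have FI p q : e p q -> letterM M p q q q = false -> F p q by rewrite /off /letterM => -> ->.
have Fb := FI _ _ ab lab; have Fc := FI _ _ bc lbc.
have Fz : F (x (i + 2)) z by rewrite F_sym; apply: FI.
have Fy : F z y' by rewrite F_sym; apply: FI.
have Fx := FI _ _ dx ldx.
have x'E : x' = M y' by rewrite lxy mateK.
have ay : x (i + 2) != y' by rewrite eq_sym.
have two p q : F (x (i + 2)) p -> F p q -> x (i + 2) != q ->
  (p = x (i + 3) /\ q = x (i + 4)) \/ (p = x (i + 1) /\ q = x i).
  move=> Fp Fq nq; case: (line_nbr lx Fp) => pE; [left|right].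
    have qE := line_next lx erefl (esym pE) Fq nq.
    by split; [rewrite pE|rewrite qE]; congr x; clear; lia.
  have := @line_next G M (fun t => x (0 - t)) (- (i + 2)) (x (i + 2)) p q (line_rev 0 lx).
  have -> : x (0 - - (i + 2)) = x (i + 2) by congr x; clear; lia.
  have -> : x (0 - (- (i + 2) + 1)) = p by rewrite pE; congr x; clear; lia.
  move=> /(_ erefl erefl Fq nq) ->; rewrite pE; split; congr x; clear; lia.
move: Fx; rewrite lcd x'E.
case: (two _ _ Fb Fc ac) (two _ _ Fz Fy ay) => -[bE cE] [] [zE yE]; try by rewrite bE zE eqxx in zb.
  by rewrite cE yE F_sym.
by rewrite cE yE.
Qed.

(** Here y would turn back only if x 0 = x 8. *)
Lemma line14 x : line x -> ~ period x 8 -> exists2 y, line y & forall k, M (x (4 * k)) = y k.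
Proof.
move=> lx n8; have [y ly [y0 y1]] := line_ex (step14 0 lx).
exists y => // k; suff [] : M (x (4 * k)) = y k /\ M (x (4 * k + 4)) = y (k + 1) by [].
elim/int_shift_ind: k => [|k [IH1 IH2]|k [IH1 IH2]].
- by rewrite mulr0 !add0r y0 y1 add0r.
- have E1 : x (4 * (k + 1)) = x (4 * k + 4) by congr x; clear; lia.
  rewrite E1; split=> //; have := step14 (4 * k + 4) lx; rewrite IH2.
  have -> : x (4 * (k + 1) + 4) = x (4 * k + 4 + 4) by congr x; clear; lia.
  case/(line_nbr ly) => //; rewrite addrK -IH1 => /mate_inj E.
  case: n8; apply: (@period_eq G M x (4 * k)) => //; rewrite -E; congr x; clear; lia.
- have E1 : x (4 * (k - 1) + 4) = x (4 * k) by congr x; clear; lia.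
  rewrite E1 subrK; split=> //; have := step14 (4 * (k - 1)) lx; rewrite E1 IH1 F_sym.
  case/(line_nbr ly) => //; rewrite -IH2 => /mate_inj E.
  case: n8; apply: (@period_eq G M x (4 * (k - 1))) => //; rewrite E; congr x; clear; lia.
Qed.

(** If lines had period 8, the edges off M whose mates are opposite on
    their line would form a second invariant matching M'. Every heptagon at
    v0 with the given pattern turns out to have three edges of M', so six
    heptagons contain each edge of M'; as all edges off M are alike, this
    makes 4 + 6 + 6 heptagons at a vertex instead of 14. *)
Lemma no_period8 x0 : line x0 -> ~ period x0 8.
Proof.
move=> l0 p0.
have p8 x : line x -> period x 8.
  apply: (all_lines (P := fun x => period x 8) l0) => //.
  - by move=> s x' sA H i; rewrite H.
  - by move=> x' y E H i; rewrite !E.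
  - by move=> x' k H i; rewrite addrAC H.
  - move=> x' H i; rewrite -(H (0 - (i + 8))); congr x'; clear; lia.
pose P v u := F v u /\ exists z, [/\ line z, z 0 = M v & z 4 = M u].
have Puniq v u u' : P v u -> P v u' -> u = u'.
  case=> _ [z [lz z0 z4]] [_ [z' [lz' z0' z4']]]; apply: (@mate_inj G M); rewrite -z4 -z4'.
  have zz : z 0 = z' 0 by rewrite z0.
  case: (line_meet lz lz' zz) => /(_ 4); rewrite !add0r // => ->.
  by rewrite -(p8 _ lz' (-4)).
have Psym v u : P v u -> P u v.
  case=> Fu [z [lz z0 z4]]; split; first by rewrite F_sym.
  exists (fun t => z (t + 4)); split; first exact: line_shift.
    by rewrite add0r.
  by rewrite -z0 -(p8 _ lz 0).
have Paut s v u : s \in graph_aut e -> P v u -> P (s v) (s u).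
  move=> sA [/andP[vu uM] [z [lz z0 z4]]]; split.
    by rewrite /off autE // vu (mate_aut M _ sA) (inj_eq perm_inj).
  by exists (fun t => s (z t)); split; [apply: line_aut | rewrite z0 (mate_aut M _ sA) | rewrite z4 (mate_aut M _ sA)].
have c3 : (0 < cnt M v0 (seq.rot 3 pat14))%N by rewrite (cnt_rot M v0 v0).
have [b [c [d [x' [y' [z [H]]]]]]] := cnt_ex c3.
have Hh := H; move: H; rewrite heptE => /and5P[ab bc cd dx /and5P[xy yz za ac /and5P[bd cx dy xz /andP[ya zb]]]].
case=> lab /eqP lbc lcd ldx lxy lyz /eqP lza.
have FI p q : e p q -> letterM M p q q q = false -> F p q by rewrite /off /letterM => -> ->.
have Fb := FI _ _ ab lab; have Fcd := FI _ _ cd lcd; have Fdx := FI _ _ dx ldx.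
have Fxy := FI _ _ xy lxy; have Fyz := FI _ _ yz lyz.
have zE : z = M v0 by rewrite lza mateK.
have Pb : P v0 b.
  split=> //; have [w lw w0] := F_line M (M v0).
  exists w; split=> //; rewrite -lbc.
  have [F1 F2 F3 F4] : [/\ F (w 0) y', F y' x', F x' d & F d c].
    by rewrite w0 -zE; split; rewrite F_sym.
  have [||| ->|->] := path4_line lw F1 F2 F3 F4; rewrite ?w0 -?zE 1?eq_sym //.
  by rewrite -(p8 _ lw (0 - 4)).
have [m m0 mE] : exists2 m : G -> G, m v0 = b & equivariant m.
  apply: equivariant_of_fixed => s sA s0; apply: (Puniq v0) => //.
  by rewrite -{1}s0; apply: Paut.
have Pm w : P w (m w).
  by have [s sA <-] := aut_to v0 w; rewrite mE // m0; apply: Paut.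
have ma : e v0 (m v0) by rewrite m0.
have mm : m (m v0) = v0 by apply: (Puniq (m v0)) => //; apply: Psym.
have [M' _ M'E] := matching_of_equivariant mE ma mm.
have FM' w : F w (M' w) by rewrite M'E; case: (Pm w).
(* The edges off M are alternately in M' and not in M'. *)
have alt p q r : F p q -> F q r -> p != r -> (r == M' q) = ~~ (q == M' p).
  move=> Fp Fq pr; have := FM' q; rewrite -[q == M' p](mate_sym M').
  rewrite F_sym in Fp; case/(F_split Fp Fq pr) => ->; first by rewrite eqxx eq_sym (negPf pr).
  by rewrite eqxx (negPf pr).
have w112 : (0 < cnt M' v0 pat112)%N.
  have M'v : b = M' v0 by rewrite M'E m0.
  have := cnt_gt0 M' Hh; rewrite /= /letterM -M'v eqxx.
  have -> : (c == M' b) = false.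
    by rewrite M'v mateK eq_sym; apply/negbTE.
  have -> : (v0 == M' z) = false.
    by apply/negbTE; have /andP[_] := FM' z; rewrite -lza eq_sym.
  rewrite (alt _ _ _ Fxy Fyz xz) (alt _ _ _ Fdx Fxy dy) (alt _ _ _ Fcd Fdx cx) !negbK.
  case: (d == M' c).
    by rewrite -[in X in X -> _](cnt_rot M' v0 v0 6).
  by rewrite -[in X in X -> _](cnt_rot M' v0 v0 2).
have [c0 t1 tM all] := pattern_counts M v0; have [c0' t1' tM' all'] := pattern_counts M' v0.
have c00 : cnt M v0 pat0 = 0%N.
  apply/eqP; rewrite -leqn0 leqNgt; apply/negP => /pat0_line/(_ l0)/(_ 0) E.
  have := adj_neq (F_adj (lineF 7 l0)); rewrite add0r in E.
  by have := p0 0; rewrite E add0r => ->; rewrite eqxx.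
have [u [u' [Mu Mu' uu' N]]] := nbr_split (mate_adj M v0).
have [Fu Fu'] : F v0 u /\ F v0 u' by rewrite /off !N !eqxx !orbT /= ![_ == M v0]eq_sym Mu Mu'.
have T := thru1 Mu Mu' uu' N; rewrite (Feq Fu (FM' v0)) (Feq Fu' (FM' v0)) in T.
rewrite t1 tM tM' c00 in T; clear -c14 w112 all all' T.
move: c14 w112 all all' T; rewrite !inE.
move: (cnt M v0 pat1) (cnt M v0 pat23) (cnt M v0 pat14) (cnt M v0 pat112).
move: (cnt M' v0 pat1) (cnt M' v0 pat23) (cnt M' v0 pat14) (cnt M' v0 pat112).
move=> n1 n2 n3 n4 n5 n6 n7 n8 H7 H4.
by case/or4P=> [|||/orP[]] /eqP[E5 E6 E7 E8]; subst; rewrite // => /or4P[|||/orP[]] /eqP[E1 E2 E3 E4]; subst.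
Qed.

(** As y k = M (x (4 k)) is a line and step14 applies to it, x 0 and x 16
    are adjacent on x. *)
Lemma line14_period x : line x -> period x 15 \/ period x 17.
Proof.
move=> lx; have [y ly My] := line14 lx (no_period8 lx).
have := step14 0 ly; rewrite add0r.
have -> : M (y 0) = x 0 by rewrite -(My 0) mulr0 mateK.
have -> : M (y 4) = x 16 by rewrite -(My 4) mateK.
case/(line_nbr lx); rewrite add0r => E; [left|right] => i.
  have := line_self lx E (i - 1); have -> : x (16 + (i - 1)) = x (i + 15) by congr x; clear; lia.
  by move=> ->; congr x; clear; lia.
have := line_self lx E (i + 1); have -> : x (16 + (i + 1)) = x (i + 17) by congr x; clear; lia.
by move=> ->; congr x; clear; lia.
Qed.

(** The period of the lines is 15 or 17, and M (x i) = y (4 i) or y (- 4 i)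
    respectively since 4 * 4 is 1 modulo 15 and -1 modulo 17. If y were the
    line x, the mate would be an affine map of the indices; modulo 15 it
    would fix an index, and modulo 17 it would not be an involution. *)
Lemma pet15_17 : (graph_iso e (Pet 15 4) \/ graph_iso e (Pet 17 4)) /\ cnt M v0 pat0 = 0%N.
Proof.
have [x lx _] := F_line M v0.
have [y ly My] := line14 lx (no_period8 lx).
have [xP15|xP17] : (forall i j, (x i = x j) <-> (15 %| i - j)%Z) \/ (forall i j, (x i = x j) <-> (17 %| i - j)%Z).
- case: (line14_period lx) => pn; [left|right].
    apply: (@period_dvd G M x 15) => // l l7 /dvdnP[q qE]; have : (q <= 2)%N by [nia].
    by case: q qE => [|[|[|]]] //; lia.
  apply: (@period_dvd G M x 17) => // l l7 /dvdnP[q qE]; have : (q <= 2)%N by [nia].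
  by case: q qE => [|[|[|]]] //; lia.
- split; last first.
    by apply/eqP; rewrite -leqn0 leqNgt; apply/negP => /pat0_line/(_ lx)/(_ 0)/xP15.
  left; apply: (@pet_iso G M 15 4 x) => //; first by move=> i; apply: step14.
  have MxE i : M (x i) = y (4 * i).
    by rewrite -My; congr (M _); apply/xP15/dvdzP; exists (- i); lia.
  move=> i j; apply/eqP => E; rewrite MxE in E.
  have [H|H] := line_meet ly lx E.
    have Mk t : M (x t) = x (4 * t + (j - 4 * i)).
      by rewrite MxE; have := H (4 * t - 4 * i); rewrite addrC subrK => ->; congr x; clear; lia.
    have := Mk (4 * 0 + (j - 4 * i)); rewrite -(Mk 0) mateK => /xP15/dvdzP[q qE].
    have := adj_neq (mate_adj M (x q)); rewrite Mk => /eqP[]; apply/xP15/dvdzP; exists 0; lia.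
  have Mk t : M (x t) = x (j + 4 * i - 4 * t).
    by rewrite MxE; have := H (4 * t - 4 * i); rewrite addrC subrK => ->; congr x; clear; lia.
  have := Mk (j + 4 * i - 4 * 0); rewrite -(Mk 0) mateK => /xP15/dvdzP[q qE].
  have := adj_neq (mate_adj M (x q)); rewrite Mk => /eqP[]; apply/xP15/dvdzP; exists 0; lia.
split; last first.
  by apply/eqP; rewrite -leqn0 leqNgt; apply/negP => /pat0_line/(_ lx)/(_ 0)/xP17.
right; apply: (@pet_iso G M 17 4 x) => //; first by move=> i; apply: step14.
have MxE i : M (x i) = y (- 4 * i).
  by rewrite -My; congr (M _); apply/xP17/dvdzP; exists i; lia.
move=> i j; apply/eqP => E; rewrite MxE in E.
have [H|H] := line_meet ly lx E.
  have Mk t : M (x t) = x (- 4 * t + (j + 4 * i)).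
    by rewrite MxE; have := H (- 4 * t + 4 * i); have -> : y (-4 * i + (- 4 * t + 4 * i)) = y (-4 * t) by [congr y; clear; lia]; move=> ->; congr x; clear; lia.
  have := Mk (- 4 * 0 + (j + 4 * i)); rewrite -(Mk 0) mateK => /xP17/dvdzP[q qE].
  have := Mk (- 4 * 1 + (j + 4 * i)); rewrite -(Mk 1) mateK => /xP17/dvdzP[q' qE']; lia.
have Mk t : M (x t) = x (j - 4 * i + 4 * t).
  by rewrite MxE; have := H (- 4 * t + 4 * i); have -> : y (-4 * i + (- 4 * t + 4 * i)) = y (-4 * t) by [congr y; clear; lia]; move=> ->; congr x; clear; lia.
have := Mk (j - 4 * i + 4 * 0); rewrite -(Mk 0) mateK => /xP17/dvdzP[q qE].
have := Mk (j - 4 * i + 4 * 1); rewrite -(Mk 1) mateK => /xP17/dvdzP[q' qE']; lia.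
Qed.
End Pattern14.

(** * Heptagons with three matching edges *)

Section Pattern112.
Variable G : vtGraph7.
Variable M : matching G.
Local Notation e := (@adj G).
Local Notation F := (off M).
Local Notation line := (line M).
Implicit Types (b c d u v w : G) (s : {perm G}) (i j k : int) (x y a : int -> G).
(** The cycle through the two mates and the stretch of x between them would
    have length at most six. *)
Lemma mates_far x i (n : nat) : line x -> (0 < n <= 3)%N -> ~~ F (M (x i)) (M (x (i + n%:Z))).
Proof.
move=> lx n3; apply/negP => Fm.
pose p (t : nat) := if t is t'.+1 then (if (t' <= n)%N then x (i + t'%:Z) else
  if t' == n.+1 then M (x (i + n%:Z)) else M (x i)) else M (x i).
have := @nbw_fun G p n.+3; rewrite /p; have -> : (n.+2 <= n)%N = false by lia.
have -> : (n.+2 == n.+1) = false by lia.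
rewrite eqxx => W; suff: ~~ true by []; apply: W; first by lia.
  move=> [_|t tn]; first by rewrite /= addr0 adj_sym mate_adj.
  rewrite /=; case: (ltngtP t n) => tn'.
  - rewrite ?(ltnW tn') ?tn'; have -> : i + t.+1%:Z = i + t%:Z + 1 by clear; lia.
    exact: F_adj (lineF _ lx).
  - have -> : t = n.+1 by lia.
    rewrite eqxx; have -> : (n.+2 == n.+1) = false by lia.
    by rewrite adj_sym; apply: F_adj Fm.
  - by rewrite tn' eqxx; apply: mate_adj.
have n0 : (0 < n)%N by case/andP: n3.
move=> [_|t tn]; first by rewrite /= n0 eq_sym; apply: F_mate; apply: (lineF i lx).
rewrite /=; case: (ltngtP t.+1 n) => tn'.
- have -> : (t <= n)%N by rewrite ltnW // ltnW.
  by have [_] := lx (i + t%:Z); have -> : i + t%:Z + 2 = i + t.+2%:Z by clear; lia.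
- have -> : t = n by apply/eqP; rewrite eqn_leq; apply/andP; split; [exact: tn | exact: tn'].
  rewrite leqnn; have -> : (n.+2 == n.+1) = false by clear; lia.
  by rewrite eq_sym; apply: line_mate => //; rewrite n0; case/andP: n3 => _ H; apply: leq_trans H _.
- rewrite -tn' leqnSn eqxx; have := F_mate (lineF (i + t%:Z) lx).
  have -> : i + t%:Z + 1 = i + t.+1%:Z by clear; lia.
  by rewrite -(inj_eq (@mate_inj _ M)) mateK eq_sym.
Qed.

Hypothesis Feq : forall v p q, F v p -> F v q -> thru [:: v; p] = thru [:: v; q].
Variable v0 : G.
Hypothesis c112 : (0 < cnt M v0 pat112)%N.

Lemma F_aut s u v : s \in graph_aut e -> F (s u) (s v) = F u v.
Proof. by move=> sA; rewrite /off autE // (mate_aut M _ sA) (inj_eq perm_inj). Qed.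

Lemma F_two v : exists p q, [/\ F v p, F v q & p != q].
Proof.
have [b [c [nb nc bc N]]] := nbr_split (mate_adj M v); exists b, c.
by rewrite /off !N !eqxx !orbT /= ![_ == M v]eq_sym nb nc.
Qed.

Lemma F_other v p : F v p -> exists2 q, F v q & q != p.
Proof.
move=> Fp; have [q [r [Fq Fr qr]]] := F_two v.
by case: (eqVneq q p) => [qp|]; [exists r; rewrite // -qp eq_sym | exists q].
Qed.

(** The heptagon centred at v with this pattern is v, p, M p, t, M t, M q,
    q. *)
Lemma step112 v p q : F v p -> F v q -> p != q ->
  exists2 t, F (M p) t & F (M q) (M t).
Proof.
move=> Fp Fq pq; have c0 := c112; rewrite (cnt_any M v0 v) in c0.
have [b [c [d [x' [y' [z [H]]]]]]] := cnt_ex c0.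
move: H; rewrite heptE => /and5P[ab bc cd dx /and5P[xy yz za ac /and5P[bd cx dy xz /andP[ya zb]]]].
case=> lab /eqP lbc lcd /eqP ldx lxy /eqP lyz lza.
have FI r t : e r t -> letterM M r t t t = false -> F r t by rewrite /off /letterM => -> ->.
have Fb := FI _ _ ab lab; have Fcd := FI _ _ cd lcd; have Fxy := FI _ _ xy lxy.
have Fz : F v z by rewrite F_sym; apply: FI.
have yE : y' = M z by rewrite lyz mateK.
rewrite lbc in Fcd; rewrite yE ldx F_sym in Fxy.
case: (F_split Fp Fq pq Fb) (F_split Fp Fq pq Fz) => bE [] zE; try by rewrite bE zE eqxx in zb.
  by exists d; rewrite -?bE // -zE.
by exists (M d); rewrite -?zE // mateK -bE.
Qed.

(** The edge from M p to t is the one that the heptagon centred at v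
    follows after v, p and M p. *)
Definition bridge v p t := [&& F v p, F (M p) t & [exists q, [&& F v q, q != p & F (M q) (M t)]]].

Lemma bridge_ex v p : F v p -> exists t, bridge v p t.
Proof.
move=> Fp; have [q Fq qp] := F_other Fp; have [|t Ft Ft'] := step112 Fp Fq; first by rewrite eq_sym.
by exists t; rewrite /bridge Fp Ft; apply/existsP; exists q; rewrite Fq qp.
Qed.

(** Two choices of t would close a 5-cycle with M p and M q. *)
Lemma bridge_uniq v p t t' : bridge v p t -> bridge v p t' -> t = t'.
Proof.
case/and3P=> Fp Ft /existsP[q /and3P[Fq qp Fqt]] /and3P[_ Ft' /existsP[q' /and3P[Fq' q'p Fqt']]].
have qq' : q' = q by case: (F_split Fp Fq _ Fq'); rewrite ?(eq_sym p) // => E; rewrite E eqxx in q'p.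
rewrite {}qq' in Fqt' {Fq' q'p}; apply/eqP/negPn/negP => tt'.
have N1 : t != p by have := F_mate Ft; rewrite mateK.
have N1' : t' != p by have := F_mate Ft'; rewrite mateK.
have N2 : M t != q by have := F_mate Fqt; rewrite mateK.
have N2' : M t' != q by have := F_mate Fqt'; rewrite mateK.
have A1 := F_adj Ft; have A2 := F_adj Ft'; have A3 := F_adj Fqt; have A4 := F_adj Fqt'.
have A5 := mate_adj M t; have A6 := mate_adj M t'.
have K1 : M p != M t' by rewrite (inj_eq (@mate_inj _ M)) eq_sym.
have K2 : M t' != M t by rewrite (inj_eq (@mate_inj _ M)) eq_sym.
have K3 : M q != t by rewrite eq_sym -(inj_eq (@mate_inj _ M)) mateK.
have K4 : M t != M p by rewrite (inj_eq (@mate_inj _ M)).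
have K5 : t' != M q by rewrite -(inj_eq (@mate_inj _ M)) mateK.
by short t [:: M p; t'; M t'; M q; M t; t].
Qed.

Lemma bridge_aut s v p t : s \in graph_aut e -> bridge v p t -> bridge (s v) (s p) (s t).
Proof.
move=> sA /and3P[Fp Ft /existsP[q /and3P[Fq qp Fqt]]].
rewrite /bridge F_aut // Fp !(mate_aut M _ sA) F_aut // Ft; apply/existsP; exists (s q).
by rewrite (mate_aut M _ sA) !F_aut // Fq Fqt (inj_eq perm_inj) qp.
Qed.

Lemma bridge_flip v p q t : F v p -> F v q -> p != q -> bridge v p t -> bridge v q (M t).
Proof.
move=> Fp Fq pq /and3P[_ Ft /existsP[r /and3P[Fr rp Frt]]].
have rq : r = q by case: (F_split Fp Fq pq Fr) => // E; rewrite E eqxx in rp.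
rewrite rq in Frt; rewrite /bridge Fq Frt; apply/existsP; exists p.
by rewrite Fp pq mateK.
Qed.

(** The heptagons centred at the two neighbours v and v' of p both pass
    through M p, and leave it along different edges. Otherwise, by vertex-
    transitivity, an edge off M from each vertex w to some f w would be
    singled out invariantly. If f is an involution, it is a matching with
    three edges in a heptagon, and as the edges off M are alike there are
    18 heptagons at a vertex, which is too many. If not, f is a permutation
    and the heptagons give f M f f = M f M; so f is of order four and its
    orbits are 4-cycles. *)
Lemma bridge_neq v v' p t t' : v != v' -> bridge v p t -> bridge v' p t' -> t != t'.
Proof.
move=> vv' Tv Tv'; apply/eqP => tt'; rewrite -{t'}tt' in Tv'.
pose R w u := F w u /\ forall r, F (M w) r -> bridge r (M w) u.
have Fpv : F p v by case/and3P: Tv; rewrite F_sym.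
have Fpv' : F p v' by case/and3P: Tv'; rewrite F_sym.
have R0 : R (M p) t.
  split; first by case/and3P: Tv.
  by rewrite mateK => r /(F_split Fpv Fpv' vv')[] ->.
have Runiq w u u' : R w u -> R w u' -> u = u'.
  move=> [_ H] [_ H']; have [r [_ [Fr _ _]]] := F_two (M w).
  by apply: bridge_uniq (H _ Fr) (H' _ Fr).
have Raut s w u : s \in graph_aut e -> R w u -> R (s w) (s u).
  move=> sA [Fu H]; split; first by rewrite F_aut.
  move=> r; rewrite (mate_aut M _ sA) -[r](permKV s) F_aut // => Fr.
  by apply: bridge_aut => //; apply: H.
have [f f0 fE] : exists2 f : G -> G, f (M p) = t & equivariant f.
  apply: equivariant_of_fixed => s sA sp; apply/esym/(Runiq _ _ _ R0).
  by rewrite -{1}sp; apply: Raut.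
have Rf w : R w (f w).
  by have [s sA <-] := aut_to (M p) w; rewrite fE // f0; apply: Raut.
have Ff w : F w (f w) by case: (Rf w).
have Tf r q : F r q -> bridge r q (f (M q)).
  by move=> Fq; have [_] := Rf (M q); rewrite mateK; apply; rewrite F_sym.
have [ff|ff] := eqVneq (f (f v0)) v0.
  have [M' _ M'E] := matching_of_equivariant fE (F_adj (Ff v0)) ff.
  have M'K w : f (f w) = w by rewrite -!M'E mateK.
  have c0 := c112.
  have [b [c [d [x' [y' [z [H]]]]]]] := cnt_ex c0; have Hh := H.
  move: H; rewrite heptE => /and5P[ab bc cd dx /and5P[xy yz za ac /and5P[bd cx dy xz /andP[ya zb]]]].
  case=> lab /eqP lbc lcd /eqP ldx lxy /eqP lyz lza.
  have FI r q : e r q -> letterM M r q q q = false -> F r q by rewrite /off /letterM => -> ->.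
  have Fb := FI _ _ ab lab; have Fcd := FI _ _ cd lcd; have Fxy := FI _ _ xy lxy.
  have Fz : F v0 z by rewrite F_sym; apply: FI.
  have bz : b != z by rewrite eq_sym.
  have Td : bridge v0 b d.
    rewrite /bridge Fb -lbc Fcd; apply/existsP; exists z; rewrite Fz zb -ldx F_sym.
    by rewrite lyz mateK.
  have dE : d = M' c by rewrite M'E lbc; apply: bridge_uniq Td (Tf _ _ Fb).
  have x'E : x' = M' y'.
    rewrite M'E; apply: (bridge_uniq (v := v0) (p := z)).
      by rewrite ldx; apply: bridge_flip Td.
    by rewrite (_ : y' = M z); [apply: Tf | rewrite lyz mateK].
  have nMM' w : M w != M' w by rewrite M'E eq_sym; apply: F_mate.
  have w112 : (0 < cnt M' v0 pat112)%N.
    have := cnt_gt0 M' Hh; rewrite /= /letterM dE x'E !mateK !eqxx.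
    have -> : (c == M' b) = false by rewrite lbc; apply/negbTE.
    have -> : (M' y' == c) = false by rewrite -x'E; apply/negbTE; rewrite eq_sym.
    have -> : (z == M' y') = false by rewrite lyz; apply/negbTE.
    have -> : (v0 == M' z) = ~~ (b == M' v0).
      rewrite [v0 == M' z](mate_sym M').
      case: (F_split Fb Fz bz (_ : F v0 (M' v0))); first by rewrite M'E.
        by move=> ->; rewrite eqxx (negPf zb).
      by move=> ->; rewrite eqxx (negPf bz).
    case: (b == M' v0).
      by rewrite -[in X in X -> _](cnt_rot M' v0 v0 6).
    by rewrite -[in X in X -> _](cnt_rot M' v0 v0 1).
  have [k0 t1 tM all] := pattern_counts M v0; have [k0' t1' tM' all'] := pattern_counts M' v0.
  have [u [u' [Mu Mu' uu' N]]] := nbr_split (mate_adj M v0).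
  have [Fu Fu'] : F v0 u /\ F v0 u' by rewrite /off !N !eqxx !orbT /= ![_ == M v0]eq_sym Mu Mu'.
  have FM' : F v0 (M' v0) by rewrite M'E.
  have TT := thru1 Mu Mu' uu' N; rewrite (Feq Fu FM') (Feq Fu' FM') in TT.
  rewrite t1 tM tM' in TT.
  move: c112 w112 k0 k0' all all' TT; rewrite !inE; clear.
  move: (cnt M v0 pat0) (cnt M v0 pat1) (cnt M v0 pat23) (cnt M v0 pat14) (cnt M v0 pat112).
  move: (cnt M' v0 pat0) (cnt M' v0 pat1) (cnt M' v0 pat23) (cnt M' v0 pat14) (cnt M' v0 pat112).
  move=> n0 n1 n2 n3 n4 n0' n5 n6 n7 n8 H8 H4 /orP[]/eqP-> _.
    by case/or4P=> [|||/orP[]] /eqP[E5 E6 E7 E8]; subst; rewrite // => /or4P[|||/orP[]] /eqP[E1 E2 E3 E4]; subst.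
  by case/or4P=> [|||/orP[]] /eqP[E5 E6 E7 E8]; subst; rewrite // => /or4P[|||/orP[]] /eqP[E1 E2 E3 E4]; subst.
have ffn w : f (f w) != w.
  by have [s sA <-] := aut_to v0 w; rewrite !fE // (inj_eq perm_inj).
(* Compare the heptagon centred at f w, read in both directions. *)
have rel w : f (M (f (f w))) = M (f (M w)).
  have F1 : F (f w) w by rewrite F_sym.
  have F2 := Ff (f w).
  apply: (bridge_uniq (Tf _ _ F2)); apply: bridge_flip (Tf _ _ F1) => //.
  by rewrite eq_sym.
have f4 w : f (f (f (f w))) = w.
  apply: (@mate_inj _ M); apply: (equivariant_inj fE).
  by rewrite rel rel mateK.
have A w := F_adj (Ff w).
have A1 := A v0; have A2 := A (f v0); have A3 := A (f (f v0)); have A4 := A (f (f (f v0))).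
rewrite f4 in A4; have N1 := ffn v0; have N2 := ffn (f v0); have N3 := ffn (f (f v0)).
by short v0 [:: f v0; f (f v0); f (f (f v0)); v0].
Qed.

End Pattern112.

(** * The ladder along a line *)

Section Ladder.
Variable G : vtGraph7.
Variable M : matching G.
Local Notation e := (@adj G).
Local Notation F := (off M).
Local Notation line := (line M).
Implicit Types (b c d u v w : G) (s : {perm G}) (i j k : int) (x y a : int -> G).
Hypothesis Feq : forall v p q, F v p -> F v q -> thru [:: v; p] = thru [:: v; q].
Variable v0 : G.
Hypothesis c112 : (0 < cnt M v0 pat112)%N.

(** Around the line of the vertices x_i of A(m), the values M (x i), a i
    and M (a i) stand for y_i, a_i and b_i. *)
Definition ladder x a := [/\ line x, forall i, F (M (x i)) (a i),
  forall i, F (M (x (i + 2))) (M (a i)) & forall i, a i != M (a (i - 2))].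

(** Take for a i the vertex that follows x i and M (x i) on the heptagon
    centred at x (i + 1); bridge_neq says that a i and b_(i-2) are the two
    neighbours of y_i. *)
Lemma ladder_ex x : line x -> exists a, ladder x a.
Proof.
move=> lx; pose a i := odflt v0 [pick t | bridge M (x (i + 1)) (x i) t].
have E i k l : k = l -> x (i + k) = x (i + l) by move=> ->.
have Ta i : bridge M (x (i + 1)) (x i) (a i).
  rewrite /a; case: pickP => //= no; have := lineFV (i + 1) lx; rewrite addrK => F1.
  by have [t Tt] := bridge_ex c112 F1; rewrite no in Tt.
have Tb i : bridge M (x (i + 1)) (x (i + 2)) (M (a i)).
  apply: bridge_flip (Ta i); first by rewrite F_sym; apply: lineF.
    by have := lineF (i + 1) lx; rewrite -addrA.
  by case: (lx i).
exists a; split=> // i; first by case/and3P: (Ta i).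
  by case/and3P: (Tb i).
have := Tb (i - 2); rewrite subrK => Tb'.
apply: (bridge_neq Feq c112 _ (Ta i) Tb').
have := line_back i lx; have -> // : x (i - 1) = x (i - 2 + 1) by congr x; clear; lia.
Qed.

Section Local.
Variables x a : int -> G.
Hypothesis lad : ladder x a.

Let lx : line x. Proof. by case: lad. Qed.
Let Fa i : F (M (x i)) (a i). Proof. by case: lad. Qed.
Let Fb i : F (M (x (i + 2))) (M (a i)). Proof. by case: lad. Qed.
Let ab i : a i != M (a (i - 2)). Proof. by case: lad. Qed.

Let far i (n : nat) : (0 < n <= 3)%N -> F (M (x i)) (M (x (i + n%:Z))) -> False.
Proof. by move=> n3 Fm; have := mates_far i lx n3; rewrite Fm. Qed.

Let farV i (n : nat) : (0 < n <= 3)%N -> F (M (x (i + n%:Z))) (M (x i)) -> False.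
Proof. by rewrite F_sym; apply: far. Qed.

Let Fb' i : F (M (x i)) (M (a (i - 2))).
Proof. by have := Fb (i - 2); rewrite subrK. Qed.

Let split_y i u : F (M (x i)) u -> u = a i \/ u = M (a (i - 2)).
Proof. exact: F_split (Fa i) (Fb' i) (ab i). Qed.

(** The heptagon centred at a_i passes through y_i, x_i and one of the
    neighbours x_(i+1) and x_(i-1). *)
Let dich i c : F (a i) c -> c != M (x i) -> c = M (a (i + 1)) \/ c = a (i - 3).
Proof.
move=> Fc nc; have Fy : F (a i) (M (x i)) by rewrite F_sym.
have yc : M (x i) != c by rewrite eq_sym.
have nx j : a j != x j by have := F_mate (Fa j); rewrite mateK.
have FE j : F (M (x j)) (a j) by [].
have ey j := F_adj (Fa j).
have my j := mate_adj M (x j).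
have xx j := F_adj (lineF j lx).
have [t Ft Ft'] := step112 c112 Fy Fc yc; rewrite mateK in Ft.
case: (line_nbr lx Ft) => tE; rewrite {}tE F_sym in Ft' *.
  case: (split_y Ft') => /(canRL (@mateK _ M)) E; first by left.
  exfalso; rewrite mateK in E.
  have {}E : c = a (i - 1) by rewrite E; congr a; clear; lia.
  rewrite E in Fc; have F1 := F_adj Fc; have A1 := ey i; have A2 := ey (i - 1).
  have A3 := my i; have A4 := my (i - 1); have A5 := xx (i - 1); rewrite subrK in A5.
  have N1 : M (x (i - 1)) != a i.
    apply/eqP => H; have := Fa i; rewrite -H; have -> : x i = x (i - 1 + 1%N%:Z) by congr x; clear; lia.
    exact: farV.
  have N2 : a (i - 1) != M (x i).
    apply/eqP => H; have := Fa (i - 1); rewrite H; have -> : x i = x (i - 1 + 1%N%:Z) by congr x; clear; lia.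
    exact: far.
  have N3 := nx i; have N4 := nx (i - 1).
  have N5 : M (x i) != x (i - 1) by rewrite eq_sym; apply: F_mate; apply: lineFV.
  have N6 : x i != M (x (i - 1)) by apply: F_mate; have := lineF (i - 1) lx; rewrite subrK.
  have N7 : x (i - 1) != a (i - 1) by rewrite eq_sym.
  by short (M (x (i - 1))) [:: a (i - 1); a i; M (x i); x i; x (i - 1); M (x (i - 1))].
case: (split_y Ft') => /(canRL (@mateK _ M)) E.
  exfalso; rewrite E in Fc.
  have F1 := F_adj Fc; have A1 := ey i; have A2 := F_adj (Fb (i - 1)).
  have E2 : x (i - 1 + 2) = x (i + 1) by congr x; clear; lia.
  rewrite E2 in A2.
  have A3 := my i; have A4 := my (i + 1); have A5 := xx i.
  have N1 : M (x i) != M (a (i - 1)).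
    apply/eqP => H; have := Fb (i - 1); rewrite E2 -H.
    exact: (@farV i 1%N).
  have N2 : a i != M (x (i + 1)).
    apply/eqP => H; have := Fa i; rewrite H; exact: (@far i 1%N).
  have N3 : M (a (i - 1)) != x (i + 1).
    by have := F_mate (Fb (i - 1)); rewrite mateK E2.
  have N4 : M (x (i + 1)) != x i by rewrite eq_sym; apply: F_mate; have := lineFV (i + 1) lx; rewrite addrK.
  have N5 : x (i + 1) != M (x i) by apply: F_mate; apply: lineF.
  have N6 := nx i; have N7 : x i != a i by rewrite eq_sym.
  by short (M (x i)) [:: a i; M (a (i - 1)); M (x (i + 1)); x (i + 1); x i; M (x i)].
by right; rewrite E mateK; congr a; clear; lia.
Qed.

(** This is the last edge a_i b_(i+1) of A(m). The heptagon centred at a_i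
    leaves two candidates for the second neighbour of a_i off M, namely
    b_(i+1) and a_(i-3). In the latter case a_(i-3) also has a_i as second
    neighbour, so the same alternative makes a_i equal to a_(i-6), which
    has too many neighbours. *)
Lemma ladder_step i : F (a i) (M (a (i + 1))).
Proof.
have Fy j : F (a j) (M (x j)) by rewrite F_sym.
have [c Fc nc] := F_other (Fy i).
case: (dich Fc nc) => cE; first by rewrite -cE.
exfalso; rewrite cE in Fc nc.
have E3 : x i = x (i - 3 + 3%N%:Z) by congr x; clear; lia.
have E6 : x i = x (i - 6 + 6%N%:Z) by congr x; clear; lia.
have E36 : x (i - 3) = x (i - 6 + 3%N%:Z) by congr x; clear; lia.
have n3 : a i != M (x (i - 3)).
  by apply/eqP => H; have := Fa i; rewrite H E3; apply: farV.
have F3 : F (a (i - 3)) (a i) by rewrite F_sym.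
case: (dich F3 n3) => E.
  by have := ab i; rewrite {1}E => /eqP[]; congr (M (a _)); clear; lia.
have E' : a i = a (i - 6) by rewrite E; congr a; clear; lia.
have F6 : F (a i) (M (x (i - 6))) by rewrite E'.
have yc : M (x i) != a (i - 3) by rewrite eq_sym.
case: (F_split (Fy i) Fc yc F6) => [/mate_inj|] H.
  have := line_walk (i - 6) lx (n := 6) isT; rewrite -E6 H; exact/negP/negPn.
have := Fa (i - 3); rewrite -H E36; exact: farV.
Qed.
End Local.
End Ladder.

(** * The graphs A(3n) *)

Lemma dvdz_cast (d i j : int) : i = j -> (d %| i)%Z -> (d %| j)%Z.
Proof. by move=> ->. Qed.

Section Global.
Variable G : vtGraph7.
Variable M : matching G.
Local Notation e := (@adj G).
Local Notation F := (off M).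
Local Notation line := (line M).
Implicit Types (b c d u v w : G) (s : {perm G}) (i j k : int) (x y a : int -> G).
Hypothesis Feq : forall v p q, F v p -> F v q -> thru [:: v; p] = thru [:: v; q].
Variable v0 : G.
Hypothesis c112 : (0 < cnt M v0 pat112)%N.

Definition line_of u v i := (dart_at M (u, v) i).1.

Lemma line_ofP u v : F u v -> [/\ line (line_of u v), line_of u v 0 = u & line_of u v 1 = v].
Proof.
move=> uv; have H i : F (dart_at M (u, v) i).1 (dart_at M (u, v) i).2 by apply: dart_F.
have S i : line_of u v (i + 1) = (dart_at M (u, v) i).2 by rewrite /line_of dart_succ.
split=> // i; rewrite S; split; first exact: H.
have -> : i + 2 = i + 1 + 1 by clear; lia.
rewrite S dart_succ // eq_sym; by have [] := onwardP (H i).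
Qed.

(** The line that begins y_r, a_r, b_(r+1), y_(r+3), ...; it meets the
    vertices y_i with i congruent to r modulo 3. *)
Definition rung x a r := line_of (M (x r)) (a r).

Lemma rungP x a r : ladder M x a ->
  [/\ line (rung x a r), rung x a r 0 = M (x r), rung x a r 1 = a r,
      rung x a r 2 = M (a (r + 1)) & forall k, rung x a (r + 3) k = rung x a r (k + 3)].
Proof.
move=> lad; have [lx Fa Fb ab] := lad; have [lr r0 r1] := line_ofP (Fa r).
have [lr' r0' r1'] := line_ofP (Fa (r + 3)).
rewrite -/(rung x a r) in lr r0 r1; rewrite -/(rung x a (r + 3)) in lr' r0' r1'.
have step i := ladder_step c112 lad i.
have Fb2 : F (M (a (r + 1))) (M (x (r + 3))).
  rewrite F_sym; have := Fb (r + 1); have -> // : x (r + 1 + 2) = x (r + 3) by congr x; clear; lia.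
have N1 : M (x r) != M (a (r + 1)).
  rewrite (inj_eq (@mate_inj _ M)); apply/eqP => E.
  have := Fa (r + 1); rewrite -E => /F_adj H1; have H2 := F_adj (lineF r lx).
  have H3 := mate_adj M (x (r + 1)).
  have N := F_mate (lineF r lx); have N' := F_mate (lineFV (r + 1) lx); rewrite addrK in N'.
  have N3 := adj_neq H2; have N4 := adj_neq H3.
  by short (x r) [:: x (r + 1); M (x (r + 1)); x r]; rewrite eq_sym.
have r2 : rung x a r 2 = M (a (r + 1)) by rewrite (line_next (i := 0) lr r0 r1 (step r) N1).
have N2 : a r != M (x (r + 3)).
  by apply/eqP => E; have := mates_far r lx (n := 3) isT; rewrite -E Fa.
have r3 : rung x a r 3 = M (x (r + 3)).
  by rewrite (line_next (i := 1) lr r1 r2 Fb2 N2).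
have N3 : M (a (r + 1)) != a (r + 3).
  have := ab (r + 3); rewrite eq_sym; have -> // : a (r + 3 - 2) = a (r + 1) by congr a; clear; lia.
have r4 : rung x a r 4 = a (r + 3).
  by rewrite (line_next (i := 2) lr r2 r3 (Fa (r + 3)) N3).
split=> // k; have := line_eq (i := 0) (j := 3) lr' lr; rewrite r0' r3 => /(_ erefl).
have -> : rung x a r (3 + 1) = a (r + 3) by exact: r4.
rewrite add0r r1' => /(_ erefl k); rewrite add0r => ->; congr (rung x a r _); clear; lia.
Qed.

Lemma rung_shift x a r t k : ladder M x a -> rung x a (r + 3 * t) k = rung x a r (k + 3 * t).
Proof.
move=> lad; elim/int_shift_ind: t k => [|t IH|t IH] k; first by rewrite mulr0 !addr0.
  have [_ _ _ _ S] := rungP (r + 3 * t) lad.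
  have -> : r + 3 * (t + 1) = r + 3 * t + 3 by clear; lia.
  by rewrite S IH; congr (rung x a r _); clear; lia.
have [_ _ _ _ S] := rungP (r + 3 * (t - 1)) lad.
have E : r + 3 * (t - 1) + 3 = r + 3 * t by clear; lia.
have := S (k - 3); rewrite subrK => <-; rewrite E IH; congr (rung x a r _); clear; lia.
Qed.

Definition own_line v := exists2 x, line x & x 0 = v /\ exists j, x j = M v.

Lemma own_line_aut s v : s \in graph_aut e -> own_line v -> own_line (s v).
Proof.
move=> sA [x lx [x0 [j xj]]]; exists (fun i => s (x i)); first exact: line_aut.
by split; [rewrite x0 | exists j; rewrite xj (mate_aut M _ sA)].
Qed.

Lemma own_line_any v w : own_line v -> own_line w.
Proof. by have [s sA <-] := aut_to v w; apply: own_line_aut. Qed.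

Lemma line_same x y i j k : line x -> line y -> x i = y j -> exists l, y k = x l.
Proof.
move=> lx ly; move/esym/(line_meet ly lx) => [H|H].
  by exists (i + (k - j)); rewrite -H; congr y; clear; lia.
by exists (i - (k - j)); rewrite -H; congr y; clear; lia.
Qed.

Lemma own_line_at x i v : line x -> x i = v -> own_line v -> exists j, x j = M v.
Proof.
move=> lx xi [y ly [y0 [j yj]]]; rewrite -xi in y0.
by have [l E] := line_same j lx ly (esym y0); exists l; rewrite -E.
Qed.

(** If all vertices were on one line x, the rungs would be x itself and
    y_(3t) would be x (c + 3t) or x (c - 3t). The latter is impossible as
    some y_(3t) would be near x (3t). In the former case an automorphism
    that moves x 0 to x 1, or one that moves x 0 to x 2, acts on x as a
    translation by 1 or 2 (or their composite does, if both are
    reflections), and commuting with M it shows that M maps the edge x 0, x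
    1 to an edge, closing a 4-cycle. *)
Lemma not_own_line v : ~ own_line v.
Proof.
move=> O; have own w : own_line w by apply: own_line_any O.
have [x lx _] := F_line M v0; have [a lad] := ladder_ex Feq c112 lx.
have [c xc] : exists c : int, x c = M (x 0) by apply: own_line_at (own (x 0)).
have [lr r0 _ _ _] := rungP 0 lad.
have y3 t : M (x (3 * t)) = rung x a 0 (3 * t).
  have [_ r0' _ _ _] := rungP (0 + 3 * t) lad; rewrite (rung_shift _ _ _ lad) !add0r in r0'.
  by rewrite r0'.
have E : rung x a 0 0 = x c by rewrite r0.
case: (line_meet lr lx E) => H; last first.
  have H' t : M (x (3 * t)) = x (c - 3 * t) by rewrite y3 -[3 * t in LHS]add0r H.
  have [t [n [n6 cE]]] : exists t : int, exists n : nat, (n <= 5)%N /\ c - 3 * t = 3 * t + n%:Z.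
    by exists (c %/ 6)%Z, `|(c %% 6)%Z|%N; split; lia.
  have := H' t; rewrite cE; case: n n6 {cE} => [|n] n6.
    by rewrite addr0 => /eqP; apply/negP; rewrite eq_sym; apply: adj_neq (mate_adj _ _).
  by apply/eqP/line_mate.
have H3 : M (x 3) = x (c + 3) by have := y3 1; rewrite mulr1 => ->; have := H 3; rewrite add0r.
have no_shift1 s : s \in graph_aut e -> (forall k, s (x k) = x (k + 1)) -> False.
  move=> sA sx; apply: (@mate_square G M (x 0) (x 1)); first exact: (lineF 0 lx).
  have -> : x 1 = s (x 0) by rewrite sx.
  by rewrite (mate_aut M _ sA) -xc sx; apply: lineF.
have moved s i j : s \in graph_aut e -> s (x i) = x j ->
    (forall k, s (x (i + k)) = x (j + k)) \/ (forall k, s (x (i + k)) = x (j - k)).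
  by move=> sA si; apply: (line_meet (line_aut sA lx) lx si).
have [s sA s1] := aut_to (x 0) (x 1); have [s' sA' s2] := aut_to (x 0) (x 2).
have [K|K] := moved _ _ _ sA s1.
  apply: (no_shift1 s sA) => k; have := K k; rewrite add0r => ->; congr x; clear; lia.
have [K'|K'] := moved _ _ _ sA' s2; last first.
  apply: (no_shift1 (s * s')%g); first by rewrite groupM.
  move=> k; rewrite permM; have := K k; rewrite add0r => ->.
  have := K' (1 - k); rewrite add0r => ->; congr x; clear; lia.
have K2 k : s' (x k) = x (k + 2) by have := K' k; rewrite add0r => ->; congr x; clear; lia.
apply: (@mate_square G M (x 0) (x 1)); first exact: (lineF 0 lx).
have -> : M (x 1) = x (c + 1); last by rewrite -xc; apply: lineF.
apply: (@perm_inj _ s'); rewrite -(mate_aut M _ sA') !K2.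
have -> : M (x (1 + 2)) = M (x 3) by [].
by rewrite H3; congr x; clear; lia.
Qed.

Lemma apart x y i j v k l : line x -> line y -> x i = v -> y j = M v -> x k <> y l.
Proof.
move=> lx ly xi yj E; have [t yt] := line_same j lx ly E.
apply: (@not_own_line v); exists (fun p => x (p + i)); first exact: line_shift.
split; first by rewrite add0r.
by exists (t - i); rewrite subrK -yt.
Qed.

(** Consecutive rungs are distinct lines because a_i, on one of them, has
    its mate b_i on the other. *)
Lemma rung_apart x a r r' k k' : ladder M x a -> rung x a r k = rung x a r' k' -> (3 %| r - r')%Z.
Proof.
move=> lad.
have N i j l : rung x a (i + 1) j <> rung x a i l.
  have [l1 _ p1 _ _] := rungP (i + 1) lad; have [l2 _ _ p2 _] := rungP i lad.
  by move=> E; apply: (apart l1 l2 p1 p2 E).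
have sh i j l t : i = j + 3 * t -> rung x a i l = rung x a j (l + 3 * t).
  by move=> ->; apply: rung_shift.
have [t [|[|]]] : exists t, r = r' + 3 * t \/ (r = r' + 1 + 3 * t \/ r' = r + 1 + 3 * t).
- by case: (boolP (3 %| r - r')%Z) => H1; [exists ((r - r') %/ 3)%Z; left; lia|];
  case: (boolP (3 %| r - r' - 1)%Z) => H2; [exists ((r - r' - 1) %/ 3)%Z; right; left; lia|];
  exists ((r' - r - 1) %/ 3)%Z; right; right; lia.
- by move=> -> _; apply/dvdzP; exists t; clear; lia.
- by move=> E; rewrite (sh _ _ _ _ E) => /N.
- by move=> E; rewrite (sh _ _ _ _ E) => /esym/N.
Qed.

Lemma line_rung x a i r k : ladder M x a -> x i <> rung x a r k.
Proof.
by move=> lad; have [l1 p1 _ _ _] := rungP r lad; have [lx _ _ _] := lad; move=> E; apply: (apart lx l1 (erefl (x r)) p1 E).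
Qed.

Lemma rung_period x a (l : nat) : ladder M x a -> (forall i j, (x i = x j) <-> (l%:Z %| i - j)%Z) ->
  forall r i j, (rung x a r i = rung x a r j) <-> (l%:Z %| i - j)%Z.
Proof.
move=> lad xP r i j; have [lr _ _ _ _] := rungP r lad; have [lx _ _ _] := lad.
have [s sA s0] := aut_to (x 0) (rung x a r 0).
case: (line_meet (line_aut sA lx) lr s0) => H.
  have E k : rung x a r k = s (x k) by have := H k; rewrite !add0r.
  by rewrite !E -xP; split=> [/perm_inj|->].
have E k : rung x a r k = s (x (- k)) by have := H (- k); rewrite !add0r opprK.
rewrite !E; have -> : (l%:Z %| i - j)%Z = (l%:Z %| - i - - j)%Z.
  by rewrite -[LHS]rpredN opprD.
by rewrite -xP; split=> [/perm_inj|->].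
Qed.

(** The rung through y_l is that through y_0, so rung_apart applies. *)
Lemma ladder_period x a (l : nat) : ladder M x a -> (forall i j, (x i = x j) <-> (l%:Z %| i - j)%Z) ->
  (3 %| l)%N.
Proof.
move=> lad xP; have [_ p1 _ _ _] := rungP l%:Z lad; have [_ p2 _ _ _] := rungP 0 lad.
have E : x l%:Z = x 0 by apply/xP; rewrite subr0.
by have := rung_apart lad (etrans p1 (etrans (congr1 M E) (esym p2))); rewrite subr0 dvdzE.
Qed.

(** The line x and the three rungs are pairwise distinct lines with the
    same period l, a multiple of 3, and contain all the vertices. *)
Lemma Agraph_iso : exists2 n : nat, (3 <= n)%N & graph_iso e (Agraph (3 * n)) /\ cnt M v0 pat0 = 0%N.
Proof.
have [x lx _] := F_line M v0; have [a lad] := ladder_ex Feq c112 lx.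
have [l l7 xP] := line_period lx.
have /dvdnP[n lE] := ladder_period lad xP; rewrite mulnC in lE.
exists n; first by clear -l7 lE; lia.
have [_ Fa Fb ab] := lad; have step i := ladder_step c112 lad i.
split; last first.
  apply/eqP; rewrite -leqn0 leqNgt; apply/negP => /pat0_line/(_ lx)/(_ 0)/xP.
  by rewrite add0r subr0 dvdzE /= => /dvdnP[q qE]; clear -l7 lE qE; nia.
have l1 : (1 < 3 * n)%N by rewrite -lE; apply: leq_trans l7.
have rP := rung_period lad xP.
have l3 i : (l%:Z %| i)%Z -> (3 %| i)%Z.
  by apply: dvdz_trans; rewrite dvdzE /= lE dvdn_mulr.
have a1 i : a i = rung x a i 1 by have [] := rungP i lad.
have y0 i : M (x i) = rung x a i 0 by have [] := rungP i lad.
have b2 i : M (a i) = rung x a (i - 1) 2.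
  by have [_ _ _ -> _] := rungP (i - 1) lad; rewrite subrK.
have rE r r' k k' : rung x a r k = rung x a r' k' -> (l%:Z %| k + (r - r') - k')%Z /\ (3 %| r - r')%Z.
  move=> E; have D := rung_apart lad E; split=> //; case/dvdzP: D => t tE.
  have rr : r = r' + 3 * t by clear -tE; lia.
  have := E; rewrite {1}rr (rung_shift _ _ _ lad) => /rP.
  by apply: dvdz_cast; rewrite rr; clear; lia.
have aP i j : (a i = a j) <-> (l%:Z %| i - j)%Z.
  rewrite !a1; split=> [/rE[D _]|D]; first by apply: dvdz_cast D; clear; lia.
  case/dvdzP: (l3 _ D) => t tE; have -> : i = j + 3 * t by clear -tE; lia.
  rewrite (rung_shift _ _ _ lad); apply/rP; apply: dvdz_cast D; clear -tE; lia.
pose m := (3 * n)%N; rewrite -/m in l1 lE *.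
rewrite lE in xP rP aP l3 rE.
pose V := 'Z_m.
have natZ (i : V) : ((nat_of_ord i)%:Z)%:~R = i by exact: natr_Zp.
have lift_eq (f : int -> G) : (forall i j, (f i = f j) <-> (m%:Z %| i - j)%Z) ->
    (forall i : int, f (nat_of_ord (i%:~R : V))%:Z = f i).
  by move=> fP i; apply/fP/Zp_int_val.
have ordD (f : int -> G) (i : V) (k : nat) : (forall i j, (f i = f j) <-> (m%:Z %| i - j)%Z) ->
    f (nat_of_ord (i + k%:R))%:Z = f ((nat_of_ord i)%:Z + k%:Z).
  move=> fP; rewrite -[in RHS](lift_eq f fP) intrD natZ //.
have ordB (f : int -> G) (i : V) (k : nat) : (forall i j, (f i = f j) <-> (m%:Z %| i - j)%Z) ->
    f (nat_of_ord (i - k%:R))%:Z = f ((nat_of_ord i)%:Z - k%:Z).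
  by move=> fP; rewrite -[in RHS](lift_eq f fP) intrB natZ.
have ord_inj (f : int -> G) (i j : V) : (forall i j, (f i = f j) <-> (m%:Z %| i - j)%Z) ->
    f (nat_of_ord i)%:Z = f (nat_of_ord j)%:Z -> i = j.
  by move=> fP /fP /(Zp_int_eq l1); rewrite !natZ.
pose N (i : V) := (nat_of_ord i)%:Z.
pose g (u : Avertex m) := match u return vert G with
  | Ax i => x (N i) | Ay i => M (x (N i)) | Aa i => a (N i) | Ab i => M (a (N i)) end.
have x_y i j : x i <> M (x j) by rewrite y0; apply: line_rung.
have x_a i j : x i <> a j by rewrite a1; apply: line_rung.
have x_b i j : x i <> M (a j) by rewrite b2; apply: line_rung.
have y_a i j : M (x i) <> a j.
  by rewrite y0 a1 => /rE[/l3 D1 D2]; have := rpredB D1 D2;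
    rewrite (_ : _ - _ = -1) //; clear; lia.
have y_b i j : M (x i) <> M (a j) by move/mate_inj; apply: x_a.
have a_b i j : a i <> M (a j).
  by rewrite a1 b2 => /rE[/l3 D1 D2]; have := rpredB D1 D2;
    rewrite (_ : _ - _ = -1) //; clear; lia.
have g_inj : injective g.
  move=> [i|i|i|i] [j|j|j|j] //= E;
   do ?[by case: (x_y _ _ E)|by case: (x_y _ _ (esym E))|by case: (x_a _ _ E)|by case: (x_a _ _ (esym E))
    |by case: (x_b _ _ E)|by case: (x_b _ _ (esym E))|by case: (y_a _ _ E)|by case: (y_a _ _ (esym E))
    |by case: (y_b _ _ E)|by case: (y_b _ _ (esym E))|by case: (a_b _ _ E)|by case: (a_b _ _ (esym E))].
  - by rewrite (ord_inj _ _ _ xP E).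
  - by rewrite (ord_inj _ _ _ xP (mate_inj E)).
  - by rewrite (ord_inj _ _ _ aP E).
  - by rewrite (ord_inj _ _ _ aP (mate_inj E)).
have gA (u u' : Avertex m) : Aarc u u' -> e (g u) (g u').
  case: u u' => i [] j //=.
  - by move=> /eqP ->; rewrite /N (ordD x i 1%N xP); apply: F_adj (lineF _ lx).
  - by move=> /eqP ->; apply: mate_adj.
  - by move=> /eqP ->; apply: F_adj (Fa _).
  - case/orP=> /eqP ->; first exact: mate_adj.
    by rewrite /N (ordD a i 1%N aP); apply: F_adj (step _).
  - move=> /eqP ->; rewrite adj_sym /N (ordD x i 2%N xP); apply: F_adj (Fb _).
have gE (u u' : Avertex m) : Agraph m u u' -> e (g u) (g u').
  by case/orP=> /gA //; rewrite adj_sym.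
apply: (@iso_of_covering G _ _ g (Ax 0)) => // u y uy.
have m3 : (2 < m)%N by rewrite -lE; apply: leq_trans l7.
have two0 : (2%:R : V) != 0.
  by apply/eqP => /(congr1 (@nat_of_ord _)); rewrite val_Zp_nat // modn_small.
have one0 : (1 : V) != 0.
  by apply/eqP => /(congr1 (@nat_of_ord _)); rewrite -[1]/(1%:R) val_Zp_nat // modn_small.
have three (u1 u2 u3 : Avertex m) : Agraph m u u1 -> Agraph m u u2 -> Agraph m u u3 ->
    u1 <> u2 -> u1 <> u3 -> u2 <> u3 -> exists2 u', g u' = y & Agraph m u u'.
  move=> A1 A2 A3 n12 n13 n23.
  have gn (u4 u5 : Avertex m) : u4 <> u5 -> g u4 != g u5 by move=> n45; apply/eqP => /g_inj.
  have [->|->|->] := adj_cases (gE _ _ A1) (gE _ _ A2) (gE _ _ A3) (gn _ _ n12) (gn _ _ n13) (gn _ _ n23) uy.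
  - by exists u1.
  - by exists u2.
  - by exists u3.
case: u uy three => i uy three.
- apply: (three (Ax (i + 1)) (Ax (i - 1)) (Ay i)) => //; rewrite /Agraph /= ?subrK ?eqxx ?orbT //.
  move=> E; have {}E := congr1 (fun u : Avertex m => if u is Ax t then t else 0) E; rewrite /= in E.
  have : (i + 1) - (i - 1) = 0 :> V by rewrite E subrr.
  by rewrite opprD opprK addrACA subrr add0r -[1]/(1%:R) -natrD; apply/eqP.
- apply: (three (Ax i) (Aa i) (Ab (i - 2))) => //; by rewrite /Agraph /= ?subrK ?eqxx ?orbT.
- apply: (three (Ay i) (Ab i) (Ab (i + 1))) => //; rewrite /Agraph /= ?subrK ?eqxx ?orbT //.
  move=> E; have {}E := congr1 (fun u : Avertex m => if u is Ab t then t else 0) E; rewrite /= in E.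
  by move: one0; rewrite -(inj_eq (addrI i)) -E addr0 eqxx.
- apply: (three (Aa i) (Ay (i + 2)) (Aa (i - 1))) => //; rewrite /Agraph /= ?subrK ?eqxx ?orbT //.
  move=> E; have {}E := congr1 (fun u : Avertex m => if u is Aa t then t else 0) E; rewrite /= in E.
  by move: one0; rewrite -(inj_eq (addrI i)) {1}E subrK addr0 eqxx.
Qed.
End Global.

(** * A(3n) is a Cayley graph *)

(** The group is the semidirect product of the four-group by the integers
    modulo 3 (n + 1), whose generator permutes the three involutions
    cyclically. Its generating set consists of the translation tw_t, the
    inverse of tw_t and the involution tw_g. *)
Definition four := (bool * bool)%type.
Definition four0 : four := (false, false).
Definition four_add (v w : four) : four := (v.1 (+) w.1, v.2 (+) w.2).
Definition four_turn (v : four) : four := (v.2, v.1 (+) v.2).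

Definition twisted (n : nat) : Type := (four * 'Z_(3 * n.+1))%type.
HB.instance Definition _ n := Finite.on (twisted n).

Section Twisted.
Variable n : nat.
Local Notation m := (3 * n.+1)%N.
Local Notation V := 'Z_m.

Lemma m_gt2 : (2 < m)%N. Proof. by rewrite mulnS. Qed.
Let m_gt1 : (1 < m)%N. Proof. exact: ltnW m_gt2. Qed.

Definition turn_by (i : V) (v : four) := iter i four_turn v.

Lemma turn3 k v : iter (3 * k) four_turn v = v.
Proof. by elim: k v => [|k IH] [a b] //; rewrite mulnS iterD IH /=; case: a; case: b. Qed.

Lemma turn_mod k v : iter (k %% m) four_turn v = iter k four_turn v.
Proof. by rewrite {2}(divn_eq k m) iterD mulnCA turn3. Qed.

Lemma turn_byD i j v : turn_by (i + j) v = turn_by i (turn_by j v).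
Proof.
rewrite /turn_by -iterD -[RHS]turn_mod; congr (iter _ _ _).
by congr (_ %% _)%N; apply: Zp_cast.
Qed.

Lemma turn_by0 v : turn_by 0 v = v. Proof. by []. Qed.

Lemma turn_byn (k : nat) v : turn_by k%:R v = iter k four_turn v.
Proof. by rewrite /turn_by val_Zp_nat // turn_mod. Qed.

Lemma four_addA : associative four_add.
Proof. by move=> [a b] [c d] [x y]; rewrite /four_add /= !addbA. Qed.
Lemma four_addvv v : four_add v v = four0.
Proof. by case: v => [[] []]. Qed.
Lemma four_add0 v : four_add four0 v = v. Proof. by case: v => [[] []]. Qed.
Lemma four_addv0 v : four_add v four0 = v. Proof. by case: v => [[] []]. Qed.

Lemma turn_by_add i v w : turn_by i (four_add v w) = four_add (turn_by i v) (turn_by i w).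
Proof.
rewrite /turn_by; elim: (nat_of_ord i) => //= k ->.
by move: (iter k _ v) (iter k _ w) => [[] []] [[] []].
Qed.

Lemma turn_by_four0 i : turn_by i four0 = four0.
Proof. by rewrite /turn_by; elim: (nat_of_ord i) => //= k ->. Qed.

Lemma turn_by_inj i : injective (turn_by i).
Proof. by move=> v w /(congr1 (turn_by (- i))); rewrite -!turn_byD addNr. Qed.

Definition tw_one : twisted n := (four0, 0).
Definition tw_mul (x y : twisted n) : twisted n := (four_add x.1 (turn_by x.2 y.1), x.2 + y.2).
Definition tw_inv (x : twisted n) : twisted n := (turn_by (- x.2) x.1, - x.2).

Lemma tw_mulA : associative tw_mul.
Proof.
by move=> [v i] [w j] [u k]; rewrite /tw_mul /= turn_by_add turn_byD four_addA addrA.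
Qed.
Lemma tw_mul1 : left_id tw_one tw_mul.
Proof. by move=> [v i]; rewrite /tw_mul /= turn_by0 four_add0 add0r. Qed.
Lemma tw_mulV : left_inverse tw_one tw_inv tw_mul.
Proof. by move=> [v i]; rewrite /tw_mul /= four_addvv addNr. Qed.

HB.instance Definition _ := Finite_isGroup.Build (twisted n) tw_mulA tw_mul1 tw_mulV.

Definition four1 : four := (true, false).
Definition tw_t : twisted n := (four0, 1).
Definition tw_g : twisted n := (four1, 0).

(** Following the edges from x_0, one step along the lines is right
    multiplication by tw_t and a matching edge is right multiplication by
    tw_g. *)
Definition vertex_group (u : Avertex m) : twisted n :=
  match u with
  | Ax i => (four0, i) | Ay i => (turn_by i four1, i)
  | Aa i => (turn_by i four1, i + 1) | Ab i => (turn_by (i + 2) four1, i + 1)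
  end.

Definition next1 (u : Avertex m) : Avertex m :=
  match u with Ax i => Ax (i + 1) | Ay i => Aa i | Aa i => Ab (i + 1) | Ab i => Ay (i + 2) end.
Definition next2 (u : Avertex m) : Avertex m :=
  match u with Ax i => Ax (i - 1) | Ay i => Ab (i - 2) | Aa i => Ay i | Ab i => Aa (i - 1) end.
Definition next3 (u : Avertex m) : Avertex m :=
  match u with Ax i => Ay i | Ay i => Ax i | Aa i => Ab i | Ab i => Aa i end.

Lemma Agraph_next u u' : Agraph m u u' <-> [\/ u' = next1 u, u' = next2 u | u' = next3 u].
Proof.
split; last first.
  by case=> ->; case: u => i; rewrite /Agraph /= ?subrK ?eqxx ?orbT.
have mv (i j k : V) : i = j + k -> j = i - k by move=> ->; rewrite addrK.
case: u u' => i [] j; rewrite /Agraph //= ?orbF.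
- case/orP=> /eqP => [->|/mv ->]; first by constructor 1.
  by constructor 2.
- by move/eqP->; constructor 3.
- by move/eqP->; constructor 3.
- by move/eqP->; constructor 1.
- by move/eqP/mv->; constructor 2.
- by move/eqP->; constructor 2.
- by case/orP=> /eqP->; [constructor 3 | constructor 1].
- by move/eqP->; constructor 1.
- by case/orP=> /eqP; [move=> ->; constructor 3 | move/mv->; constructor 2].
Qed.

Lemma turn_by3 i v : turn_by (i + 3) v = turn_by i v.
Proof. by rewrite turn_byD (turn_byn 3) (turn3 1). Qed.

Lemma vertex_group1 u : vertex_group (next1 u) = (vertex_group u * tw_t)%g.
Proof.
case: u => i; rewrite /= /mulg /= /tw_mul /= turn_by_four0 ?four_addv0 //.
- by rewrite -(addrA i 1 2) turn_by3.
- by rewrite -addrA.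
Qed.

Lemma vertex_group2 u : vertex_group (next2 u) = (vertex_group u * tw_t^-1)%g.
Proof.
apply: (mulIg tw_t); rewrite mulgVK -vertex_group1; congr vertex_group.
by case: u => i //=; rewrite subrK.
Qed.

Lemma vertex_group3 u : vertex_group (next3 u) = (vertex_group u * tw_g)%g.
Proof.
case: u => i; rewrite /= /mulg /= /tw_mul /= ?addr0 ?four_add0 ?four_addvv //.
- by rewrite !turn_byD !(turn_byn 1) -turn_by_add.
- by rewrite !turn_byD !(turn_byn 1) -turn_by_add.
Qed.

Lemma vertex_group_inj : injective vertex_group.
Proof.
have nz i : turn_by i four1 <> four0.
  by rewrite -(turn_by_four0 i) => /turn_by_inj.
have D1 i : turn_by (i + 1) four1 <> turn_by i four1.
  by rewrite turn_byD => /turn_by_inj; rewrite (turn_byn 1).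
have D1' i : turn_by (i + 2) four1 <> turn_by (i + 1) four1.
  by rewrite -[2]/(1 + 1) addrA; apply: D1.
have D2 i : turn_by (i + 2) four1 <> turn_by i four1.
  by rewrite turn_byD => /turn_by_inj; rewrite (turn_byn 2).
have D i : turn_by i four1 = four0 -> False by apply: nz.
move=> [i|i|i|i] [j|j|j|j] /= H; have H1 := congr1 fst H; have H2 := congr1 snd H;
  rewrite /= in H1 H2; do ?[by case: (D _ H1)|by case: (D _ (esym H1))|by rewrite H2|
    by rewrite (addIr _ H2)].
- by rewrite H2 in H1; case: (D1 _ H1).
- by rewrite H2 in H1; case: (D1' _ (esym H1)).
- by rewrite -H2 in H1; case: (D1 _ (esym H1)).
- by rewrite (addIr _ H2) in H1; case: (D2 _ (esym H1)).
- by rewrite -H2 in H1; case: (D1' _ H1).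
- by rewrite (addIr _ H2) in H1; case: (D2 _ H1).
Qed.

Lemma vertex_group_onto (x : twisted n) : exists u, vertex_group u = x.
Proof.
have W v i : exists k : nat, (k < 3)%N /\ (v = four0 \/ v = turn_by (i + k%:R) four1).
  have -> : v = turn_by i (turn_by (- i) v) by rewrite -turn_byD subrr.
  case: (turn_by (- i) v) => [[] []].
  - by exists 2%N; split=> //; right; rewrite turn_byD turn_byn.
  - by exists 0%N; split=> //; right; rewrite addr0.
  - by exists 1%N; split=> //; right; rewrite turn_byD turn_byn.
  - by exists 0%N; split=> //; left; rewrite turn_by_four0.
case: x => v i; have [k [k3 [->|->]]] := W v i; first by exists (Ax i).
case: k k3 => [|[|[|]]] // _.
- by exists (Ay i); rewrite /= addr0.
- by exists (Ab (i - 1)); rewrite /= subrK; congr (turn_by _ _, _); rewrite -[2]/(1 + 1) addrA subrK.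
- exists (Aa (i - 1)); rewrite /= subrK -turn_by3; congr (turn_by _ _, _).
  by rewrite -[3]/(1 + 2%:R) addrA subrK.
Qed.

Lemma Agraph_cayley : is_cayley_graph (Agraph m).
Proof.
exists (twisted n), [set tw_t; tw_t^-1; tw_g]%g.
have t1 : tw_t != 1%g.
  by apply/eqP => /(congr1 snd) /= /(congr1 (@nat_of_ord _)).
have gg : (tw_g * tw_g = 1)%g by rewrite /mulg /= /tw_mul /= four_addvv addr0.
have gV : (tw_g^-1 = tw_g)%g by apply: (mulgI tw_g); rewrite mulgV gg.
split.
- apply/negP; rewrite !inE => /orP[/orP[]|] /eqP H.
  + by rewrite -H eqxx in t1.
  + by rewrite -(invgK tw_t) -H invg1 eqxx in t1.
  + by have := congr1 (fun z : twisted n => z.1.1) H.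
- move=> s; rewrite !inE => /orP[/orP[]|] /eqP ->; first by rewrite !eqxx ?orbT.
    by rewrite invgK !eqxx ?orbT.
  by rewrite gV !eqxx ?orbT.
have [f fK] := fin_all_exists vertex_group_onto.
exists vertex_group; first by exists f => // u; apply: vertex_group_inj; rewrite fK.
move=> u u'; apply/idP/idP.
  rewrite !inE => H; apply/Agraph_next; case/orP: H => [/orP[]|] /eqP E.
  - by constructor 1; apply: vertex_group_inj; rewrite vertex_group1 -E mulKVg.
  - by constructor 2; apply: vertex_group_inj; rewrite vertex_group2 -E mulKVg.
  - by constructor 3; apply: vertex_group_inj; rewrite vertex_group3 -E mulKVg.
rewrite !inE => /Agraph_next [] ->.
- by rewrite vertex_group1 mulKg !eqxx ?orbT.
- by rewrite vertex_group2 mulKg !eqxx ?orbT.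
- by rewrite vertex_group3 mulKg !eqxx ?orbT.
Qed.
End Twisted.

(** * A heptagon and its spokes *)

Section Hepcycles.
Variable G : vtGraph7.
Local Notation e := (@adj G).
Implicit Types (a b c d w : G) (s : {perm G}) (i j k : int) (v : int -> G).

(** A heptagon, indexed by the integers modulo 7 so that rotations and
    differences of indices are available. *)
Definition hepcycle v :=
  [/\ forall i, v (i + 7) = v i, forall i, e (v i) (v (i + 1)) & forall i, v i != v (i + 2)].

Lemma hepcycle_mod v i j k : hepcycle v -> i = j + 7 * k -> v i = v j.
Proof.
case=> v7 _ _ ->; elim/int_shift_ind: k => [|k IH|k IH]; first by rewrite mulr0 addr0.
  by rewrite -IH -[RHS]v7; congr v; clear; lia.
by rewrite -IH -[LHS]v7; congr v; clear; lia.
Qed.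

Lemma hepcycle_ex a b c d x y z : hept a b c d x y z ->
  exists2 v, hepcycle v & [/\ v 0 = a, v 1 = b, v 2 = c, v 3 = d & [/\ v 4 = x, v 5 = y & v 6 = z]].
Proof.
rewrite heptE => /and5P[ab bc cd dx /and5P[xy yz za ac /and5P[bd cx dy xz /andP[ya zb]]]].
pose v (i : int) := nth a [:: a; b; c; d; x; y; z] `|(i %% 7)%Z|%N.
exists v => //.
have R i : exists r : nat, (r < 7)%N /\ (i %% 7)%Z = r.
  by exists `|(i %% 7)%Z|%N; clear; split; lia.
have S i n (r m : nat) : (i %% 7)%Z = r -> (m < 7)%N -> ((r + n) %% 7 = m)%N -> v (i + n%:Z) = nth a [:: a; b; c; d; x; y; z] m.
  move=> ir mr E; rewrite /v; congr nth.
  by clear -ir mr E; lia.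
have S0 i (r : nat) : (i %% 7)%Z = r -> v i = nth a [:: a; b; c; d; x; y; z] r.
  by rewrite /v => ->.
split=> i; have [r [r7 ir]] := R i.
- by rewrite (S i 7%N r r ir r7) ?(S0 _ _ ir) // modnDr modn_small.
- rewrite (S0 _ _ ir); case: r r7 ir => [|[|[|[|[|[|[|]]]]]]] // _ ir.
  + by rewrite (S i 1%N _ 1%N ir).
  + by rewrite (S i 1%N _ 2%N ir).
  + by rewrite (S i 1%N _ 3%N ir).
  + by rewrite (S i 1%N _ 4%N ir).
  + by rewrite (S i 1%N _ 5%N ir).
  + by rewrite (S i 1%N _ 6%N ir).
  + by rewrite (S i 1%N _ 0%N ir).
- rewrite (S0 _ _ ir); case: r r7 ir => [|[|[|[|[|[|[|]]]]]]] // _ ir.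
  + by rewrite (S i 2%N _ 2%N ir).
  + by rewrite (S i 2%N _ 3%N ir).
  + by rewrite (S i 2%N _ 4%N ir).
  + by rewrite (S i 2%N _ 5%N ir).
  + by rewrite (S i 2%N _ 6%N ir).
  + by rewrite (S i 2%N _ 0%N ir).
  + by rewrite (S i 2%N _ 1%N ir).
Qed.

Section Cycle.
Variable v : int -> G.
Hypothesis hv : hepcycle v.

Lemma hc_adj i : e (v i) (v (i + 1)). Proof. by case: hv. Qed.
Lemma hc_adjV i : e (v i) (v (i - 1)).
Proof. by rewrite adj_sym -{2}(subrK 1 i); apply: hc_adj. Qed.

Lemma hc_neq i (n : nat) : (0 < n <= 6)%N -> v i != v (i + n%:Z).
Proof.
case: hv => _ va vn n6; have := @nbw_fun G (fun t => v (i + t%:Z)) n n6; rewrite addr0; apply.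
  by move=> t _; have -> : i + t.+1%:Z = i + t%:Z + 1 by [clear; lia]; apply: va.
by move=> t _; have := vn (i + t%:Z); have -> // : i + t%:Z + 2 = i + t.+2%:Z by clear; lia.
Qed.

Lemma hc_hept i : hept (v i) (v (i + 1)) (v (i + 2)) (v (i + 3)) (v (i + 4)) (v (i + 5)) (v (i + 6)).
Proof.
have [v7 va vn] := hv; rewrite heptE.
have A k l : l = k + 1 -> e (v k) (v l) by move=> ->.
have N k l : l = k + 2 -> v k != v l by move=> ->.
by repeat (apply/andP; split); first [apply: A; clear; lia | apply: N; clear; lia
 | rewrite -[v i]v7; apply: A; clear; lia | rewrite -[v i]v7; apply: N; clear; lia
 | rewrite -[v (i + 1)]v7; apply: N; clear; lia].
Qed.

Definition spoke i := third (v i) (v (i + 1)) (v (i - 1)).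

Lemma hc_back i : v (i + 1) != v (i - 1).
Proof. by case: hv => _ _ vn; have := vn (i - 1); rewrite eq_sym; have -> // : i - 1 + 2 = i + 1 by clear; lia. Qed.

Lemma spokeP i : [/\ e (v i) (spoke i), spoke i != v (i + 1), spoke i != v (i - 1)
  & forall t, e (v i) t -> [\/ t = v (i + 1), t = v (i - 1) | t = spoke i]].
Proof. exact: thirdP (hc_adj i) (hc_adjV i) (hc_back i). Qed.

Lemma spoke_adj i : e (spoke i) (v i).
Proof. by rewrite adj_sym; case: (spokeP i). Qed.

Lemma spoke_mod i j k : i = j + 7 * k -> spoke i = spoke j.
Proof.
move=> E; rewrite /spoke (hepcycle_mod hv E).
have -> : v (i + 1) = v (j + 1) by apply: (hepcycle_mod (k := k) hv); rewrite E; clear; lia.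
by have -> : v (i - 1) = v (j - 1) by apply: (hepcycle_mod (k := k) hv); rewrite E; clear; lia.
Qed.

Lemma spoke_neqR i : spoke i != v (i + 1). Proof. by case: (spokeP i). Qed.
Lemma spoke_neqL i : spoke i != v (i - 1). Proof. by case: (spokeP i). Qed.

Lemma spoke_third i : e (v i) (spoke i). Proof. by rewrite adj_sym spoke_adj. Qed.

Lemma hc_adj12 i : e (v (i + 1)) (v (i + 2)).
Proof. by have := hc_adj (i + 1); have -> : i + 1 + 1 = i + 2 by clear; lia. Qed.

Lemma hc_adj23 i : e (v (i + 2)) (v (i + 3)).
Proof. by have := hc_adj (i + 2); have -> : i + 2 + 1 = i + 3 by clear; lia. Qed.

(** Every walk that follows the cycle and then leaves it without turning
    back is non-backtracking. *)
Lemma cycle_tail i (n : nat) (t : seq G) : nbw (v (i + n%:Z - 1) :: v (i + n%:Z) :: t) ->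
  (0 < n + size t <= 6)%N -> v i != last (v (i + n%:Z)) t.
Proof.
move=> W nt; suff [t' [W' tE <-]] : exists t', [/\ nbw (v (i - 1) :: v i :: t'), size t' = (n + size t)%N
    & last (v i) t' = last (v (i + n%:Z)) t].
  by apply: nbw_neq; [case/and3P: W' | rewrite tE].
elim: n i W {nt} => [|n IH] i; first by rewrite addr0 => W; exists t.
have -> : i + n.+1%:Z = i + 1 + n%:Z by clear; lia.
case/IH => t' []; rewrite addrK => W' tE lE; exists (v (i + 1) :: t'); split=> //=; last by rewrite tE.
apply/and3P; split; [by have := hc_adj (i - 1); rewrite subrK | by rewrite eq_sym hc_back | exact: W'].
Qed.

Lemma mod7_split (i j : int) : (exists k, i = j + 7 * k) \/
  exists n : nat, exists2 k, (0 < n <= 3)%N & j = i + n%:Z + 7 * k \/ i = j + n%:Z + 7 * k.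
Proof.
have E := divz_eq (j - i) 7; set q := ((j - i) %/ 7)%Z in E *.
have [r [r7 rE]] : exists r : nat, (r < 7)%N /\ ((j - i) %% 7)%Z = r%:Z.
  by exists `|((j - i) %% 7)%Z|%N; clear; split; lia.
rewrite rE in E; case: (posnP r) => [r0|r0]; [left|right].
  by exists (- q); clear -E r0; lia.
have [r3|r4] := leqP r 3.
  by exists r, q; rewrite ?r0 //; left; clear -E; lia.
exists (7 - r)%N, (- q - 1); first by clear -r7 r4; lia.
by right; clear -E r7; lia.
Qed.

Let back i : e (v (i - 1)) (v i). Proof. by rewrite adj_sym hc_adjV. Qed.

Lemma spoke_vertex i j : spoke i != v j.
Proof.
have st k (n : nat) : (1 < n <= 5)%N -> spoke k != v (k + n%:Z).
  move=> n5; apply/eqP => E; have A := spoke_third k; rewrite E in A.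
  have := @cycle_tail k n [:: v k]; rewrite /= back adj_sym A eqxx !andbT /= => W.
  suff: ~~ true by []; apply: W; last by clear -n5; lia.
  rewrite eq_sym; have -> : k + n%:Z - 1 = k + n.-1%:Z by clear -n5; lia.
  by apply: hc_neq; clear -n5; lia.
case: (mod7_split i j) => [[k E]|[n [k n3 [E|E]]]].
- by rewrite (spoke_mod E) eq_sym; apply: adj_neq (spoke_third j).
- rewrite (hepcycle_mod hv E); case: n n3 {E} => [|[|n]] // n3; first exact: spoke_neqR.
  by apply: st; clear -n3; lia.
have -> : v j = v (i + (7 - n)%N%:Z) by apply: (hepcycle_mod (k := - k - 1) hv); clear -E n3; lia.
case: n n3 {E} => [|[|n]] // n3; last by apply: st; clear -n3; lia.
have -> : v (i + (7 - 1)%N%:Z) = v (i - 1) by apply: (hepcycle_mod (k := 1) hv); clear; lia.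
exact: spoke_neqL.
Qed.

Lemma vertex_eq i j : v i = v j -> exists k, i = j + 7 * k.
Proof.
case: (mod7_split i j) => [//|[n [k n3 [E|E]]]]; rewrite (hepcycle_mod hv E) => /eqP.
  by rewrite (negbTE (hc_neq _ _)) //; clear -n3; lia.
by rewrite eq_sym (negbTE (hc_neq _ _)) //; clear -n3; lia.
Qed.

Let far i (n : nat) : (0 < n <= 3)%N -> v (i + n%:Z) != v i.
Proof. by move=> n3; rewrite eq_sym hc_neq //; clear -n3; lia. Qed.

Lemma spoke_link i j : e (spoke i) (v j) -> v j = v i.
Proof.
move=> A; apply/eqP/negPn/negP => N; have A' := spoke_third i; have S := spoke_vertex i.
have st k l (n : nat) : (0 < n <= 3)%N -> e (v (k + n%:Z)) (spoke l) -> e (spoke l) (v k) -> False.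
  move=> n3 E1 E2; have := @cycle_tail k n [:: spoke l; v k].
  rewrite /= back E1 E2 eqxx eq_sym spoke_vertex far // => /(_ isT) H.
  by suff: ~~ true by []; apply: H; clear -n3; lia.
case: (mod7_split i j) => [[k E]|[n [k n3 [E|E]]]].
- by rewrite (hepcycle_mod hv E) eqxx in N.
- by rewrite (hepcycle_mod hv E) adj_sym in A; apply: st n3 A (spoke_adj i).
by rewrite (hepcycle_mod hv E) in A'; apply: st n3 A' A.
Qed.

(** A short walk along the cycle from one spoke to the other would close
    up. *)
Lemma spokes_link i j : ~ e (spoke i) (spoke j).
Proof.
have st k (n : nat) : (0 < n <= 3)%N -> ~ e (spoke (k + n%:Z)) (spoke k).
  move=> n3 A; have := @cycle_tail k n [:: spoke (k + n%:Z); spoke k; v k].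
  rewrite /= back spoke_third A spoke_adj eqxx ![v _ == spoke _]eq_sym !spoke_vertex => /(_ isT) H.
  by suff: ~~ true by []; apply: H; clear -n3; lia.
case: (mod7_split i j) => [[k E]|[n [k n3 [E|E]]]]; rewrite (spoke_mod E); first by rewrite adj_irr.
  by rewrite adj_sym; apply: st.
exact: st.
Qed.

Lemma spoke_eq i j : spoke i = spoke j -> exists k, i = j + 7 * k.
Proof.
by move=> E; apply: vertex_eq; apply: spoke_link; rewrite -E spoke_adj.
Qed.

(** One of the two neighbours of the i-th spoke at distance 2 from the
    cycle. *)
Definition outer t i := e (spoke i) t && (t != v i).

Lemma outer_mod t i j k : i = j + 7 * k -> outer t i = outer t j.
Proof. by move=> E; rewrite /outer (spoke_mod E) (hepcycle_mod hv E). Qed.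

Lemma outer_near t i j k (n : nat) : outer t i -> outer t j -> (0 < n <= 2)%N ->
  j = i + n%:Z + 7 * k -> False.
Proof.
move=> /andP[T1 n1] + n2 E; rewrite (outer_mod t E) => /andP[T2 n2'].
have := @cycle_tail i n [:: spoke (i + n%:Z); t; spoke i; v i].
have N : spoke (i + n%:Z) != spoke i.
  by apply/eqP => /spoke_eq[m]; clear -n2; lia.
rewrite /= back spoke_third T2 adj_sym T1 spoke_adj eqxx n1 N ![v _ == _]eq_sym spoke_vertex n2' => /(_ isT) H.
by suff: ~~ true by []; apply: H; clear -n2; lia.
Qed.

Lemma outer_vertex t i j : outer t i -> t != v j.
Proof. by case/andP=> A n; apply/eqP=> E; move: A n; rewrite E => /spoke_link ->; rewrite eqxx. Qed.

Lemma outer_spoke t i j : outer t i -> t != spoke j.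
Proof. by case/andP=> A n; apply/eqP=> E; move: A; rewrite E; apply: spokes_link. Qed.
End Cycle.
End Hepcycles.

(** * No cubic graph of girth seven attains the Moore bound *)

Section Moore.
Variable G : vtGraph7.
Local Notation e := (@adj G).
Implicit Types (a b c d w t : G) (s : {perm G}) (i j k : int).

(** Around a heptagon v, the 4-arc u_i, v_i, ..., v_(i+3) closes through a
    common outer neighbour z_i of u_i and u_(i+3). So the outer vertices
    are z_0, ..., z_6, where z_i and z_(i-3) belong to u_i; let t_i be the
    third neighbour of z_i. The 4-arc u_(j+2), v_(j+2), v_(j+3), u_(j+3),
    z_j makes t_j adjacent to one of the outer neighbours z_(j+2) and
    z_(j-1) of u_(j+2). The 4-arc u_0, v_0, v_1, v_2, u_2 makes two of the
    z adjacent, say z_b = t_a; then z_b has two neighbours among the z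
    besides its two spokes. *)
Lemma no_moore : (forall a b c d x, e a b -> e b c -> e c d -> e d x -> a != c -> b != d -> c != x ->
    exists y z, hept a b c d x y z) -> False.
Proof.
move=> H4; have [a0 [b0 [c0 [d0 [x0 [y0 [z0 H0]]]]]]] := hept_ex G.
have {a0 b0 c0 d0 x0 y0 z0 H0} [v hv _] := hepcycle_ex H0.
pose u := spoke v.
have vA := hc_adj hv; have vAV := hc_adjV hv; have uA := spoke_adj hv.
have uAV i : e (v i) (u i) by rewrite adj_sym.
have uR := spoke_neqR hv; have uL := spoke_neqL hv.
have v2 i : v i != v (i + 2) by apply: (hc_neq hv i (n := 2)).
have shv i j : i = j -> v i = v j by move=> ->.
have v12 := hc_adj12 hv.
have uL2 i : v (i + 1) != u (i + 2).
  have := uL (i + 2); rewrite eq_sym; have -> // : v (i + 2 - 1) = v (i + 1) by apply: shv; clear; lia.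
have zex i : exists z, outer v z i && outer v z (i + 3).
  have v23 := hc_adj23 hv i.
  have n13 : v (i + 1) != v (i + 3).
    by have := v2 (i + 1); have -> : v (i + 1 + 2) = v (i + 3) by apply: shv; clear; lia.
  have [p [q]] := H4 _ _ _ _ _ (uA i) (vA i) (v12 i) v23 (uR i) (v2 i) n13.
  rewrite heptE => /and5P[_ _ _ _ /and5P[vp pq qu _ /and5P[_ _ np nq /andP[pu qv]]]].
  have uq : e (u i) q by rewrite adj_sym.
  have [_ _ _ /(_ _ vp)] := spokeP hv (i + 3); case=> pE.
  - exfalso; have E4 : p = v (i - 3).
      by rewrite pE; apply: (hepcycle_mod (k := 1) hv); clear; lia.
    rewrite E4 in pq; have [_ _ _ /(_ _ pq)] := spokeP hv (i - 3); case=> qE.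
    + have {}qE : q = v (i - 2) by rewrite qE; apply: shv; clear; lia.
      have := spoke_link hv (i := i) (j := i - 2); rewrite -qE => /(_ uq) qv'.
      by rewrite qv' eqxx in qv.
    + have qE' : q = v (i + 3) by rewrite qE; apply: (hepcycle_mod (k := -1) hv); clear; lia.
      by rewrite qE' eqxx in nq.
    + have := @spokes_link G v hv i (i - 3); rewrite -qE; exact.
  - have {}pE : p = v (i + 2) by rewrite pE; apply: shv; clear; lia.
    by rewrite pE eqxx in np.
  - exists q; rewrite /outer qv andbT; apply/andP; split; first exact: uq.
    by rewrite -pE pq /= eq_sym; exact: nq.
pose z i := xchoose (zex i).
have [z0 z3] : (forall i, outer v (z i) i) /\ (forall i, outer v (z i) (i + 3)).
  by split=> i; have /andP[] := xchooseP (zex i).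
have zV i : outer v (z (i - 3)) i by have := z3 (i - 3); rewrite subrK.
have zinj i j : (forall k, j <> i + 7 * k) -> z i != z j.
  move=> ne; apply/eqP => E.
  have near i' j' k (n : nat) : (0 < n <= 3)%N -> j' = i' + n%:Z + 7 * k -> z i' = z j' -> False.
    move=> n3 ij zE; have o := z0 i'; have o' := z0 j'; have o3 := z3 j'; rewrite -zE in o' o3.
    case: n n3 ij => [|[|[|[|]]]] // _ ij.
    - exact: (outer_near hv o o' (n := 1) isT ij).
    - exact: (outer_near hv o o' (n := 2) isT ij).
    by apply: (outer_near hv o3 o (n := 1) (k := - k - 1)) => //; rewrite ij; clear; lia.
  case: (mod7_split i j) => [[k H]|[n [k n3 [H|H]]]].
  - by apply: (ne (- k)); rewrite H; clear; lia.
  - exact: near n3 H E.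
  exact: near n3 H (esym E).
have oN i t : outer v t i -> t = z i \/ t = z (i - 3).
  case/andP=> T n; have /andP[T1 n1] := z0 i; have /andP[T2 n2] := zV i.
  have n12 : z i != z (i - 3) by apply: zinj => k; clear; lia.
  have N1 : v i != z i by rewrite eq_sym.
  have N2 : v i != z (i - 3) by rewrite eq_sym.
  case: (adj_cases (uA i) T1 T2 N1 N2 n12 T) => E; [|by left|by right].
  by rewrite E eqxx in n.
have zu i j : z i != u j.
  by apply/eqP => E; apply: (@spokes_link G v hv i j); rewrite -/u -E; case/andP: (z0 i).
pose t i := third (z i) (u i) (u (i + 3)).
have zA i : e (z i) (u i) by rewrite adj_sym; case/andP: (z0 i).
have zA3 i : e (z i) (u (i + 3)) by rewrite adj_sym; case/andP: (z3 i).
have u3 i : u i != u (i + 3) by apply/eqP => /(spoke_eq hv)[k]; clear; lia.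
have tP i := thirdP (zA i) (zA3 i) (u3 i).
have claim1 j : e (t j) (z (j + 2)) \/ e (t j) (z (j - 1)).
  have vj := hc_adj23 hv j.
  have E3 : j + 2 + 1 = j + 3 by clear; lia.
  have N1 : u (j + 2) != v (j + 3) by rewrite -E3; apply: uR.
  have N2 : v (j + 2) != u (j + 3) by rewrite -E3 eq_sym; apply: (spoke_vertex hv).
  have uz : e (u (j + 3)) (z j) by rewrite adj_sym.
  have N3 : v (j + 3) != z j by rewrite eq_sym; case/andP: (z3 j).
  have [p [q]] := H4 _ _ _ _ _ (uA (j + 2)) vj (uAV (j + 3)) uz N1 N2 N3.
  rewrite heptE => /and5P[_ _ _ _ /and5P[zp pq qu _ /and5P[_ _ np nq /andP[pu qv]]]].
  have uq : e (u (j + 2)) q by rewrite adj_sym.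
  have oq : outer v q (j + 2) by rewrite /outer uq qv.
  have [_ _ _ /(_ _ zp)] := tP j; case=> pE.
  - exfalso; have [qj|nqj] := eqVneq q (v j).
      have := outer_vertex hv j oq; rewrite qj eqxx; exact/negP/negPn.
    apply: (outer_near hv _ oq (i := j) (k := 0) (n := 2)) => //; last by clear; lia.
    by rewrite /outer nqj -/u -pE pq.
  - by rewrite pE eqxx in np.
  - rewrite pE in pq; case: (oN _ _ oq) => qE; rewrite qE in pq; [by left|right].
    by move: pq; have -> : j + 2 - 3 = j - 1 by clear; lia.
have [p [q]] := H4 _ _ _ _ _ (uA 0) (vA 0) (v12 0) (uAV 2) (uR 0) (v2 0) (uL2 0).
rewrite heptE => /and5P[_ _ _ _ /and5P[up pq qu _ /and5P[_ _ np nq /andP[_ qv]]]].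
have op : outer v p 2 by rewrite /outer up eq_sym.
have oq : outer v q 0 by rewrite /outer qv andbT adj_sym.
have [a [b [ab aE bE]]] : exists a b : int, [/\ (forall k, b <> a + 7 * k), p = z a & q = z b].
  case: (oN _ _ op) (oN _ _ oq) => pE [] qE.
  - by exists 2, 0; split=> // k; clear; lia.
  - by exists 2, (0 - 3); split=> // k; clear; lia.
  - by exists (2 - 3), 0; split=> // k; clear; lia.
  - by exists (2 - 3), (0 - 3); split=> // k; clear; lia.
rewrite aE bE in pq.
have zb : z b = t a.
  have [_ _ _ /(_ _ pq)] := tP a; case=> // E; by have := zu b a; have := zu b (a + 3); rewrite E eqxx.
have [a' na zz] : exists2 a' : int, (forall k, a' <> a + 7 * k) & e (z b) (z a').
  by rewrite zb; case: (claim1 a) => H; [exists (a + 2)|exists (a - 1)] => // k; clear; lia.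
have ba : e (z b) (z a) by rewrite adj_sym.
apply: (four_nbrs (zA b) (zA3 b) ba zz).
rewrite /= !inE !negb_or (u3 b) (zinj _ _ na) !andbT !(eq_sym (u _)) !zu.
by [].
Qed.
End Moore.

Local Close Scope ring_scope.

(** * Heptagons of arc-transitive graphs *)

Lemma rotations_uniq (b1 b2 b3 b4 b5 b6 b7 : bool) :
  let om := [:: b1; b2; b3; b4; b5; b6; b7] in
  om != nseq 7 true -> om != nseq 7 false -> uniq [seq seq.rot i om | i <- iota 0 7].
Proof. by case: b1; case: b2; case: b3; case: b4; case: b5; case: b6; case: b7. Qed.

Section Seven.
Variable G : vtGraph7.
Local Notation e := (@adj G).
Variables (X : finType) (root : 7.-tuple G -> X) (D : {set X}).
Variable L : G -> G -> G -> G -> bool.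
Hypothesis Linv : invariant_letter L.
Hypothesis rootD : forall c : 7.-tuple G, c \in heps G -> root c \in D.
Hypothesis root_trans : forall x y, x \in D -> y \in D ->
  exists2 s, s \in graph_aut e & forall c : 7.-tuple G, root c = x -> root (mapH s c) = y.

(** Seven being prime, a word that is not constant has seven distinct
    rotations, and each of them is read at every root. *)
Lemma seven_words (c : 7.-tuple G) x : c \in heps G -> x \in D ->
  word L c != nseq 7 true -> word L c != nseq 7 false ->
  6 < #|[set h in heps G | root h == x]|.
Proof.
move=> cH xD nT nF; set om := word L c.
have uO : uniq [seq seq.rot i om | i <- iota 0 7].
  move: nT nF; rewrite /om; have [a [b [c1 [d [x' [y [z ->]]]]]]] := tuple7P c.
  exact: rotations_uniq.
have pos i : 0 < rooted_count root L x (seq.rot i om).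
  have R1 u u' om' : u \in D -> u' \in D ->
      rooted_count root L u om' = rooted_count root L u' (seq.rot 1 om').
    by move=> uD u'D; apply: (count_rot Linv rootD root_trans).
  have Ri j u : u \in D -> rooted_count root L u (seq.rot j om) = rooted_count root L x om.
    case: (leqP j (size om)) => [|oj] ; last first.
      by rewrite rot_oversize 1?ltnW // => uD; apply: (count_const Linv root_trans).
    elim: j u => [|j IH] u joj uD; first by rewrite rot0; apply: (count_const Linv root_trans).
    by rewrite -addn1 addnC rotD ?add1n // -(R1 x) // IH // ltnW.
  rewrite Ri // (count_const Linv root_trans om xD (rootD cH)).
  by apply/card_gt0P; exists c; rewrite inE cH !eqxx.
pose A := [set h in heps G | root h == x].
pose A' := [set h : 7.-tuple G in A | word L h \in [seq seq.rot i om | i <- iota 0 7]].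
have A'A : #|A'| <= #|A| by apply/subset_leq_card/subsetP => h; rewrite inE => /andP[].
apply: leq_trans A'A; rewrite (card_by_label (f := fun h : 7.-tuple G => word L h) uO); last first.
  by move=> h; rewrite inE => /andP[].
apply: (@leq_trans (\sum_(w <- [seq seq.rot i om | i <- iota 0 7]) 1)).
  by rewrite sum1_size size_map size_iota.
rewrite !big_seq; apply: leq_sum => w wI; have [i iI wE] := mapP wI.
rewrite wE; apply: leq_trans (pos i) _.
apply/subset_leq_card/subsetP => h /setIdP[hH /andP[/eqP wh rh]].
rewrite inE; apply/andP; split; last by rewrite wh.
by rewrite inE; apply/andP; split; [rewrite inE hH | rewrite wh -wE].
Qed.
End Seven.

Section ArcTransitive.
Variable G : vtGraph7.
Local Notation e := (@adj G).
Hypothesis at2 : arc_transitive G.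
Implicit Types (a b c d p q r v w : G) (s : {perm G}).

Lemma arc_to v a w b : e v a -> e w b -> exists2 s, s \in graph_aut e & s v = w /\ s a = b.
Proof.
move=> va wb; have [s sA sv] := aut_to v w.
have wa : e w (s a) by rewrite -sv autE.
have [t [tA tw ta]] := at2 wa wb.
by exists (s * t)%g; rewrite ?groupM // !permM sv.
Qed.

Lemma thru2_const v a w b : e v a -> e w b -> thru [:: v; a] = thru [:: w; b].
Proof. by move=> va wb; have [s sA [<- <-]] := arc_to va wb; rewrite (thru_aut [:: v; a] sA). Qed.

Lemma thru3_sum a b c c' : e b a -> e b c -> e b c' -> a != c -> a != c' -> c != c' ->
  thru [:: a; b] = thru [:: a; b; c] + thru [:: a; b; c'].
Proof.
move=> ba bc bc' ac ac' cc'; apply: thru2 => // y; apply/idP/or3P.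
  by case/(adj_cases ba bc bc' ac ac' cc') => ->; [constructor 1|constructor 2|constructor 3].
by case=> /eqP->.
Qed.

(** The three 2-arcs centred at b have pairwise equal sums, hence are in
    equally many heptagons. *)
Lemma thru3_half a b c : e a b -> e b c -> a != c -> thru [:: a; b] = 2 * thru [:: a; b; c].
Proof.
move=> ab bc ac; have ba : e b a by rewrite adj_sym.
have [bd da dc _] := thirdP ba bc ac; set d := third b a c in bd da dc.
have ad : a != d by rewrite eq_sym.
have cd : c != d by rewrite eq_sym.
have ca : c != a by rewrite eq_sym.
have := thru3_sum ba bc bd ac ad cd.
have := thru3_sum bc ba bd ca cd ad.
have := thru3_sum bd ba bc da dc ac.
rewrite (thru3_sym d b a) (thru3_sym d b c) (thru3_sym c b a).
have cb : e c b by rewrite adj_sym.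
have db : e d b by rewrite adj_sym.
rewrite (thru2_const db ab) (thru2_const cb ab).
move: (thru [:: a; b]) (thru [:: a; b; c]) (thru [:: a; b; d]) (thru [:: c; b; d]).
by clear; lia.
Qed.

Lemma thru3_const a b c a' b' c' : e a b -> e b c -> a != c -> e a' b' -> e b' c' -> a' != c' ->
  thru [:: a; b; c] = thru [:: a'; b'; c'].
Proof.
move=> ab bc ac ab' bc' ac'; have := thru3_half ab bc ac; have := thru3_half ab' bc' ac'.
rewrite (thru2_const ab ab'); move: (thru [:: a'; b']) (thru [:: a; b; c]) (thru [:: a'; b'; c']).
by clear; lia.
Qed.

Definition root2 (h : 7.-tuple G) : G * G := (nth (thead h) h 0, nth (thead h) h 1).
Definition arcs := [set p : G * G | e p.1 p.2].

Lemma root2D (h : 7.-tuple G) : h \in heps G -> root2 h \in arcs.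
Proof.
have [a [b [c [d [x [y [z ->]]]]]]] := tuple7P h.
by rewrite in_heps heptE inE => /andP[].
Qed.

Lemma root2_trans (p q : G * G) : p \in arcs -> q \in arcs ->
  exists2 s, s \in graph_aut e & forall h : 7.-tuple G, root2 h = p -> root2 (mapH s h) = q.
Proof.
case: p q => [a b] [a' b']; rewrite !inE /= => ab ab'.
have [s sA [sa sb]] := arc_to ab ab'; exists s => // h.
have [a1 [b1 [c [d [x [y [z ->]]]]]]] := tuple7P h.
by rewrite /root2 /= => -[E1 E2]; rewrite -sa -sb -E1 -E2.
Qed.

Definition root3 (h : 7.-tuple G) : G * G * G := (root2 h, nth (thead h) h 2).
Definition arcs2 := [set p : G * G * G | [&& e p.1.1 p.1.2, e p.1.2 p.2 & p.1.1 != p.2]].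

Lemma root3D (h : 7.-tuple G) : h \in heps G -> root3 h \in arcs2.
Proof.
have [a [b [c [d [x [y [z ->]]]]]]] := tuple7P h.
by rewrite in_heps heptE inE => /and5P[-> -> _ _ /and5P[_ _ _ -> _]].
Qed.

Lemma thru_root2 a b : thru [:: a; b] = #|[set h in heps G | root2 h == (a, b)]|.
Proof.
apply: eq_card => h; have [a1 [b1 [c [d [x [y [z ->]]]]]]] := tuple7P h.
by rewrite !inE /root2 /= xpair_eqE andbT (eq_sym a) (eq_sym b).
Qed.

Lemma thru_root3 a b c : thru [:: a; b; c] = #|[set h in heps G | root3 h == (a, b, c)]|.
Proof.
apply: eq_card => h; have [a1 [b1 [c1 [d [x [y [z ->]]]]]]] := tuple7P h.
rewrite !inE /root3 /root2 /= !xpair_eqE andbT -andbA (eq_sym a) (eq_sym b) (eq_sym c).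
by rewrite andbA.
Qed.

Definition two_arc_transitive := forall a b c c', e a b -> e b c -> e b c' -> a != c -> a != c' ->
  exists s, [/\ s \in graph_aut e, s a = a, s b = b & s c = c'].

(** Four heptagons through one 2-arc, hence through all of them, would put
    every 4-arc on a heptagon. *)
Lemma thru3_bound a b c : thru [:: a; b; c] = 4 -> e a b -> e b c -> a != c -> False.
Proof.
move=> F ab bc ac; apply: (@no_moore G) => a1 b1 c1 d1 x1 ab1 bc1 cd1 dx1 ac1 bd1 cx1.
apply: thru3_full; rewrite // -F; exact: thru3_const.
Qed.

Lemma thru3_pos a b c : e a b -> e b c -> a != c -> 0 < thru [:: a; b; c].
Proof.
move=> ab bc ac; have [a0 [b0 [c0 [d0 [x0 [y0 [z0 H0]]]]]]] := hept_ex G.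
have := H0; rewrite heptE => /and5P[ab0 bc0 cd0 dx0 /and5P[xy0 yz0 za0 ac0 _]].
rewrite (thru3_const ab bc ac ab0 bc0 ac0); apply/card_gt0P.
by exists [tuple a0; b0; c0; d0; x0; y0; z0]; rewrite inE in_heps H0 /= !eqxx.
Qed.

(** If the two continuations of an arc are not equivalent, let the letter
    of a 2-arc tell which of the two orbits contains it. A heptagon whose
    word is not constant would entail seven heptagons through each arc,
    hence four through each 2-arc, which is excluded. So every heptagon
    always turns the same way, and is determined by its first 2-arc. *)
Lemma turns_constant : (forall a b c, e a b -> e b c -> a != c -> thru [:: a; b; c] = 1) \/ two_arc_transitive.
Proof.
pose P (q : G * G * G * G) := [exists s in graph_aut e,
  [&& s q.1.1.1 == q.1.1.1, s q.1.1.2 == q.1.1.2 & s q.1.2 == q.2]].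
pose C (q : G * G * G * G) := [&& e q.1.1.1 q.1.1.2, e q.1.1.2 q.1.2, e q.1.1.2 q.2, q.1.1.1 != q.1.2 & q.1.1.1 != q.2].
case: (boolP [forall q, C q ==> P q]) => [/forallP H|].
  right=> a b c c' ab bc bc' ac ac'; have := H (a, b, c, c').
  rewrite /C /P /= ab bc bc' ac ac' /= => /exists_inP[s sA /and3P[/eqP sa /eqP sb /eqP sc]].
  by exists s.
case/forallPn=> -[[[a b] c] c']; rewrite negb_imply /C /P /= => /andP[/and5P[ab bc bc' ac ac'] nP].
left; pose L a1 b1 c1 (_ : G) := [exists s in graph_aut e, [&& s a == a1, s b == b1 & s c == c1]].
have LP a1 b1 c1 d1 : reflect (exists2 s, s \in graph_aut e & [/\ s a = a1, s b = b1 & s c = c1]) (L a1 b1 c1 d1).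
  apply: (iffP exists_inP) => -[s sA H]; exists s => //; first by case/and3P: H => /eqP ? /eqP ? /eqP ?.
  by case: H => -> -> ->; rewrite !eqxx.
have Linv : invariant_letter L.
  move=> t a1 b1 c1 d1 tA; apply/LP/LP => -[s sA [sa sb sc]].
    exists (s * t^-1)%g; first by rewrite groupM ?groupV.
    by rewrite !permM sa sb sc !permK.
  by exists (s * t)%g; rewrite ?groupM // !permM sa sb sc.
have Luniq a1 b1 c1 c2 d1 d2 : e a1 b1 -> e b1 c1 -> e b1 c2 -> a1 != c1 -> a1 != c2 ->
    L a1 b1 c1 d1 = L a1 b1 c2 d2 -> c1 = c2.
  move=> ab1 bc1 bc2 ac1 ac2 E; have [s sA [sa sb]] := arc_to ab ab1.
  have Lsc : L a1 b1 (s c) d1 by apply/LP; exists s.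
  have Lsc' : ~~ L a1 b1 (s c') d1.
    apply/negP => /LP[t tA [ta tb tc]]; case/negP: nP; apply/exists_inP; exists (t * s^-1)%g.
      by rewrite groupM ?groupV.
    by rewrite !permM ta tb tc -{1}sa -{1}sb !permK !eqxx.
  have scc : s c != s c' by apply: contraNneq Lsc' => <-.
  have ba1 : e b1 a1 by rewrite adj_sym.
  have bsc : e b1 (s c) by rewrite -sb autE.
  have bsc' : e b1 (s c') by rewrite -sb autE.
  have asc : a1 != s c by rewrite -sa (inj_eq perm_inj).
  have asc' : a1 != s c' by rewrite -sa (inj_eq perm_inj).
  have K y : e b1 y -> a1 != y -> y = s c \/ y = s c'.
    move=> by1 ay; case: (adj_cases ba1 bsc bsc' asc asc' scc by1) => E'; [|by left|by right].
    by rewrite E' eqxx in ay.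
  rewrite /L in E Lsc Lsc'.
  case: (K _ bc1 ac1) (K _ bc2 ac2) E => -> [] -> //.
    by rewrite Lsc (negPf Lsc').
  by rewrite Lsc (negPf Lsc').
have small h : h \in heps G -> (word L h == nseq 7 true) || (word L h == nseq 7 false).
  move=> hH; apply/negPn/negP; rewrite negb_or => /andP[nT nF].
  have := seven_words Linv root2D root2_trans hH (x := (a, b)); rewrite inE /= ab => /(_ isT nT nF).
  rewrite -thru_root2 (thru3_half ab bc ac).
  have := thru3_le a b c; move E: (thru _) => n n4 n3.
  by apply: (thru3_bound _ ab bc ac); rewrite E; clear -n4 n3; lia.
suff le1 : thru [:: a; b; c] <= 1.
  have T1 : thru [:: a; b; c] = 1 by apply/eqP; rewrite eqn_leq le1; apply: thru3_pos.
  by move=> a1 b1 c1 ab1 bc1 ac1; rewrite (thru3_const ab1 bc1 ac1 ab bc ac).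
rewrite leqNgt; apply/negP => /card_gt1P[h [h' [hH hH' nh]]]; case/eqP: nh.
move: hH hH'; have [a1 [b1 [c1 [d1 [x1 [y1 [z1 ->]]]]]]] := tuple7P h.
have [a2 [b2 [c2 [d2 [x2 [y2 [z2 ->]]]]]]] := tuple7P h'.
move=> /setIdP[H1 /and4P[/eqP ? /eqP ? /eqP ? _]] /setIdP[H2 /and4P[/eqP ? /eqP ? /eqP ? _]]; subst a1 b1 c1 a2 b2 c2.
have Labc t : L a b c t by apply/LP; exists 1%g; rewrite ?group1 // !perm1.
have all_true t : t \in heps G -> (nth false (word L t) 0) -> word L t = nseq 7 true.
  by move=> tH; case/orP: (small _ tH) => /eqP ->.
have W1 := all_true _ H1 (Labc d1); have W2 := all_true _ H2 (Labc d2).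
move: W1 W2 => /= [_ l1 l2 _ _ _ _] [_ l1' l2' _ _ _ _].
rewrite !in_heps in H1 H2; have F1 := H1; have F2 := H2.
rewrite heptE in F1; rewrite heptE in F2.
case/and5P: F1 => _ _ cd1 dx1 /and5P[_ _ _ _ /and5P[bd1 cx1 _ _ _]].
case/and5P: F2 => _ _ cd2 dx2 /and5P[_ _ _ _ /and5P[bd2 cx2 _ _ _]].
have dd : d1 = d2 by apply: (Luniq b c d1 d2 x1 x2); rewrite // l1 l1'.
subst d2; have xx : x1 = x2 by apply: (Luniq c d1 x1 x2 y1 y2); rewrite // l2 l2'.
by subst x2; have [-> ->] := hept_arc4 H1 H2.
Qed.

Lemma thru4_sum a b c d d' : e a b -> e c b -> e c d -> e c d' -> b != d -> b != d' -> d != d' ->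
  thru [:: a; b; c] = thru [:: a; b; c; d] + thru [:: a; b; c; d'].
Proof.
move=> ab cb cd cd' bd bd' dd'; apply: thru3 => // y; apply/idP/or3P.
  by case/(adj_cases cb cd cd' bd bd' dd') => ->; [constructor 1|constructor 2|constructor 3].
by case=> /eqP->.
Qed.

Lemma arc2_to a b c a' b' c' : two_arc_transitive -> e a b -> e b c -> a != c -> e a' b' -> e b' c' -> a' != c' ->
  exists2 s, s \in graph_aut e & [/\ s a = a', s b = b' & s c = c'].
Proof.
move=> at3 ab bc ac ab' bc' ac'; have [s sA [sa sb]] := arc_to ab ab'.
have bsc : e b' (s c) by rewrite -sb autE.
have asc : a' != s c by rewrite -sa (inj_eq perm_inj).
have [t [tA ta tb tc]] := at3 _ _ _ _ ab' bsc bc' asc ac'.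
by exists (s * t)%g; rewrite ?groupM // !permM sa sb tc ta tb.
Qed.

Lemma root3_trans (p q : G * G * G) : two_arc_transitive -> p \in arcs2 -> q \in arcs2 ->
  exists2 s, s \in graph_aut e & forall h : 7.-tuple G, root3 h = p -> root3 (mapH s h) = q.
Proof.
move=> at3; case: p q => [[a b] c] [[a' b'] c']; rewrite !inE /= => /and3P[ab bc ac] /and3P[ab' bc' ac'].
have [s sA [sa sb sc]] := arc2_to at3 ab bc ac ab' bc' ac'; exists s => // h.
have [a1 [b1 [c1 [d [x [y [z ->]]]]]]] := tuple7P h.
by rewrite /root3 /root2 /= => -[E1 E2 E3]; rewrite -sa -sb -sc -E1 -E2 -E3.
Qed.

(** For a 2-arc-transitive group, the number k of heptagons through a 2-arc
    is at most 3. If the group is transitive on 3-arcs, then k = 2 with one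
    heptagon through each 3-arc. If it is not, the letters tell the two
    continuations of a 2-arc apart; as seven heptagons do not fit a 2-arc,
    all words are constant, a 3-arc is in at most one heptagon, and k = 1
    or each 3-arc is in exactly one. *)
Lemma arc_transitive_counts :
  (forall a b c, e a b -> e b c -> a != c -> thru [:: a; b; c] = 1) \/
  (forall a b c d, e a b -> e b c -> e c d -> a != c -> b != d -> thru [:: a; b; c; d] = 1).
Proof.
case: turns_constant => [|at3]; [by left|].
have cases a b c d : e a b -> e b c -> e c d -> a != c -> b != d ->
   exists d', [/\ e c d', b != d', d != d' & thru [:: a; b; c] = thru [:: a; b; c; d] + thru [:: a; b; c; d']].
  move=> ab bc cd ac bd; have cb : e c b by rewrite adj_sym.
  have [cd' d'b d'd _] := thirdP cb cd bd; exists (third c b d).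
  have bd' : b != third c b d by rewrite eq_sym.
  have dd' : d != third c b d by rewrite eq_sym.
  by split=> //; apply: thru4_sum.
pose P (q : G * G * G * G * G) := [exists s in graph_aut e,
  [&& s q.1.1.1.1 == q.1.1.1.1, s q.1.1.1.2 == q.1.1.1.2, s q.1.1.2 == q.1.1.2 & s q.1.2 == q.2]].
pose C (q : G * G * G * G * G) := [&& e q.1.1.1.1 q.1.1.1.2, e q.1.1.1.2 q.1.1.2, e q.1.1.2 q.1.2, e q.1.1.2 q.2 &
  [&& q.1.1.1.1 != q.1.1.2, q.1.1.1.2 != q.1.2 & q.1.1.1.2 != q.2]].
case: (boolP [forall q, C q ==> P q]) => [/forallP H|].
  right=> a b c d ab bc cd ac bd; have [d' [cd' bd' dd' E]] := cases _ _ _ _ ab bc cd ac bd.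
  have := H (a, b, c, d, d'); rewrite /C /P /= ab bc cd cd' ac bd bd' /=.
  case/exists_inP=> s sA /and4P[/eqP sa /eqP sb /eqP sc /eqP sd].
  have E' : thru [:: a; b; c; d] = thru [:: a; b; c; d'].
    by rewrite -{2}sa -{2}sb -{2}sc -sd (thru_aut [:: a; b; c; d] sA).
  have := thru3_le a b c; have := thru3_pos ab bc ac; have := @thru3_bound a b c.
  rewrite E -E'; case: (thru [:: a; b; c; d]) => [|[|[|n]]] //.
    by move=> /(_ erefl ab bc ac).
  by move=> _ _; clear; lia.
case/forallPn=> -[[[[a b] c] d] d']; rewrite negb_imply /C /P /=.
move=> /andP[/and5P[ab bc cd cd' /and3P[ac bd bd']] nP].
pose L a1 b1 c1 d1 := [exists s in graph_aut e, [&& s a == a1, s b == b1, s c == c1 & s d == d1]].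
have LP a1 b1 c1 d1 : reflect (exists2 s, s \in graph_aut e & [/\ s a = a1, s b = b1, s c = c1 & s d = d1]) (L a1 b1 c1 d1).
  apply: (iffP exists_inP) => -[s sA H]; exists s => //; first by case/and4P: H => /eqP ? /eqP ? /eqP ? /eqP ?.
  by case: H => -> -> -> ->; rewrite !eqxx.
have Linv : invariant_letter L.
  move=> t a1 b1 c1 d1 tA; apply/LP/LP => -[s sA [sa sb sc sd]].
    exists (s * t^-1)%g; first by rewrite groupM ?groupV.
    by rewrite !permM sa sb sc sd !permK.
  by exists (s * t)%g; rewrite ?groupM // !permM sa sb sc sd.
have Luniq a1 b1 c1 d1 d2 : e a1 b1 -> e b1 c1 -> a1 != c1 -> e c1 d1 -> e c1 d2 -> b1 != d1 -> b1 != d2 ->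
    L a1 b1 c1 d1 = L a1 b1 c1 d2 -> d1 = d2.
  move=> ab1 bc1 ac1 cd1 cd2 bd1 bd2 E; have [s sA [sa sb sc]] := arc2_to at3 ab bc ac ab1 bc1 ac1.
  have Lsd : L a1 b1 c1 (s d) by apply/LP; exists s.
  have Lsd' : ~~ L a1 b1 c1 (s d').
    apply/negP => /LP[t tA [ta tb tc td]]; case/negP: nP; apply/exists_inP; exists (t * s^-1)%g.
      by rewrite groupM ?groupV.
    by rewrite !permM ta tb tc td -{1}sa -{1}sb -{1}sc !permK !eqxx.
  have sdd : s d != s d' by apply: contraNneq Lsd' => <-.
  have cb1 : e c1 b1 by rewrite adj_sym.
  have csd : e c1 (s d) by rewrite -sc autE.
  have csd' : e c1 (s d') by rewrite -sc autE.
  have bsd : b1 != s d by rewrite -sb (inj_eq perm_inj).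
  have bsd' : b1 != s d' by rewrite -sb (inj_eq perm_inj).
  have K y : e c1 y -> b1 != y -> y = s d \/ y = s d'.
    move=> by1 ay; case: (adj_cases cb1 csd csd' bsd bsd' sdd by1) => E'; [|by left|by right].
    by rewrite E' eqxx in ay.
  case: (K _ cd1 bd1) (K _ cd2 bd2) E => -> [] -> //.
    by rewrite Lsd (negPf Lsd').
  by rewrite Lsd (negPf Lsd').
have small h : h \in heps G -> (word L h == nseq 7 true) || (word L h == nseq 7 false).
  move=> hH; apply/negPn/negP; rewrite negb_or => /andP[nT nF].
  have T3 (p q : G * G * G) (pD : p \in arcs2) (qD : q \in arcs2) := root3_trans at3 pD qD.
  have := seven_words Linv root3D T3 hH (x := (a, b, c)); rewrite inE /= ab bc ac => /(_ isT nT nF).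
  by rewrite -thru_root3 ltnNge (leq_trans (thru3_le a b c)).
have le1 a1 b1 c1 d1 : e a1 b1 -> e b1 c1 -> e c1 d1 -> a1 != c1 -> b1 != d1 -> thru [:: a1; b1; c1; d1] <= 1.
  move=> ab1 bc1 cd1 ac1 bd1; rewrite leqNgt; apply/negP => /card_gt1P[h [h' [hH hH' nh]]]; case/eqP: nh.
  move: hH hH'; have [a2 [b2 [c2 [d2 [x2 [y2 [z2 ->]]]]]]] := tuple7P h.
  have [a3 [b3 [c3 [d3 [x3 [y3 [z3 ->]]]]]]] := tuple7P h'.
  move=> /setIdP[H1 /and5P[/eqP ? /eqP ? /eqP ? /eqP ? _]].
  move=> /setIdP[H2 /and5P[/eqP ? /eqP ? /eqP ? /eqP ? _]]; subst a2 b2 c2 d2 a3 b3 c3 d3.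
  have EL : L b1 c1 d1 x2 = L b1 c1 d1 x3.
    have C1 t : t \in heps G -> nth false (word L t) 0 = nth false (word L t) 1.
      by move=> tH; case/orP: (small _ tH) => /eqP ->.
    have := C1 _ H1; have := C1 _ H2; rewrite /= => <- <-; by [].
  rewrite !in_heps in H1 H2; have F1 := H1; have F2 := H2.
  rewrite heptE in F1; rewrite heptE in F2.
  case/and5P: F1 => _ _ _ dx1 /and5P[_ _ _ _ /and5P[_ cx1 _ _ _]].
  case/and5P: F2 => _ _ _ dx2 /and5P[_ _ _ _ /and5P[_ cx2 _ _ _]].
  have xx : x2 = x3 by apply: (Luniq b1 c1 d1 x2 x3).
  by subst x3; have [-> ->] := hept_arc4 H1 H2.
have := thru3_pos ab bc ac; case: (ltngtP (thru [:: a; b; c]) 1) => //; last first.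
  move=> T1 _; left=> a1 b1 c1 ab1 bc1 ac1.
  by rewrite (thru3_const ab1 bc1 ac1 ab bc ac).
move=> T2 _; right=> a1 b1 c1 d1 ab1 bc1 cd1 ac1 bd1.
have [d2 [cd2 bd2 dd2 E]] := cases _ _ _ _ ab1 bc1 cd1 ac1 bd1.
rewrite (thru3_const ab bc ac ab1 bc1 ac1) E in T2.
have := le1 _ _ _ _ ab1 bc1 cd1 ac1 bd1; have := le1 _ _ _ _ ab1 bc1 cd2 ac1 bd2.
by move: T2; clear; lia.
Qed.
End ArcTransitive.

(** * One heptagon through every 2-arc: rotary maps *)

Section FaceAut.
Variable G : vtGraph7.
Local Notation e := (@adj G).
Implicit Types (a b c d x y z t u v w p q r o : G) (s g : {perm G}) (F : {set {set G}}).

Lemma hept_uniq a b c d x y z : hept a b c d x y z -> uniq [:: a; b; c; d; x; y; z].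
Proof. by case/andP. Qed.

Lemma face_aut s a b c d x y z : s \in graph_aut e -> hept a b c d x y z ->
  ('P^*^*)%act (face a b c d x y z) s = face (s a) (s b) (s c) (s d) (s x) (s y) (s z).
Proof.
move=> sA H; have K := H; rewrite -(hept_aut _ _ _ _ _ _ _ sA) in K.
have sE p q : ('P^*)%act [set p; q] s = [set s p; s q].
  by rewrite /= /setact imsetU !imset_set1.
apply/setP => E; rewrite (in_face _ K) [LHS]/=; apply/imsetP/idP => [[E']|].
  by rewrite (in_face _ H) => + ->; do 6?case/orP; move/eqP=> ->; rewrite sE eqxx ?orbT.
do 6?case/orP; move/eqP=> ->.
- by exists [set a; b]; rewrite ?(in_face _ H) ?eqxx ?orbT ?sE.
- by exists [set b; c]; rewrite ?(in_face _ H) ?eqxx ?orbT ?sE.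
- by exists [set c; d]; rewrite ?(in_face _ H) ?eqxx ?orbT ?sE.
- by exists [set d; x]; rewrite ?(in_face _ H) ?eqxx ?orbT ?sE.
- by exists [set x; y]; rewrite ?(in_face _ H) ?eqxx ?orbT ?sE.
- by exists [set y; z]; rewrite ?(in_face _ H) ?eqxx ?orbT ?sE.
- by exists [set z; a]; rewrite ?(in_face _ H) ?eqxx ?orbT ?sE.
Qed.

Lemma card_face a b c d x y z : hept a b c d x y z -> #|face a b c d x y z| = 7.
Proof.
move=> H; pose L : seq {set G} :=
  [:: [set a; b]; [set b; c]; [set c; d]; [set d; x]; [set x; y]; [set y; z]; [set z; a]].
transitivity #|L|; first by apply: eq_card => E; rewrite (in_face _ H) !inE.
rewrite (card_uniqP _) // /L.
have PN p q r o : (p != r) || (q != o) -> (p != o) || (q != r) -> [set p; q] != [set r; o].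
  by move=> h1 h2; apply/eqP => /pair_eq[[E1 E2]|[E1 E2]]; rewrite E1 E2 !eqxx in h1 h2.
have := hept_uniq H; rewrite /= !inE !negb_or => /andP[/and5P[ab ac ad ax /andP[ay az]]].
case/and5P=> /and5P[bc bd bx by_ bz] /and4P[cd cx cy cz] /and3P[dx dy dz] /andP[xy xz] /andP[yz _].
repeat (apply/andP; split); (try apply: PN); rewrite ?ab ?ac ?ad ?ax ?ay ?az ?bc ?bd ?bx ?by_ ?bz ?cd ?cx ?cy ?cz ?dx ?dy ?dz ?xy ?xz ?yz ?orbT //.
by rewrite eq_sym ay.
Qed.

Lemma face_cover a b c d x y z t : hept a b c d x y z ->
  (t \in cover (face a b c d x y z)) = (t \in [:: a; b; c; d; x; y; z]).
Proof.
move=> H; apply/bigcupP/idP => [[E]|].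
  rewrite (in_face _ H) => + tE; do 6?case/orP; move/eqP=> EE; move: tE; rewrite EE !inE;
   by case/orP=> ->; rewrite ?orbT.
rewrite !inE; do 6?case/orP; move/eqP=> ->.
- by exists [set a; b]; rewrite ?(in_face _ H) ?eqxx ?orbT ?set21.
- by exists [set b; c]; rewrite ?(in_face _ H) ?eqxx ?orbT ?set21.
- by exists [set c; d]; rewrite ?(in_face _ H) ?eqxx ?orbT ?set21.
- by exists [set d; x]; rewrite ?(in_face _ H) ?eqxx ?orbT ?set21.
- by exists [set x; y]; rewrite ?(in_face _ H) ?eqxx ?orbT ?set21.
- by exists [set y; z]; rewrite ?(in_face _ H) ?eqxx ?orbT ?set21.
- by exists [set z; a]; rewrite ?(in_face _ H) ?eqxx ?orbT ?set21.
Qed.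
End FaceAut.

Section Map.
Variable G : vtGraph7.
Local Notation e := (@adj G).
Implicit Types (a b c d x y z t u v w p q r o : G) (s g : {perm G}) (F : {set {set G}}).
Hypothesis at2 : arc_transitive G.
Hypothesis U2 : forall a b c, e a b -> e b c -> a != c -> thru [:: a; b; c] = 1.

Definition faces : {set {set {set G}}} := [set F | kcycle e 7 F].

Lemma map_autE s : s \in graph_aut e -> s \in map_aut e faces.
Proof.
move=> sA; rewrite inE sA !inE; apply/subsetP => F; rewrite !inE => /kcycle7P[a [b [c [d [x [y [z [H ->]]]]]]]].
by rewrite (face_aut sA H); apply/kcycle7P; do 7!eexists; split; last reflexivity; rewrite hept_aut.
Qed.

Lemma faces_at v w : e v w -> thru [:: v; w] = 2.
Proof.
move=> vw; have wv : e w v by rewrite adj_sym.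
have [c [d [vc vd cd N]]] := nbr_split wv.
by rewrite (thru2 cd vc vd N) !U2 // N eqxx ?orbT.
Qed.

Lemma faces_cubic_map : cubic_map e faces.
Proof.
split; first exact: adj_cubic.
  by move=> F; rewrite inE => H; exists 7.
move=> _ /imsetP[[v w]] /[!inE] /= vw ->; rewrite -(faces_at vw) -girth_through /girth_cycles_through adj_girth.
by apply: eq_card => F; rewrite !inE.
Qed.

Lemma card_edges_at v : #|edges_at e v| = 3.
Proof.
rewrite -(adj_cubic v) -(card_in_imset (f := fun w => [set v; w])); last first.
  by move=> w w' _ _ /pair_eq[[]|[-> ->]].
apply: eq_card => E; rewrite edges_atE; apply/existsP/imsetP => [[w /andP[vw /eqP ->]]|[w]].
  by exists w; rewrite ?inE.
by rewrite inE => vw ->; exists w; rewrite vw eqxx.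
Qed.

Lemma card_edges : 2 * #|edges e| = 3 * #|G|.
Proof.
have -> : 3 * #|G| = \sum_v \sum_(E in edges e) (v \in E).
  transitivity (\sum_(v : G) 3); first by rewrite sum_nat_const mulnC.
  apply: eq_bigr => v _.
  rewrite -(card_edges_at v) -sum1_card [LHS]big_mkcond [RHS]big_mkcond; apply: eq_bigr => E _.
  by rewrite inE; case: (E \in edges e); case: (v \in E).
rewrite exchange_big /=; transitivity (\sum_(E in edges e) 2); first by rewrite sum_nat_const mulnC.
apply: eq_bigr => E /imsetP[[v w]]; rewrite inE /= => vw ->.
transitivity #|[set v; w]|; first by rewrite cards2 (adj_neq vw).
by rewrite -sum1_card [LHS]big_mkcond; apply: eq_bigr => t _; case: (t \in _).
Qed.

Lemma card_faces : 7 * #|faces| = 2 * #|edges e|.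
Proof.
have -> : 7 * #|faces| = \sum_(F in faces) \sum_(E in edges e) (E \in F).
  transitivity (\sum_(F in faces) 7); first by rewrite sum_nat_const mulnC.
  apply: eq_bigr => F; rewrite inE => /kcycle7P[a [b [c [d [x [y [z [H ->]]]]]]]].
  rewrite -(card_face H) -sum1_card [LHS]big_mkcond [RHS]big_mkcond; apply: eq_bigr => E _.
  have EE : E \in face a b c d x y z -> E \in edges e.
    rewrite (in_face _ H); move: H; rewrite heptE => /and5P[ab bc cd dx /and5P[xy yz za _ _]].
    by do 6?case/orP; move/eqP=> ->; rewrite edge_mem.
  by case: (boolP (E \in face a b c d x y z)) => [/EE ->|_] //; case: ifP.
rewrite exchange_big /=; transitivity (\sum_(E in edges e) 2); last by rewrite sum_nat_const mulnC.
apply: eq_bigr => E EE.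
have [_ _ H] := faces_cubic_map; rewrite -(H _ EE) -sum1_card [LHS]big_mkcond [RHS]big_mkcond.
by apply: eq_bigr => F _; rewrite [F \in [set _ in _ | _]]inE; case: (F \in faces); case: (E \in F).
Qed.

Lemma faces_euler : ((euler_char e faces)%:~R = #|G|%:R * (3 / 7 - 1 / 2) :> rat)%R.
Proof.
have := card_faces; have := card_edges; rewrite /euler_char.
move: #|edges e| #|faces| #|G| => m f n E1 E2.
have {}E1 : (2 * m%:R = 3 * n%:R :> rat)%R by rewrite -!GRing.natrM E1.
have {}E2 : (7 * f%:R = 2 * m%:R :> rat)%R by rewrite -!GRing.natrM E2.
rewrite GRing.rmorphD GRing.rmorphB /= -[(n%:Z)%:~R%R]/(n%:R)%R -[(m%:Z)%:~R%R]/(m%:R)%R -[(f%:Z)%:~R%R]/(f%:R)%R.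
lra.
Qed.

(** A transitive group of permutations of three points contains a 3-cycle. *)
Lemma vertex_rotation v : exists g a b c, [/\ g \in graph_aut e, g v = v, g a = b & g b = c] /\
  forall w, e v w = [|| w == a, w == b | w == c].
Proof.
have [a [b [c [ab ac bc N]]]] := nbr_enum v.
have va : e v a by rewrite N eqxx. have vb : e v b by rewrite N eqxx orbT.
have vc : e v c by rewrite N eqxx !orbT.
have [s [sA sv sa]] := at2 va vb; have [t [tA tv tb]] := at2 vb vc.
have im g w : g \in graph_aut e -> g v = v -> e v w -> [|| g w == a, g w == b | g w == c].
  by move=> gA gv vw; rewrite -N -{1}gv (autE _ _ gA).
have sbn : s b != b by rewrite -{2}sa (inj_eq perm_inj) eq_sym.
have := im s b sA sv vb; rewrite (negbTE sbn) /=.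
case/orP=> /eqP sb; last by exists s, a, b, c.
have tcn : t c != c by rewrite -{2}tb (inj_eq perm_inj) eq_sym.
have := im t c tA tv vc; rewrite (negbTE tcn) orbF.
case/orP=> /eqP tc; first by exists t, b, c, a; split=> // w; rewrite N orbC -orbA.
(* The remaining case of two transpositions, whose product is a 3-cycle. *)
exists (s * t)%g, a, c, b; split; last by move=> w; rewrite N; congr (_ || _); rewrite orbC.
have sc : s c = c.
  have sca : s c != a by rewrite -sb (inj_eq perm_inj) eq_sym.
  have scb : s c != b by rewrite -sa (inj_eq perm_inj) eq_sym.
  by have := im s c sA sv vc; rewrite (negbTE sca) (negbTE scb) => /eqP.
by split; rewrite ?groupM ?permM ?sv ?sa ?sc.
Qed.

(** By arc-transitivity the 2-arcs fall into at most two orbits, told apart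
    by a boolean. *)
Lemma two_arc_classes : exists k : G -> G -> G -> bool, forall a b c d x y,
  e a b -> e b c -> a != c -> e d x -> e x y -> d != y -> k a b c = k d x y ->
  exists g, [/\ g \in graph_aut e, g a = d, g b = x & g c = y].
Proof.
have [v0 _] := hept_ex G; have [a0 [b0 [d0 [_ _ _ N]]]] := nbr_enum v0.
have a0v : e a0 v0 by rewrite adj_sym N eqxx.
have v0a : e v0 a0 by rewrite adj_sym.
have [c0 [c1 [vc0 vc1 cc Nb]]] := nbr_split a0v.
exists (fun a b c => [exists s, [&& s \in graph_aut e, s a == v0, s b == a0 & s c == c0]]).
move=> a b c d x y ab bc ac dx xy dy kE.
have [s sA [sa sb]] := arc_to at2 ab v0a; have [t tA [td tx]] := arc_to at2 dx v0a.
have comp s' g' : s' \in graph_aut e -> g' \in graph_aut e -> s' a = g' d -> s' b = g' x -> s' c = g' y ->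
    exists g, [/\ g \in graph_aut e, g a = d, g b = x & g c = y].
  move=> s'A g'A Ea Eb Ec; exists (s' * g'^-1)%g; rewrite groupM ?groupV //.
  by split; rewrite // permM ?Ea ?Eb ?Ec permK.
have [/existsP[s' /and4P[s'A /eqP sa' /eqP sb' /eqP sc']]|no] := boolP [exists s, [&& s \in graph_aut e, s a == v0, s b == a0 & s c == c0]].
  move: kE; have -> : [exists s, [&& s \in graph_aut e, s a == v0, s b == a0 & s c == c0]].
    by apply/existsP; exists s'; rewrite s'A sa' sb' sc' !eqxx.
  case/esym/existsP=> t' /and4P[t'A /eqP ta' /eqP tb' /eqP tc'].
  by apply: (comp s' t'); rewrite // ?sa' ?sb' ?sc'.
move: kE; rewrite (negbTE no) => /esym/negbT no'.
have third1 g u1 u2 u3 : g \in graph_aut e -> g u1 = v0 -> g u2 = a0 -> e u2 u3 -> u1 != u3 ->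
    ~~ [exists s, [&& s \in graph_aut e, s u1 == v0, s u2 == a0 & s u3 == c0]] -> g u3 = c1.
  move=> gA g1 g2 u23 u13 /existsPn/(_ g); rewrite gA g1 g2 !eqxx /= => n0.
  have := u23; rewrite -(autE _ _ gA) g2 Nb (negbTE n0) -g1 (inj_eq perm_inj) eq_sym (negbTE u13).
  by move/eqP.
apply: (comp s t); rewrite ?sa ?sb //.
by rewrite (third1 s a b c) // (third1 t d x y).
Qed.

(** The seven 2-arcs of the heptagon carry at most two colours and seven is
    odd, so two consecutive 2-arcs have the same colour. An automorphism
    that maps one to the next rotates the only heptagon through them. *)
Lemma face_rotation a b c d x y z : hept a b c d x y z -> exists g,
  [/\ g \in graph_aut e, g a = b, g b = c, g c = d & [/\ g d = x, g x = y, g y = z & g z = a]].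
Proof.
have [k kP] := two_arc_classes.
have step a1 b1 c1 d1 x1 y1 z1 : hept a1 b1 c1 d1 x1 y1 z1 -> k a1 b1 c1 = k b1 c1 d1 ->
  exists g, [/\ g \in graph_aut e, g a1 = b1, g b1 = c1, g c1 = d1 & [/\ g d1 = x1, g x1 = y1, g y1 = z1 & g z1 = a1]].
  move=> H kE; have := H; rewrite heptE => /and5P[ab bc cd _ /and5P[_ _ _ ac /andP[bd _]]].
  have [g [gA ga gb gc]] := kP _ _ _ _ _ _ ab bc ac bc cd bd kE.
  exists g; have := H; rewrite -(hept_aut _ _ _ _ _ _ _ gA) ga gb gc => H'.
  have K := hept_rot H; have /eqP/cards1P[h hE] := U2 bc cd bd.
  have h1 : [tuple b1; c1; d1; g d1; g x1; g y1; g z1] \in [set h].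
    by rewrite -hE; apply/setIdP; split; [rewrite in_heps | rewrite /= !eqxx].
  have h2 : [tuple b1; c1; d1; x1; y1; z1; a1] \in [set h].
    by rewrite -hE; apply/setIdP; split; [rewrite in_heps | rewrite /= !eqxx].
  move: h1 h2; rewrite !in_set1 => /eqP <- /eqP/(congr1 val)[-> -> -> ->].
  by split.
move=> H; have H1 := hept_rot H; have H2 := hept_rot H1; have H3 := hept_rot H2.
have H4 := hept_rot H3; have H5 := hept_rot H4; have H6 := hept_rot H5.
have [E|n0] := eqVneq (k a b c) (k b c d); first exact: step H E.
have [E|n1] := eqVneq (k b c d) (k c d x).
  by have [g [? ? ? ? [? ? ? ?]]] := step _ _ _ _ _ _ _ H1 E; exists g.
have [E|n2] := eqVneq (k c d x) (k d x y).
  by have [g [? ? ? ? [? ? ? ?]]] := step _ _ _ _ _ _ _ H2 E; exists g.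
have [E|n3] := eqVneq (k d x y) (k x y z).
  by have [g [? ? ? ? [? ? ? ?]]] := step _ _ _ _ _ _ _ H3 E; exists g.
have [E|n4] := eqVneq (k x y z) (k y z a).
  by have [g [? ? ? ? [? ? ? ?]]] := step _ _ _ _ _ _ _ H4 E; exists g.
have [E|n5] := eqVneq (k y z a) (k z a b).
  by have [g [? ? ? ? [? ? ? ?]]] := step _ _ _ _ _ _ _ H5 E; exists g.
have [E|n6] := eqVneq (k z a b) (k a b c).
  by have [g [? ? ? ? [? ? ? ?]]] := step _ _ _ _ _ _ _ H6 E; exists g.
by move: n0 n1 n2 n3 n4 n5 n6; do 7!case: (k _ _ _).
Qed.

(** Powers of the automorphisms of vertex_rotation and face_rotation. *)
Lemma faces_rotary : rotary e faces.
Proof.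
split=> [v|F].
  have [g [a [b [c [[gA gv ga gb] N]]]]] := vertex_rotation v.
  exists <[g]>%G; split; first exact: cycle_cyclic.
    by rewrite cycle_subG inE map_autE //; apply/astab1P.
  apply/imsetP; exists [set v; a]; first by rewrite edges_atE; apply/existsP; exists a; rewrite N !eqxx.
  apply/setP => E; rewrite edges_atE; apply/existsP/imsetP => [[w /andP[]]|[s]].
    rewrite N => /or3P[]/eqP -> /eqP ->.
    - by exists 1%g; rewrite ?group1 // act1.
    - by exists g; rewrite ?cycle_id //= /setact imsetU !imset_set1 /= /aperm gv ga.
    exists (g ^+ 2)%g; first by rewrite mem_cycle.
    by rewrite actM /= /setact !imsetU !imset_set1 /= /aperm !gv ga gb.
  case/cycleP=> n ->; elim: n E => [|n IH] E.
    by rewrite expg0 act1 => ->; exists a; rewrite N !eqxx.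
  rewrite expgSr actM => ->; have [w /andP[vw /eqP ->]] := IH _ (erefl _).
  exists (g w); rewrite -{1}gv (autE _ _ gA) vw /= /setact imsetU !imset_set1 /= /aperm gv.
  by rewrite eqxx.
rewrite inE => /kcycle7P[a [b [c [d [x [y [z [H ->]]]]]]]].
have [g [gA ga gb gc [gd gx gy gz]]] := face_rotation H.
exists <[g]>%G; split; first exact: cycle_cyclic.
  rewrite cycle_subG inE map_autE //; apply/astab1P.
  by rewrite (face_aut gA H) ga gb gc gd gx gy gz (face_rot H).
apply/imsetP; exists a; first by rewrite (face_cover _ H) inE eqxx.
apply/setP => t; rewrite (face_cover _ H); apply/idP/imsetP => [|[s]].
  have pw n : 'P%act a (g ^+ n)%g = iter n g a.
    by rewrite /= /aperm; elim: n => [|n IH]; rewrite ?expg0 ?perm1 // expgSr permM IH.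
  rewrite !inE; do 6?case/orP; move/eqP=> ->.
  - by exists (g ^+ 0)%g; rewrite ?mem_cycle ?pw.
  - by exists (g ^+ 1)%g; rewrite ?mem_cycle ?pw //= ga.
  - by exists (g ^+ 2)%g; rewrite ?mem_cycle ?pw //= ga gb.
  - by exists (g ^+ 3)%g; rewrite ?mem_cycle ?pw //= ga gb gc.
  - by exists (g ^+ 4)%g; rewrite ?mem_cycle ?pw //= ga gb gc gd.
  - by exists (g ^+ 5)%g; rewrite ?mem_cycle ?pw //= ga gb gc gd gx.
  - by exists (g ^+ 6)%g; rewrite ?mem_cycle ?pw //= ga gb gc gd gx gy.
case/cycleP=> n ->; elim: n t => [|n IH] t; first by rewrite expg0 act1 => ->; rewrite inE eqxx.
rewrite expgSr actM => ->; have := IH _ (erefl _).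
rewrite !inE; do 6?case/orP; move/eqP=> ->; rewrite /= /aperm ?ga ?gb ?gc ?gd ?gx ?gy ?gz eqxx ?orbT //.
Qed.
End Map.

Local Open Scope ring_scope.

(** * One heptagon through every 3-arc *)

Section OnePerThreeArc.
Variable G : vtGraph7.
Local Notation e := (@adj G).
Implicit Types (a b c d p q w x y z t : G) (s : {perm G}) (i j k : int) (v : int -> G).
Hypothesis U3 : forall a b c d, e a b -> e b c -> e c d -> a != c -> b != d -> thru [:: a; b; c; d] = 1%N.

Lemma hept_of_arc3 a b c d : e a b -> e b c -> e c d -> a != c -> b != d -> exists x y z, hept a b c d x y z.
Proof.
move=> ab bc cd ac bd; have : (0 < thru [:: a; b; c; d])%N by rewrite U3.
case/card_gt0P=> h; have [a1 [b1 [c1 [d1 [x1 [y1 [z1 ->]]]]]]] := tuple7P h.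
case/setIdP=> H /and5P[/eqP -> /eqP -> /eqP -> /eqP -> _]; rewrite in_heps in H.
by exists x1, y1, z1.
Qed.

Lemma hept_arc3_uniq a b c d x y z x' y' z' : hept a b c d x y z -> hept a b c d x' y' z' ->
  [/\ x = x', y = y' & z = z'].
Proof.
move=> H H'; have := H; rewrite heptE => /and5P[ab bc cd dx /and5P[_ _ _ ac /andP[bd _]]].
have /eqP/cards1P[h hE] := U3 ab bc cd ac bd.
have : [tuple a; b; c; d; x; y; z] \in [set h].
  by rewrite -hE inE in_heps H /= !eqxx.
have : [tuple a; b; c; d; x'; y'; z'] \in [set h].
  by rewrite -hE inE in_heps H' /= !eqxx.
by rewrite !inE => /eqP <- /eqP /(congr1 val) [-> -> ->].
Qed.

(** A path of five vertices on a heptagon. The end x is determined by the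
    others. *)
Definition hept5 a b c d x := [exists t : G * G, hept a b c d x t.1 t.2].

Lemma hept5P a b c d x : reflect (exists y z, hept a b c d x y z) (hept5 a b c d x).
Proof.
apply: (iffP existsP) => [[[y z] H]|[y [z H]]]; first by exists y, z.
by exists (y, z).
Qed.

Lemma hept5_rev a b c d x : hept5 a b c d x -> hept5 x d c b a.
Proof. by case/hept5P=> y [z /hept_rev/hept_rot/hept_rot/hept_rot H]; apply/hept5P; exists z, y. Qed.

Lemma hept5_uniq a b c d x x' : hept5 a b c d x -> hept5 a b c d x' -> x = x'.
Proof. by case/hept5P=> y [z H] /hept5P[y' [z' H']]; case: (hept_arc3_uniq H H'). Qed.

(** Around w, a heptagon through a neighbour p1 of w and a neighbour q1 of
    p1 goes on to p2 and to some neighbour q2 of p2. Repeating this over p3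
    and back to p1 yields q1 or the other choice; w is flat in the first
    case. By vertex-transitivity all vertices are flat or none is. *)
Definition flat w := [exists t : G * G * G * G * G * G,
  let: (p1, p2, p3, q1, q2, q3) := t in
  [&& uniq [:: p1; p2; p3], hept5 q1 p1 w p2 q2, hept5 q2 p2 w p3 q3 & hept5 q3 p3 w p1 q1]].

Lemma flatP w : reflect (exists p1 p2 p3 q1 q2 q3, [/\ uniq [:: p1; p2; p3], hept5 q1 p1 w p2 q2, hept5 q2 p2 w p3 q3 & hept5 q3 p3 w p1 q1])
  (flat w).
Proof.
apply: (iffP existsP) => [[[[[[[p1 p2] p3] q1] q2] q3] /and4P[*]]|[p1 [p2 [p3 [q1 [q2 [q3 [u1 h1 h2 h3]]]]]]]].
  by exists p1, p2, p3, q1, q2, q3.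
by exists (p1, p2, p3, q1, q2, q3); rewrite u1 h1 h2 h3.
Qed.

Lemma hept5_aut s a b c d x : s \in graph_aut e -> hept5 a b c d x -> hept5 (s a) (s b) (s c) (s d) (s x).
Proof.
by move=> sA /hept5P[y [z H]]; apply/hept5P; exists (s y), (s z); rewrite hept_aut.
Qed.

Lemma flat_aut s w : s \in graph_aut e -> flat w -> flat (s w).
Proof.
move=> sA /flatP[p1 [p2 [p3 [q1 [q2 [q3 [u1 h1 h2 h3]]]]]]]; apply/flatP.
exists (s p1), (s p2), (s p3), (s q1), (s q2), (s q3); split; try exact: hept5_aut.
by rewrite (map_inj_uniq (@perm_inj _ s) [:: p1; p2; p3]).
Qed.

Lemma flat_any w w' : flat w -> flat w'.
Proof. by have [s sA <-] := aut_to w w'; apply: flat_aut. Qed.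

(** The definition does not depend on the order of the neighbours, for
    heptagons may be read backwards. *)
Lemma flat_at w n1 n2 n3 : e w n1 -> e w n2 -> e w n3 -> uniq [:: n1; n2; n3] -> flat w ->
  exists a b c, [/\ hept5 a n1 w n2 b, hept5 b n2 w n3 c & hept5 c n3 w n1 a].
Proof.
move=> e1 e2 e3 /and3P[]; rewrite !inE negb_or => /andP[n12 n13] n23 _.
case/flatP=> p1 [p2 [p3 [q1 [q2 [q3 [/and3P[]]]]]]]; rewrite !inE negb_or => /andP[p12 p13] p23 _ h1 h2 h3.
have ep q p rim p' q' : hept5 q p rim p' q' -> e rim p'.
  by case/hept5P=> y [z]; rewrite heptE => /and3P[_ _ /andP[]].
have ep1 := ep _ _ _ _ _ h3; have ep2 := ep _ _ _ _ _ h1; have ep3 := ep _ _ _ _ _ h2.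
have N := adj_cases e1 e2 e3 n12 n13 n23.
have r1 := hept5_rev h1; have r2 := hept5_rev h2; have r3 := hept5_rev h3.
case: (N _ ep1) => E1; case: (N _ ep2) => E2; case: (N _ ep3) => E3; subst;
  rewrite ?eqxx // in p12 p13 p23 *.
- by exists q1, q2, q3.
- by exists q1, q3, q2.
- by exists q2, q1, q3.
- by exists q3, q1, q2.
- by exists q2, q3, q1.
- by exists q3, q2, q1.
Qed.

Section Cycle.
Variable v : int -> G.
Hypothesis hv : hepcycle v.
Local Notation u := (spoke v).

Let shv i j : i = j -> v i = v j. Proof. by move=> ->. Qed.

Definition tailH a b c d := odflt (a, a, a) [pick t : G * G * G | hept a b c d t.1.1 t.1.2 t.2].

Lemma tailHP a b c d x y z : hept a b c d x y z -> tailH a b c d = (x, y, z).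
Proof.
move=> H; rewrite /tailH; case: pickP => [[[x' y'] z'] /= H'|/(_ (x, y, z))]; last by rewrite H.
by case: (hept_arc3_uniq H H') => -> -> ->.
Qed.

(** The neighbours al i and be i of the spoke u_i lead to u_(i+2) and
    u_(i-2) on the heptagons that follow the cycle for two steps. *)
Definition al i := (tailH (u i) (v i) (v (i + 1)) (v (i + 2))).2.
Definition be i := (tailH (u (i - 2)) (v (i - 2)) (v (i - 1)) (v i)).1.2.

(** After v_(i+2) the heptagon cannot go on along the cycle, since the
    3-arc from v_i to v_(i+3) is on the heptagon v only. *)
Lemma arm_hept i : hept (u i) (v i) (v (i + 1)) (v (i + 2)) (u (i + 2)) (be (i + 2)) (al i).
Proof.
have v02 : v i != v (i + 2) by apply: (hc_neq hv i (n := 2)).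
have [x [y [z H]]] := hept_of_arc3 (spoke_adj hv i) (hc_adj hv i) (hc_adj12 hv i) (spoke_neqR hv i) v02.
have E := tailHP H.
have E2 : be (i + 2) = y.
  rewrite /be addrK; have -> : v (i + 2 - 1) = v (i + 1) by apply: shv; clear; lia.
  by rewrite E.
have xE : x = u (i + 2).
  have := H; rewrite heptE => /and5P[_ _ _ dx /and5P[_ _ _ _ /and3P[_ cx _]]].
  have [_ _ _ /(_ _ dx)] := spokeP hv (i + 2); case=> // xE.
    have {}xE : x = v (i + 3) by rewrite xE; apply: shv; clear; lia.
    have H' := hept_rot H; rewrite xE in H'.
    have [_ _ Z] := hept_arc3_uniq H' (hc_hept hv i).
    have := spoke_neqL hv i; rewrite Z => /eqP[]; apply: (hepcycle_mod (k := 1) hv); clear; lia.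
  have {}xE : x = v (i + 1) by rewrite xE; apply: shv; clear; lia.
  by rewrite xE eqxx in cx.
by rewrite E2 /al E -xE.
Qed.

Lemma al_outer i : outer v (al i) i.
Proof.
have := arm_hept i; rewrite heptE => /and5P[_ _ _ _ /and5P[_ _ za _ /and5P[_ _ _ _ /andP[_ zb]]]].
by rewrite /outer adj_sym za zb.
Qed.

Lemma be_outer i : outer v (be i) i.
Proof.
have := arm_hept (i - 2); rewrite !subrK heptE => /and5P[_ _ _ _ /and5P[xy _ _ _ /and5P[_ _ dy _ _]]].
by rewrite /outer xy eq_sym.
Qed.

Lemma al_be_adj i : e (al i) (be (i + 2)).
Proof. by have := arm_hept i; rewrite heptE => /and5P[_ _ _ _ /and3P[_ yz _]]; rewrite adj_sym. Qed.

Lemma al_mod i j k : i = j + 7 * k -> al i = al j.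
Proof.
move=> E; rewrite /al (spoke_mod hv E) (hepcycle_mod hv E).
have -> : v (i + 1) = v (j + 1) by apply: (hepcycle_mod (k := k) hv); rewrite E; clear; lia.
by have -> : v (i + 2) = v (j + 2) by apply: (hepcycle_mod (k := k) hv); rewrite E; clear; lia.
Qed.

Lemma be_mod i j k : i = j + 7 * k -> be i = be j.
Proof.
move=> E; rewrite /be (hepcycle_mod hv E).
have -> : u (i - 2) = u (j - 2) by apply: (spoke_mod hv (k := k)); rewrite E; clear; lia.
have -> : v (i - 2) = v (j - 2) by apply: (hepcycle_mod (k := k) hv); rewrite E; clear; lia.
by have -> : v (i - 1) = v (j - 1) by apply: (hepcycle_mod (k := k) hv); rewrite E; clear; lia.
Qed.

Lemma outer3 t i j k : outer v t i -> outer v t j -> j = i + 3 + 7 * k -> False.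
Proof.
move=> o1 + E; rewrite (outer_mod hv _ E) => o2.
have H := hc_hept hv i; have N := spoke_vertex hv (i + 3) (i + 4).
suff H' : hept (v i) (v (i + 1)) (v (i + 2)) (v (i + 3)) (u (i + 3)) t (u i).
  by have [Z _ _] := hept_arc3_uniq H H'; rewrite Z eqxx in N.
have := H; rewrite !heptE => /and5P[-> -> -> _ /and5P[_ _ _ -> /andP[-> _]]] /=.
have N3 : u (i + 3) != u i by apply/eqP => /(spoke_eq hv)[m]; clear; lia.
have N0 := spoke_vertex hv i (i + 1); have N2 := spoke_vertex hv (i + 3) (i + 2).
have t3 := outer_vertex hv (i + 3) o1; have t0 := outer_vertex hv i o1.
case/andP: o1 => T1 n1; case/andP: o2 => T2 n2.
by rewrite (spoke_third hv) (spoke_adj hv) T2 adj_sym T1 N0 N3 t0 eq_sym N2 eq_sym t3.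
Qed.

Lemma outer_uniq t i j : outer v t i -> outer v t j -> exists k, i = j + 7 * k.
Proof.
have near i' j' k (n : nat) : outer v t i' -> outer v t j' -> (0 < n <= 3)%N -> j' = i' + n%:Z + 7 * k -> False.
  move=> o1 o2; case: n => [|[|[|[|]]]] // _.
  - exact: (outer_near hv o1 o2 (n := 1)).
  - exact: (outer_near hv o1 o2 (n := 2)).
  exact: outer3 o1 o2.
move=> o1 o2; have [//|[n [k n3 [E|E]]]] := mod7_split i j; first by case: (near _ _ _ _ o1 o2 n3 E).
by case: (near _ _ _ _ o2 o1 n3 E).
Qed.

(** Flatness of v_i compares the heptagon v with the two heptagons that
    share two edges with it at v_i and reach u_i. *)
Lemma flat_outer i : flat (v i) = (al i == be i).
Proof.
have ab1 := arm_hept i; have ab2 := arm_hept (i - 2).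
have [E1 E2] : i - 2 + 1 = i - 1 /\ i - 2 + 2 = i by clear; split; lia.
rewrite E1 E2 in ab2.
have G1 : hept5 (v (i + 2)) (v (i + 1)) (v i) (v (i - 1)) (v (i - 2)).
  apply: hept5_rev; have := hc_hept hv (i - 2); rewrite E1 E2.
  have -> : i - 2 + 3 = i + 1 by clear; lia.
  have -> : i - 2 + 4 = i + 2 by clear; lia.
  by move=> H; apply/hept5P; do 2!eexists; exact: H.
have G2 : hept5 (v (i - 2)) (v (i - 1)) (v i) (u i) (be i).
  by apply/hept5P; do 2!eexists; exact: hept_rot ab2.
have G3 : hept5 (al i) (u i) (v i) (v (i + 1)) (v (i + 2)).
  by apply/hept5P; do 2!eexists; exact/hept_rot/hept_rot/hept_rot/hept_rot/hept_rot/hept_rot/ab1.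
have [S1 S2 _ _] := spokeP hv i; rewrite -/(u i) in S1 S2.
have B := hc_back hv i; have e1 := hc_adj hv i; have e2 := hc_adjV hv i.
apply/idP/eqP => [|E]; last first.
  apply/flatP; exists (v (i + 1)), (v (i - 1)), (u i), (v (i + 2)), (v (i - 2)), (be i).
  split=> //; last by rewrite -E.
  by rewrite /= !inE negb_or B ![_ == u i]eq_sym spoke_neqR // spoke_neqL.
case/(flat_at e1 e2 S1) => [|a [b [c [h1 h2 h3]]]].
  by rewrite /= !inE negb_or B ![_ == u i]eq_sym spoke_neqR // spoke_neqL.
have [E|N] := eqVneq a (v (i + 2)).
  rewrite E in h1 h3; have bE := hept5_uniq h1 G1; rewrite bE in h2.
  by rewrite -(hept5_uniq (hept5_rev h3) (hept5_rev G3)) (hept5_uniq h2 G2).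
have cA : c != al i.
  by apply/eqP => E; rewrite E in h3; rewrite (hept5_uniq h3 G3) eqxx in N.
have cB : c != be i.
  apply/eqP => E; rewrite E in h2.
  have bE := hept5_uniq (hept5_rev h2) (hept5_rev G2); rewrite bE in h1.
  by rewrite (hept5_uniq (hept5_rev h1) (hept5_rev G1)) eqxx in N.
have [uc cv] : e (u i) c /\ v i != c.
  by case/hept5P: h3 => y [z]; rewrite heptE adj_sym => /and5P[-> _ _ _ /and4P[_ _ _ /andP[]]]; rewrite eq_sym.
have [/andP[a1 a2] /andP[b1 b2]] := (al_outer i, be_outer i).
by apply: (third_uniq (spoke_adj hv i) uc cv); rewrite // eq_sym.
Qed.

Hypothesis nf : forall w, ~~ flat w.

(** When be i and al i differ, the heptagon that begins be i, u_i, v_i,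
    v_(i+1) leaves the cycle at once and goes on over u_(i+1) and al (i +
    1). *)
Definition rim i := (tailH (be i) (u i) (v i) (v (i + 1))).2.

Lemma al_be i : al i != be i. Proof. by rewrite -flat_outer. Qed.

Lemma al_neq_be i j : al i != be j.
Proof.
apply/eqP => E; have oa := al_outer i; have ob := be_outer j; rewrite -E in ob.
have [k ij] := outer_uniq oa ob; have := al_be j.
by rewrite -E (al_mod ij) eqxx.
Qed.

Lemma rim_hept i : hept (be i) (u i) (v i) (v (i + 1)) (u (i + 1)) (al (i + 1)) (rim i).
Proof.
have ab := arm_hept i; have := ab.
have [/andP[b1 b2] S] := (be_outer i, spoke_third hv i).
have N := spoke_vertex hv i (i + 1); have A := hc_adj hv i.
rewrite adj_sym in b1; rewrite adj_sym in S.
have [x [y [z H]]] := hept_of_arc3 b1 S A b2 N.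
have zE : z = rim i by rewrite /rim (tailHP H).
have := H; rewrite heptE => /and5P[_ _ _ dx /and5P[xy _ _ _ /and5P[_ cx dy _ _]]] _.
have G3 : hept5 (al i) (u i) (v i) (v (i + 1)) (v (i + 2)).
  by apply/hept5P; do 2!eexists; exact/hept_rot/hept_rot/hept_rot/hept_rot/hept_rot/hept_rot/ab.
have xE : x = u (i + 1).
  have [_ _ _ /(_ _ dx)] := spokeP hv (i + 1).
  have -> : v (i + 1 + 1) = v (i + 2) by apply: shv; clear; lia.
  rewrite addrK; case=> // xE; last by rewrite xE eqxx in cx.
  have Hb : hept5 (be i) (u i) (v i) (v (i + 1)) x by apply/hept5P; exists y, z.
  rewrite xE in Hb.
  by have := al_be i; rewrite (hept5_uniq (hept5_rev G3) (hept5_rev Hb)) eqxx.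
rewrite -zE -xE; suff <- : y = al (i + 1) by [].
rewrite xE in xy H.
have [/andP[a1 a2] /andP[b3 b4]] := (al_outer (i + 1), be_outer (i + 1)).
rewrite eq_sym in dy.
have [] := adj_cases (spoke_adj hv (i + 1)) a1 b3 _ _ (al_be (i + 1)) xy; rewrite 1?eq_sym // => yE.
  by rewrite yE eqxx in dy.
rewrite yE in H; have H1 := arm_hept (i - 1).
have [E1 E2] : i - 1 + 1 = i /\ i - 1 + 2 = i + 1 by clear; split; lia.
rewrite E1 E2 in H1.
have [_ _ F] := hept_arc3_uniq (hept_rot (hept_rot H)) (hept_rot (hept_rot H1)).
by have := spoke_vertex hv i (i - 1); rewrite F eqxx.
Qed.

Lemma rim_be i : e (rim i) (be i).
Proof. by have := rim_hept i; rewrite heptE => /and5P[_ _ _ _ /and3P[_ _ /andP[]]]. Qed.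

Lemma rim_al i : e (rim i) (al (i + 1)).
Proof. by have := rim_hept i; rewrite heptE [e (al _) _]adj_sym => /and5P[_ _ _ _ /and3P[_ ? _]]. Qed.

Lemma al_nbr i t : e (al i) t -> [\/ t = u i, t = be (i + 2) | t = rim (i - 1)].
Proof.
have H := rim_hept (i - 1); have H1 := arm_hept i.
have Ei : i - 1 + 1 = i by clear; lia.
have al1 := al_be_adj i; have al2 := rim_al (i - 1); rewrite Ei in H al2.
have /andP[a1 a2] := al_outer i.
apply: adj_cases => //; try by rewrite adj_sym.
- by rewrite eq_sym; apply: (outer_spoke hv _ (be_outer _)).
- by move: H; rewrite heptE => /and5P[_ _ _ _ /and5P[_ _ _ _ /and5P[_ _ _ H _]]].
apply/eqP => E; rewrite -E in H.
have H4 := hept_rot (hept_rev (hept_rot (hept_rot H1))).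
have [_ _ F] := hept_arc3_uniq (hept_rot (hept_rot (hept_rot H))) H4.
by have := hc_back hv i; rewrite F eqxx.
Qed.

Lemma be_nbr i t : e (be i) t -> [\/ t = u i, t = al (i - 2) | t = rim i].
Proof.
have H := rim_hept i; have H1 := arm_hept (i - 2).
have [E1 E2] : i - 2 + 1 = i - 1 /\ i - 2 + 2 = i by clear; split; lia.
have al1 := al_be_adj (i - 2); have rb := rim_be i; rewrite E2 in al1; rewrite E1 E2 in H1.
have /andP[b1 b2] := be_outer i.
apply: adj_cases => //; try by rewrite adj_sym.
- by rewrite eq_sym; apply: (outer_spoke hv _ (al_outer _)).
- by rewrite eq_sym; move: H; rewrite heptE => /and5P[_ _ _ _ /and5P[_ _ _ _ /and5P[_ _ _ _ /andP[]]]].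
apply/eqP => E; rewrite -E in H.
have H3 := hept_rot (hept_rot (hept_rot (hept_rot (hept_rot (hept_rev H))))).
have [_ _ F] := hept_arc3_uniq (hept_rot (hept_rot (hept_rot H1))) H3.
by have := hc_back hv i; rewrite F eqxx.
Qed.

Lemma al_uniq i j : al i = al j -> exists k, i = j + 7 * k.
Proof. by move=> E; apply: (outer_uniq (al_outer i)); rewrite E; apply: al_outer. Qed.

Lemma be_uniq i j : be i = be j -> exists k, i = j + 7 * k.
Proof. by move=> E; apply: (outer_uniq (be_outer i)); rewrite E; apply: be_outer. Qed.

(** A coincidence of rim j with be k forces one of rim k with be j, and the
    two require different relations between j and k modulo 7. *)
Lemma rim_neq_be i j : rim i != be j.
Proof.
have st k l : rim k = be l -> be k = rim l /\ exists m, k + 1 = l - 2 + 7 * m.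
  move=> E; have := rim_be k; have := rim_al k; rewrite E => /be_nbr A /be_nbr B.
  have {}B : be k = rim l.
    case: B => // B; first by have := outer_spoke hv l (be_outer k); rewrite B eqxx.
    by have := al_neq_be (l - 2) k; rewrite B eqxx.
  split=> //; case: A => [A|/al_uniq //|A].
    by have := outer_spoke hv l (al_outer (k + 1)); rewrite A eqxx.
  by have := al_neq_be (k + 1) k; rewrite A B eqxx.
apply/eqP => /st[/esym /st[_ [m E]] [m' E']]; clear -E E'; lia.
Qed.

Lemma rim_neq_al i j : rim i != al j.
Proof.
have st k l : rim k = al l -> al (k + 1) = rim (l - 1) /\ exists m, k = l + 2 + 7 * m.
  move=> E; have := rim_be k; have := rim_al k; rewrite E => /al_nbr A /al_nbr B.
  have {}A : al (k + 1) = rim (l - 1).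
    case: A => // A; first by have := outer_spoke hv l (al_outer (k + 1)); rewrite A eqxx.
    by have := al_neq_be (k + 1) (l + 2); rewrite A eqxx.
  split=> //; case: B => [B|/be_uniq //|B].
    by have := outer_spoke hv l (be_outer k); rewrite B eqxx.
  by have := al_neq_be (k + 1) k; rewrite A B eqxx.
apply/eqP => /st[/esym /st[_ [m E]] [m' E']]; clear -E E'; lia.
Qed.

Lemma rim_spoke i j : ~ e (u j) (rim i).
Proof.
have [/andP[a1 a2] /andP[b1 b2]] := (al_outer j, be_outer j).
case/(adj_cases (spoke_adj hv j) a1 b1 _ _ (al_be j)); rewrite 1?eq_sym // => E; first last.
- by have := rim_neq_be i j; rewrite E eqxx.
- by have := rim_neq_al i j; rewrite E eqxx.
have := rim_be i; rewrite E => A; have [_ _ _ /(_ _ A)] := spokeP hv j.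
have o := be_outer i; case=> E'.
- by have := outer_vertex hv (j + 1) o; rewrite E' eqxx.
- by have := outer_vertex hv (j - 1) o; rewrite E' eqxx.
by have := outer_spoke hv j o; rewrite E' eqxx.
Qed.

(** Since u_i is not flat, the heptagon that begins be (i + 2), al i, u_i,
    be i goes on to al (i - 2), and its remaining edge joins one of
    u_(i-2), rim (i - 3) to one of u_(i+2), rim (i + 2). *)
Lemma rim_adj2 i : e (rim (i - 3)) (rim (i + 2)).
Proof.
have H1 := arm_hept i; have H2 := arm_hept (i - 2); have H3 := rim_hept i.
have [E1 E2] : i - 2 + 1 = i - 1 /\ i - 2 + 2 = i by clear; split; lia.
rewrite E1 E2 in H2.
have [/andP[a1 a2] /andP[b1 b2]] := (al_outer i, be_outer i).
have A0 : e (be (i + 2)) (al i) by rewrite adj_sym al_be_adj.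
have A1 : e (al i) (u i) by rewrite adj_sym.
have N0 : be (i + 2) != u i by apply: (outer_spoke hv _ (be_outer _)).
have [x [y [z H]]] := hept_of_arc3 A0 A1 b1 N0 (al_be i).
have xE : x = al (i - 2).
  have := H; rewrite heptE => /and5P[_ _ _ /be_nbr + /and5P[_ _ _ _ /and3P[_ ux _]]].
  case=> // xE; first by rewrite xE eqxx in ux.
  case/negP: (nf (u i)); apply/flatP.
  exists (al i), (be i), (v i), (be (i + 2)), (rim i), (v (i + 1)); split.
  - by rewrite /= !inE negb_or al_be a2 b2.
  - by apply/hept5P; exists y, z; rewrite -xE.
  - by apply/hept5P; do 2!eexists; exact/hept_rot/hept_rot/hept_rot/hept_rot/hept_rot/hept_rot/H3.
  - by apply: hept5_rev; apply/hept5P; do 2!eexists; exact/hept_rot/hept_rot/hept_rot/hept_rot/hept_rot/H1.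
move: H; rewrite xE heptE => /and5P[_ _ _ _ /and5P[xy yz za _ /and5P[_ _ by_ xz /andP[ya zb]]]].
rewrite adj_sym in za; have [E3 E4] : i - 2 - 1 = i - 3 /\ i + 2 - 2 = i by clear; split; lia.
have {xy} yE : y = u (i - 2) \/ y = rim (i - 3).
  case: (al_nbr xy); rewrite ?E2 ?E3 => yE; [by left| |by right].
  by rewrite yE eqxx in by_.
have {za} zE : z = u (i + 2) \/ z = rim (i + 2).
  case: (be_nbr za); rewrite ?E4 => zE; [by left| |by right].
  by rewrite zE eqxx in zb.
(* Spokes are adjacent neither to spokes nor to rim vertices. *)
case: yE yz => ->; case: zE => -> //.
- by move/(spokes_link hv).
- by move/rim_spoke.
- by rewrite adj_sym => /rim_spoke.
Qed.

Lemma rim_mod i j k : i = j + 7 * k -> rim i = rim j.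
Proof.
move=> E; rewrite /rim (be_mod E) (spoke_mod hv E) (hepcycle_mod hv E).
by have -> : v (i + 1) = v (j + 1) by apply: (hepcycle_mod (k := k) hv); rewrite E; clear; lia.
Qed.

(** Every rim vertex rim i is adjacent to be i, al (i + 1) and both rim (i
    - 2) and rim (i + 2). *)
Lemma nonflat_absurd : False.
Proof.
have A i : e (rim i) (rim (i - 2)).
  have := rim_adj2 (i + 3); have -> : i + 3 - 3 = i by clear; lia.
  by have -> : rim (i + 3 + 2) = rim (i - 2) by apply: (rim_mod (k := 1)); clear; lia.
have B : e (rim 0) (rim 2) by rewrite adj_sym; apply: A.
have N : rim 2 != rim (0 - 2).
  apply/eqP => E; have := rim_be (0 - 2); have := rim_be 2; have := rim_al 2; rewrite E => e1 e2 e3.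
  have := A (0 - 2) => e4; apply: (four_nbrs e1 e2 e3 e4).
  rewrite /= !inE !negb_or !al_neq_be ![_ == rim _]eq_sym rim_neq_al !rim_neq_be !andbT /=.
  by apply/eqP => /be_uniq[k]; clear; lia.
apply: (four_nbrs (rim_be 0) (rim_al 0) B (A 0)).
by rewrite /= !inE !negb_or N ![be _ == _]eq_sym al_neq_be !rim_neq_be ![al _ == rim _]eq_sym !rim_neq_al.
Qed.

End Cycle.
End OnePerThreeArc.

(** * The Coxeter graph *)

(** The Coxeter graph by its symmetry of order seven: three heptagons with
    steps 1, 2 and 3, the three tags other than (true, true), and seven
    vertices of tag (true, true), one for each residue, that are joined to
    all three. *)
Definition cox_model : finType := (bool * bool * 'Z_7)%type.

Definition cox_arc (x y : cox_model) : bool :=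
  let: (ax, bx, i) := x in let: (ay, by_, j) := y in
  match ax, bx, ay, by_ with
  | false, false, false, false => j == i + 1
  | false, true, false, true => j == i + 2
  | true, false, true, false => j == i + 3
  | true, true, false, _ | true, true, true, false => j == i
  | _, _, _, _ => false
  end.

Definition cox_adj : rel cox_model := fun x y => cox_arc x y || cox_arc y x.

(** The orbits of the 3-subsets of the Fano plane that are not lines, under
    translation. The plane has the lines {i, i + 1, i + 3}. *)
Definition cox_triple (x : cox_model) : seq 'Z_7 :=
  let: (a, b, i) := x in
  match a, b with
  | false, false => [:: i; i + 2; i + 4]
  | false, true => [:: i; i + 1; i + 4]
  | true, false => [:: i; i + 1; i + 2]
  | true, true => [:: i + 3; i + 5; i + 6]
  end.

Definition line_triple (i : 'Z_7) : seq 'Z_7 := [:: i; i + 1; i + 3].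

Definition residues : seq 'Z_7 := [:: 0; 1; 2; 3; 4; 5; 6].
Definition cox_models : seq cox_model :=
  [seq (ab, i) | ab <- [:: (false, false); (false, true); (true, false); (true, true)], i <- residues].

Lemma mem_residues i : i \in residues.
Proof. by rewrite !inE; case: i => [[|[|[|[|[|[|[|]]]]]]]]. Qed.

Lemma mem_models x : x \in cox_models.
Proof. by case: x => ab i; apply/allpairs_f/mem_residues; case: ab => [[] []]. Qed.

Lemma cox_triple_inj x y : all (mem (cox_triple y)) (cox_triple x) -> x = y.
Proof.
have /allP/(_ x (mem_models x))/allP/(_ y (mem_models y))/implyP H :
  all (fun x => all (fun y => all (mem (cox_triple y)) (cox_triple x) ==> (x == y)) cox_models) cox_models.
  by vm_compute.
by move/H/eqP.
Qed.

Lemma cox_triple_uniq x : uniq (cox_triple x).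
Proof. by have /allP/(_ x (mem_models x)) : all (fun x => uniq (cox_triple x)) cox_models by vm_compute. Qed.

Lemma cox_adjE x y : cox_adj x y = ~~ has (mem (cox_triple y)) (cox_triple x).
Proof.
have /allP/(_ x (mem_models x))/allP/(_ y (mem_models y))/eqP // :
  all (fun x => all (fun y => cox_adj x y == ~~ has (mem (cox_triple y)) (cox_triple x)) cox_models) cox_models.
by vm_compute.
Qed.

Lemma cox_triple_line x i : ~~ all (mem (line_triple i)) (cox_triple x).
Proof.
have /allP/(_ x (mem_models x))/allP/(_ i (mem_residues i)) // :
  all (fun x => all (fun i => ~~ all (mem (line_triple i)) (cox_triple x)) residues) cox_models.
by vm_compute.
Qed.

Lemma line_triple_inj i j : all (mem (line_triple j)) (line_triple i) -> i = j.
Proof.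
have /allP/(_ i (mem_residues i))/allP/(_ j (mem_residues j))/implyP H :
  all (fun i => all (fun j => all (mem (line_triple j)) (line_triple i) ==> (i == j)) residues) residues.
  by vm_compute.
by move/H/eqP.
Qed.

Lemma line_set i : [set i; i + 1; i + 3] = [set t in line_triple i].
Proof. by apply/setP => t; rewrite !inE orbA. Qed.

Lemma cox_vertex_subproof x :
  (#|[set t in cox_triple x]| == 3) && ([set t in cox_triple x] \notin fano_lines).
Proof.
apply/andP; split.
  by rewrite cardsE (card_uniqP (cox_triple_uniq x)); case: x => [[[] []] i].
apply/imsetP => [[i _]]; rewrite line_set => E; have /allP[] := cox_triple_line x i.
by move=> t tx; have := in_set (mem (cox_triple x)) t; rewrite E inE /= tx.
Qed.

Definition cox_vertex x : CoxeterVertex := Sub [set t in cox_triple x] (cox_vertex_subproof x).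

Lemma cox_vertex_inj : injective cox_vertex.
Proof.
move=> x y /(congr1 val) /= E; apply: cox_triple_inj; apply/allP => t tx.
by have := in_set (mem (cox_triple x)) t; rewrite E inE /= tx.
Qed.

Lemma card_CoxeterVertex : #|{: CoxeterVertex}| = 28.
Proof.
rewrite card_sig; pose A := [set t : {set 'Z_7} | #|t| == 3].
have LA : fano_lines \subset A.
  apply/subsetP => _ /imsetP[i _ ->]; rewrite inE line_set cardsE (card_uniqP _) //.
  by have /allP/(_ i (mem_residues i)) : all (fun i => uniq (line_triple i)) residues by vm_compute.
have cL : #|fano_lines| = 7.
  rewrite card_imset ?card_ord // => i j; rewrite !line_set => E.
  apply: line_triple_inj; apply/allP => t tx.
  by have := in_set (mem (line_triple i)) t; rewrite E inE /= tx.
have cA : #|A| = 35 by rewrite card_draws card_ord.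
rewrite (eq_card (B := A :\: fano_lines)); last by move=> t; rewrite !inE andbC.
by rewrite cardsD (setIidPr LA) cA cL.
Qed.

Lemma cox_vertex_bij : bijective cox_vertex.
Proof.
apply: inj_card_bij cox_vertex_inj _.
by rewrite card_CoxeterVertex !card_prod card_bool card_ord.
Qed.

Lemma Coxeter_model : graph_iso cox_adj Coxeter_graph.
Proof.
exists cox_vertex; first exact: cox_vertex_bij.
move=> x y; rewrite cox_adjE /Coxeter_graph /= disjoint_subset; apply/subsetP/hasPn => H t.
  by move=> tx; have := H t; rewrite !inE => /(_ tx).
by rewrite !inE; apply: H.
Qed.

Section FlatIsCoxeter.
Variable G : vtGraph7.
Local Notation e := (@adj G).
Hypothesis U3 : forall a b c d : G, e a b -> e b c -> e c d -> a != c -> b != d -> thru [:: a; b; c; d] = 1%N.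
Hypothesis fl : forall w : G, flat w.
Implicit Types (t : G) (i j k : int).
Variable v : int -> G.
Hypothesis hv : hepcycle v.
Local Notation u := (spoke v).
Local Notation p := (be v).

Lemma p_adj2 i : e (p i) (p (i + 2)).
Proof.
by have := al_be_adj U3 hv i; have := flat_outer U3 hv i; rewrite fl => /esym/eqP ->.
Qed.

(** The outer vertices p, taken with step 2, form a heptagon that has the
    same spokes. *)
Lemma p_hepcycle : hepcycle (fun k => p (2 * k)).
Proof.
split=> k.
- by apply: (be_mod hv (k := 2)); clear; lia.
- by have := p_adj2 (2 * k); have -> // : 2 * k + 2 = 2 * (k + 1) by clear; lia.
apply/eqP => E; have o1 := be_outer U3 hv (2 * k).
have := be_outer U3 hv (2 * (k + 2)); rewrite -E => o2.
by have [m] := outer_uniq U3 hv o1 o2; clear; lia.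
Qed.

Lemma p_spoke k : spoke (fun k => p (2 * k)) k = u (2 * k).
Proof.
have hp := p_hepcycle; have e1 := hc_adj hp k; have e2 := hc_adjV hp k.
have /andP[b1 b2] := be_outer U3 hv (2 * k).
apply: third_eq => //; try exact: hc_back hp k; last 2 first.
- exact: outer_spoke (be_outer U3 hv _).
- exact: outer_spoke (be_outer U3 hv _).
by rewrite adj_sym.
Qed.

Definition ga i := third (u i) (v i) (p i).

Lemma u_nbr i : [/\ e (u i) (ga i), ga i != v i, ga i != p i
  & forall t, e (u i) t -> [\/ t = v i, t = p i | t = ga i]].
Proof.
have /andP[b1 b2] := be_outer U3 hv i.
by apply: thirdP (spoke_adj hv i) b1 _; rewrite eq_sym.
Qed.

Lemma ga_outer i : outer v (ga i) i.
Proof. by have [e1 n1 _ _] := u_nbr i; apply/andP. Qed.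

Lemma ga_mod i j k : i = j + 7 * k -> ga i = ga j.
Proof. by move=> E; rewrite /ga (spoke_mod hv E) (hepcycle_mod hv E) (be_mod hv E). Qed.

(** The heptagon of the p is in the same situation as v: the outer vertices
    of its spokes that its arms reach are not on v, so they are the
    remaining vertices ga. *)
Lemma ga_adj3 i : e (ga i) (ga (i + 3)).
Proof.
suff A k : e (ga (2 * k)) (ga (2 * k + 4)).
  have := A (4 * (i + 3)); rewrite adj_sym.
  have -> : ga (2 * (4 * (i + 3))) = ga (i + 3) by apply: (ga_mod (k := i + 3)); clear; lia.
  by have -> : ga (2 * (4 * (i + 3)) + 4) = ga i by apply: (ga_mod (k := i + 4)); clear; lia.
have hp := p_hepcycle.
set q := be (fun k => p (2 * k)).
have qE l : q l = v (2 * l) \/ q l = ga (2 * l).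
  have /andP[q1 q2] := be_outer U3 hp l; rewrite p_spoke in q1.
  have [_ _ _ /(_ _ q1)] := u_nbr (2 * l); case=> E; [by left| |by right].
  by rewrite /q E eqxx in q2.
have qA l : e (q l) (q (l + 2)).
  by have := al_be_adj U3 hp l; have := flat_outer U3 hp l; rewrite fl => /esym/eqP ->.
have vz l m : ~ e (v l) (ga m).
  move=> A; have [_ _ _ /(_ _ A)] := spokeP hv l; have o := ga_outer m; case=> E.
  - by have := outer_vertex hv (l + 1) o; rewrite E eqxx.
  - by have := outer_vertex hv (l - 1) o; rewrite E eqxx.
  by have := outer_spoke hv l o; rewrite E eqxx.
have vv l : ~ e (v l) (v (l + 4)).
  move=> A; have [_ _ _ /(_ _ A)] := spokeP hv l; case=> E.
  - by have := hc_neq hv (l + 1) (n := 3) isT; rewrite -E; have -> : l + 1 + 3%N%:Z = l + 4 by [clear; lia]; rewrite eqxx.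
  - by have := hc_neq hv (l - 1) (n := 5) isT; rewrite -E; have -> : l - 1 + 5%N%:Z = l + 4 by [clear; lia]; rewrite eqxx.
  by have := spoke_vertex hv l (l + 4); rewrite E eqxx.
have := qA k; have E4 : 2 * (k + 2) = 2 * k + 4 by clear; lia.
case: (qE k) => ->; case: (qE (k + 2)) => ->; rewrite E4 //.
- by move/vv.
- by move/vz.
by rewrite adj_sym => /vz.
Qed.

(** The cycle v, the heptagons of the p and of the ga and the spokes form a
    copy of the model. *)
Lemma flat_Coxeter : graph_iso e Coxeter_graph.
Proof.
have [f fb fE] := Coxeter_model; suff [g gb gE] : graph_iso e cox_adj.
  by exists (f \o g); [apply: bij_comp | move=> x y; rewrite /= fE gE].
have oP i := be_outer U3 hv i; have oZ := ga_outer.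
have pv i j : p i != v j by apply: outer_vertex (oP i).
have zv i j : ga i != v j by apply: outer_vertex (oZ i).
have pu i j : p i != u j by apply: outer_spoke (oP i).
have zu i j : ga i != u j by apply: outer_spoke (oZ i).
have uv i j : u i != v j by apply: spoke_vertex.
have uu i j : u i = u j -> exists k, i = j + 7 * k.
  move=> E; apply: (outer_uniq U3 hv (oP i)); apply/andP; split=> //.
  by rewrite -E; case/andP: (oP i).
have pp i j : p i = p j -> exists k, i = j + 7 * k.
  by move=> E; apply: (outer_uniq U3 hv (oP i)); rewrite E.
have zz i j : ga i = ga j -> exists k, i = j + 7 * k.
  by move=> E; apply: (outer_uniq U3 hv (oZ i)); rewrite E.
have pz i j : p i != ga j.
  apply/eqP => E; have o := oZ j; rewrite -E in o; have [k ij] := outer_uniq U3 hv (oP i) o.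
  by have [_ _ + _] := u_nbr j; rewrite -E (be_mod hv ij) eqxx.
have vv i j : v i = v j -> exists k, i = j + 7 * k.
  move=> E; suff : u i = u j by apply: uu.
  have [_ _ _ N] := spokeP hv j; have := spoke_third hv i; rewrite E => /N[] // F.
    by have := uv i (j + 1); rewrite F eqxx.
  by have := uv i (j - 1); rewrite F eqxx.
pose g (x : cox_model) : G := let: (a, b, i) := x in
  let k := (nat_of_ord i)%:Z in if a then (if b then u k else ga k) else (if b then p k else v k).
have val7 (i j : 'Z_7) k : (nat_of_ord i)%:Z = (nat_of_ord j)%:Z + 7 * k -> i = j.
  have := ltn_ord i; have := ltn_ord j; rewrite -[(Zp_trunc 7).+2]/7%N => j7 i7 E.
  by apply: val_inj => /=; clear -i7 j7 E; lia.
have add7 (i : 'Z_7) (n : nat) : exists k, (nat_of_ord (i + n%:R))%:Z = (nat_of_ord i)%:Z + n%:Z + 7 * k.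
  have := @Zp_int_val 7 ((nat_of_ord i)%:Z + n%:Z) isT.
  have -> : ((nat_of_ord i)%:Z + n%:Z)%:~R = i + n%:R :> 'Z_7 by rewrite intrD; congr (_ + _); apply: natr_Zp.
  by case/dvdzP=> q /eqP; rewrite subr_eq => /eqP ->; exists q; clear; lia.
have shift (w : int -> G) : (forall i j k, i = j + 7 * k -> w i = w j) ->
    forall (i : 'Z_7) (n : nat), w (nat_of_ord (i + n%:R))%:Z = w ((nat_of_ord i)%:Z + n%:Z).
  by move=> wm i n; have [k E] := add7 i n; apply: wm E.
have shV := shift v (fun i j k => hepcycle_mod (k := k) hv); have shP := shift p (be_mod hv); have shZ := shift ga ga_mod.
have arc x y : cox_arc x y -> e (g x) (g y).
  case: x => [[[] []] i]; case: y => [[[] []] j] //= /eqP ->.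
  - by case: (u_nbr (nat_of_ord i)).
  - by case/andP: (oP (nat_of_ord i)).
  - exact: spoke_adj.
  - by rewrite shZ; apply: ga_adj3.
  - by rewrite (shP i 2%N); apply: p_adj2.
  - by rewrite (shV i 1%N); apply: hc_adj.
apply: (@iso_of_covering G _ _ g (false, false, 0)).
- move=> [[[] []] i] [[[] []] j] /= E;
   try by [have := zu (nat_of_ord i) (nat_of_ord j); have := zu (nat_of_ord j) (nat_of_ord i);
     have := pu (nat_of_ord i) (nat_of_ord j); have := pu (nat_of_ord j) (nat_of_ord i);
     have := uv (nat_of_ord i) (nat_of_ord j); have := uv (nat_of_ord j) (nat_of_ord i);
     have := pv (nat_of_ord i) (nat_of_ord j); have := pv (nat_of_ord j) (nat_of_ord i);
     have := zv (nat_of_ord i) (nat_of_ord j); have := zv (nat_of_ord j) (nat_of_ord i);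
     have := pz (nat_of_ord i) (nat_of_ord j); have := pz (nat_of_ord j) (nat_of_ord i); rewrite E eqxx].
  + by have [k /val7 ->] := uu _ _ E.
  + by have [k /val7 ->] := zz _ _ E.
  + by have [k /val7 ->] := pp _ _ E.
  + by have [k /val7 ->] := vv _ _ E.
- by move=> x y /orP[/arc //|/arc]; rewrite adj_sym.
have cyc (w : int -> G) (n : nat) (i : 'Z_7) t : (forall i j k, i = j + 7 * k -> w i = w j) ->
    (forall k, e (w k) (w (k + n%:Z))) -> (forall k, w (k + n%:Z) != w (k - n%:Z)) ->
    (forall k, e (w k) (u k)) -> (forall k j, w k != u j) -> e (w (nat_of_ord i)) t ->
    [\/ t = u (nat_of_ord i), t = w (nat_of_ord (i + n%:R)) | t = w (nat_of_ord (i - n%:R)%R) ].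
  move=> wm wa wd wu wn; have shW := shift w wm.
  have wb k : e (w k) (w (k - n%:Z)) by rewrite adj_sym -{2}(subrK n%:Z k); apply: wa.
  have -> : w (nat_of_ord (i - n%:R)%R) = w ((nat_of_ord i)%:Z - n%:Z).
    have [k] := add7 (i - n%:R) n; rewrite subrK => E.
    by apply: (wm _ _ (- k)); rewrite E; clear; lia.
  rewrite shW; apply: adj_cases => //; by rewrite eq_sym.
move=> [[[] []] i] t /=.
- have [_ _ _ N] := u_nbr (nat_of_ord i); case/N=> ->.
  + by exists (false, false, i) => //; rewrite /cox_adj /= eqxx.
  + by exists (false, true, i) => //; rewrite /cox_adj /= eqxx.
  + by exists (true, false, i) => //; rewrite /cox_adj /= eqxx.
- case/(cyc ga 3%N) => [|||||->|->|->].
  + exact: ga_mod.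
  + exact: ga_adj3.
  + by move=> k; apply/eqP => /zz[m]; clear; lia.
  + by move=> k; case: (u_nbr k); rewrite adj_sym.
  + exact: zu.
  + by exists (true, true, i) => //; rewrite /cox_adj /= eqxx.
  + by exists (true, false, i + 3%:R) => //; rewrite /cox_adj /= eqxx.
  + by exists (true, false, i - 3%:R) => //; rewrite /cox_adj /= subrK eqxx orbT.
- case/(cyc p 2%N) => [|||||->|->|->].
  + exact: be_mod.
  + exact: p_adj2.
  + by move=> k; apply/eqP => /pp[m]; clear; lia.
  + by move=> k; rewrite adj_sym; case/andP: (oP k).
  + exact: pu.
  + by exists (true, true, i) => //; rewrite /cox_adj /= eqxx.
  + by exists (false, true, i + 2%:R) => //; rewrite /cox_adj /= eqxx.
  + by exists (false, true, i - 2%:R) => //; rewrite /cox_adj /= subrK eqxx orbT.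
case/(cyc v 1%N) => [|||||->|->|->].
- by move=> ? ? ?; apply: hepcycle_mod.
- exact: hc_adj.
- exact: hc_back.
- exact: spoke_third.
- by move=> k j; rewrite eq_sym.
- by exists (true, true, i) => //; rewrite /cox_adj /= eqxx.
- by exists (false, false, i + 1%:R) => //; rewrite /cox_adj /= eqxx.
- by exists (false, false, i - 1%:R) => //; rewrite /cox_adj /= subrK eqxx orbT.
Qed.
End FlatIsCoxeter.

(** Any heptagon serves as starting point. *)
Lemma coxeter (G : vtGraph7) :
  (forall a b c d : G, adj a b -> adj b c -> adj c d -> a != c -> b != d -> thru [:: a; b; c; d] = 1%N) ->
  graph_iso (@adj G) Coxeter_graph.
Proof.
move=> U3; have [a [b [c [d [x [y [z H]]]]]]] := hept_ex G.
have [v hv _] := hepcycle_ex H.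
have [/existsP[w fw]|nf] := boolP [exists w : G, flat w].
  by apply: (flat_Coxeter U3 _ hv) => w'; apply: flat_any fw.
case: (nonflat_absurd U3 hv) => w; apply: contra nf => fw; by apply/existsP; exists w.
Qed.

Local Close Scope ring_scope.

(** * The classification *)

Section Signatures.
Variable G : vtGraph7.
Local Notation e := (@adj G).

Lemma matching_signature (M : matching G) m f :
  (forall v p q, off M v p -> off M v q -> thru [:: v; p] = thru [:: v; q]) ->
  (forall v, thru [:: v; M v] = m) -> (forall v : G, thru [:: v] = m + f + f) ->
  forall v, vertex_signature e v = sort leq [:: m; f; f].
Proof.
move=> Feq mE tE v; have [p [q [Mp Mq pq N]]] := nbr_split (mate_adj M v).
have Fp : off M v p by rewrite /off N eqxx orbT eq_sym.
have Fq : off M v q by rewrite /off N eqxx !orbT eq_sym.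
have := tE v; rewrite (thru1 Mp Mq pq N) (Feq v q p Fq Fp) mE => E.
have pE : thru [:: v; p] = f by clear -E; lia.
rewrite (@signature_thru _ v (M v) p q) ?N ?eqxx ?orbT //.
by rewrite mE (Feq v q p Fq Fp) pE.
Qed.

Lemma arc_transitive_signature k : arc_transitive G ->
  (forall a b c : G, e a b -> e b c -> a != c -> thru [:: a; b; c] = k) ->
  forall v, vertex_signature e v = nseq 3 (2 * k).
Proof.
move=> at2 U v; have [p [q [r [pq pr qr N]]]] := nbr_enum v.
have T w : e v w -> thru [:: v; w] = 2 * k.
  move=> vw; have [b [c [vb vc bc Nw]]] : exists b c, [/\ v != b, v != c, b != c & forall y, e w y = [|| y == v, y == b | y == c]].
    by apply: nbr_split; rewrite adj_sym.
  by rewrite (@thru3_half G at2 v w b) ?(U v w b) // Nw eqxx orbT.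
rewrite (@signature_thru _ v p q r) ?N ?eqxx ?orbT // !T ?N ?eqxx ?orbT //.
by apply: sorted_sort; [exact: leq_trans | rewrite /= leqnn].
Qed.
End Signatures.

Theorem girth7_classification (G : vtGraph7) (e := @adj G) :
  (has_signature e 0 1 1 /\
     exists (L : multigraph) (r : rel (mg_arc L)),
       [/\ mg_regular L 7, dihedral_scheme r, scheme_arc_transitive r
         & graph_iso e (truncation r)]) \/
  (has_signature e 2 2 2 /\
     exists C : {set {set {set G}}},
       [/\ cubic_map e C, map_type e C 7, rotary e C
         & ((euler_char e C)%:~R = #|G|%:R * (3 / 7 - 1 / 2) :> rat)%R]) \/
  (has_signature e 4 4 4 /\ graph_iso e Coxeter_graph) \/
  (has_signature e 4 4 6 /\
     exists n : nat,
       [/\ 3 <= n, is_cayley_graph (Agraph (3 * n))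
         & graph_iso e (Agraph (3 * n))]) \/
  (has_signature e 4 5 5 /\
     [\/ graph_iso e (Pet 13 5), graph_iso e (Pet 15 4)
       | graph_iso e (Pet 17 4)]).
Proof.
case: (matching_or_arc_transitive G) => [[M Feq]|at2]; last first.
  have [U2|U3] := arc_transitive_counts at2; [right; left|right; right; left].
    split; first exact: (arc_transitive_signature at2 U2).
    exists (faces G); split; [exact: faces_cubic_map| |exact: faces_rotary|exact: faces_euler].
    by move=> F; rewrite inE.
  split; last exact: coxeter.
  apply: (@arc_transitive_signature G 2 at2) => a b c ab bc ac.
  have cb : e c b by rewrite /e adj_sym.
  have [d [f [bd bf df N]]] := nbr_split cb.
  by rewrite (thru3 a df bd bf N) !U3 // N eqxx ?orbT.
have [v0 _] := hept_ex G.
have sig k0 k23 k14 k112 m f : cnt M v0 pat0 = k0 -> cnt M v0 pat23 = k23 -> cnt M v0 pat14 = k14 ->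
    cnt M v0 pat112 = k112 -> m = 2 * k23 + 2 * k14 + 3 * k112 ->
    m + f + f = k0 + 7 * (k23 + k14 + k112) -> forall v, vertex_signature e v = sort leq [:: m; f; f].
  move=> E0 E1 E2 E3 mE fE; apply: (matching_signature Feq) => v; have [_ t1 t2 _] := pattern_counts M v.
    by rewrite t2 no_pat1 !(cnt_any M v v0) E1 E2 E3 mE.
  by rewrite t1 no_pat1 !(cnt_any M v v0) E0 E1 E2 E3 fE.
have [c0 _ _] := pattern_counts M v0; rewrite no_pat1.
rewrite !inE !xpair_eqE /= => /or4P[].
- case/andP=> /andP[/eqP E1 /eqP E2] /eqP E3; left.
  have E0 : cnt M v0 pat0 = 2.
    have [_ t1 _ _] := pattern_counts M v0; have := thru1_gt0 v0; rewrite t1 no_pat1 E1 E2 E3.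
    by move: c0; rewrite !inE => /orP[]/eqP ->.
  split; first exact: (sig 2 0 0 0 0 1 E0 E1 E2 E3).
  apply: (@truncation_of_quotient G M) => v; have [_ _ t2 _] := pattern_counts M v.
  by rewrite t2 no_pat1 !(cnt_any M v v0) E1 E2 E3.
- case/andP=> /andP[/eqP E1 /eqP E2] /eqP E3; do 4!right.
  have [iso E0] : graph_iso e (Pet 13 5) /\ cnt M v0 pat0 = 0 by apply: pet13; rewrite E1.
  by split; [exact: (sig 0 2 0 0 4 5 E0 E1 E2 E3)|constructor 1].
- case/andP=> /andP[/eqP E1 /eqP E2] /eqP E3; do 4!right.
  have [iso E0] : (graph_iso e (Pet 15 4) \/ graph_iso e (Pet 17 4)) /\ cnt M v0 pat0 = 0.
    by apply: (pet15_17 Feq); rewrite E2.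
  split; first exact: (sig 0 0 2 0 4 5 E0 E1 E2 E3).
  by case: iso => iso; [constructor 2|constructor 3].
case/andP=> /andP[/eqP E1 /eqP E2] /eqP E3; do 3!right; left.
have [[|n] n3 [iso E0]] : exists2 n, 2 < n & graph_iso e (Agraph (3 * n)) /\ cnt M v0 pat0 = 0.
- by apply: (Agraph_iso Feq); rewrite E3.
- by [].
split; first exact: (sig 0 0 0 2 6 4 E0 E1 E2 E3).
by exists n.+1; split=> //; apply: Agraph_cayley.
Qed.

Theorem theorem1 (T : finType) (e : rel T)
    (e_sym : symmetric e) (e_irr : irreflexive e)
    (e_conn : graph_connected e) (e_cubic : cubic e)
    (e_vt : vertex_transitive e) (e_girth : girth e = 7) :
  (has_signature e 0 1 1 /\
     exists (L : multigraph) (r : rel (mg_arc L)),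
       [/\ mg_regular L 7, dihedral_scheme r, scheme_arc_transitive r
         & graph_iso e (truncation r)]) \/
  (has_signature e 2 2 2 /\
     exists C : {set {set {set T}}},
       [/\ cubic_map e C, map_type e C 7, rotary e C
         & ((euler_char e C)%:~R = #|T|%:R * (3 / 7 - 1 / 2) :> rat)%R]) \/
  (has_signature e 4 4 4 /\ graph_iso e Coxeter_graph) \/
  (has_signature e 4 4 6 /\
     exists n : nat,
       [/\ 3 <= n, is_cayley_graph (Agraph (3 * n))
         & graph_iso e (Agraph (3 * n))]) \/
  (has_signature e 4 5 5 /\
     [\/ graph_iso e (Pet 13 5), graph_iso e (Pet 15 4)
       | graph_iso e (Pet 17 4)]).
Proof. exact: (girth7_classification (VtGraph7 e_sym e_irr e_conn e_cubic e_vt e_girth)). Qed.
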